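(* Let $\delta$ be a real number with $\frac{5}{6}<\delta<1$, and let $k=k(n)$ and $r=r(n)$ be positive integers with $k=o(\sqrt{n})$ and $r=o(n)$. There is a constant integer $N=N(k,\delta,r)$ such that for any graph $G$ with $n\geq N$ vertices and any decomposition $\mathcal{G}=\{G_1,G_2,\ldots,G_k\}$ of $G$ satisfying the following conditions: \begin{itemize} \item $1\leq |E(G_1)|\leq |E(G_{2})|\leq \cdots\leq |E(G_k)|$, \item either $k\leq 2$ or $\sum_{i=1}^3|E(G_i)|\geq 3\binom{2k-3}{2}+4$, \item $G_k$ is a spanning subgraph of $G$ with minimum degree $\delta(G_k)\geq \delta n$, \end{itemize} we have $$\chi(\mathrm{KG}(G,\mathcal{G},\mathcal{T}_{n-r}))=\mathrm{cut}_{r+1}(G,\mathcal{G}).$$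
   Context: Graphs are finite, simple and unlabeled; $\chi$ denotes the chromatic number and $\delta(H)$ the minimum degree of a graph $H$. The quantities $k,r$ may depend on $n$; the $o(\cdot)$ notation is as $n\to\infty$, and the threshold $N$ depends only on $\delta$ and on $k,r$ as functions of $n$. A decomposition of a graph $G$ is a family $\mathcal{G}=\{G_1,\ldots,G_k\}$ of pairwise edge-disjoint subgraphs of $G$ whose edge sets partition $E(G)$. For a family $\mathcal{G}=\{G_1,\ldots,G_k\}$ of nonempty subgraphs of $G$ (each with at least one edge), a subgraph $H$ of $G$ is a $\mathcal{G}$-subgraph if $E(H)\cap E(G_i)\neq\varnothing$ for every $1\le i\le k$. For a family $\mathcal{F}$ of graphs, $\mathrm{KG}(G,\mathcal{G},\mathcal{F})$ is the graph whose vertices are all $\mathcal{G}$-subgraphs of $G$ isomorphic to some member of $\mathcal{F}$, two being adjacent if they are edge-disjoint. The number $\mathrm{ex}(G,\mathcal{G},\mathcal{F})$ is the maximum number of edges of a spanning subgraph of $G$ that contains no $\mathcal{G}$-subgraph isomorphic to a member of $\mathcal{F}$. $\mathcal{T}_t$ denotes the family of all tree subgraphs of $G$ with exactly $t$ vertices. For $G$ with $n$ vertices, a family $\mathcal{G}$ of pairwise edge-disjoint subgraphs of $G$, and $1\le i\le n-1$, the $i$-th cut number of $G$ with respect to $\mathcal{G}$ is $$\mathrm{cut}_i(G,\mathcal{G})=|E(G)|-\mathrm{ex}(G,\mathcal{G},\mathcal{T}_{n-i+1}).$$ *)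

(* Defs.v *)
From HB Require Import structures.
From mathcomp Require Import all_boot.
From mathcomp Require Import boolp.

Set Implicit Arguments.
Unset Strict Implicit.
Unset Printing Implicit Defensive.

(* A finite simple graph whose vertex set and edge set are drawn from an       *)
(* ambient finite type V.  The vertex set need not be all of V, so a graph and *)
(* its subgraphs live in the same (finite) type.                               *)
Record sgraph (V : finType) := SGraph {
  sgraph_val : {set V} * {set {set V}};
  _ : [forall e in sgraph_val.2, (#|e| == 2) && (e \subset sgraph_val.1)] }.

HB.instance Definition _ (V : finType) := [isSub for @sgraph_val V].
HB.instance Definition _ (V : finType) := [Finite of sgraph V by <:].

Definition vertices (V : finType) (H : sgraph V) : {set V} := (sgraph_val H).1.
Definition edges (V : finType) (H : sgraph V) : {set {set V}} := (sgraph_val H).2.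
Definition adj (V : finType) (H : sgraph V) : rel V :=
  fun x y => [set x; y] \in edges H.

(* The pairs {x, y} with x, y in A, x != y and r x y; the relation r is        *)
(* symmetrized and made irreflexive.                                           *)
Definition rel_edges (V : finType) (A : {set V}) (r : rel V) : {set {set V}} :=
  [set e | [exists x in A, exists y in A,
              [&& x != y, r x y & e == [set x; y]]]].

Fact rel_edgesP (V : finType) (A : {set V}) (r : rel V) :
  [forall e in (A, rel_edges A r).2,
    (#|e| == 2) && (e \subset (A, rel_edges A r).1)].
Proof.
apply/forall_inP => e /=; rewrite inE.
case/exists_inP => x xA /exists_inP[y yA /and3P[xy _ /eqP->]].
by rewrite cards2 xy subUset !sub1set xA yA.
Qed.

Definition rel_graph (V : finType) (A : {set V}) (r : rel V) : sgraph V :=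
  SGraph (rel_edgesP A r).

Section Basics.
Variable V : finType.
Implicit Types G H : sgraph V.

Definition degree H (x : V) : nat := #|[set y | adj H x y]|.

(* Every degree is less than #|vertices H|, so the neutral element of this     *)
(* minimum is harmless when H has a vertex.                                    *)
Definition min_degree H : nat :=
  \big[minn/#|vertices H|]_(x in vertices H) degree H x.

Definition subgraph H G : bool :=
  (vertices H \subset vertices G) && (edges H \subset edges G).

Definition spanning H G : bool := subgraph H G && (vertices H == vertices G).

Definition edge_disjoint G H : bool := [disjoint edges G & edges H].

Definition isomorphic G H : bool :=
  [exists f : {ffun V -> V},
    [&& f @: vertices G == vertices H,
        [forall x in vertices G, forall y in vertices G,
           (f x == f y) ==> (x == y)]
      & [forall x in vertices G, forall y in vertices G,
           adj H (f x) (f y) == adj G x y]]].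

Definition is_connected H : bool :=
  (vertices H != set0) &&
  [forall x in vertices H, forall y in vertices H, connect (adj H) x y].

(* The requirement 2 < size c excludes the closed walk x, y, x along an edge.  *)
Definition acyclic H : Prop :=
  forall c : seq V, 2 < size c -> ~ ucycle (adj H) c.

Definition is_tree H : bool := is_connected H && `[< acyclic H >].

Definition colorable H (m : nat) : bool :=
  [exists c : {ffun {x : V | x \in vertices H} -> 'I_m},
    [forall x, forall y, adj H (val x) (val y) ==> (c x != c y)]].

Fact colorable_exists H : exists m, colorable H m.
Proof.
exists #|{: {x : V | x \in vertices H}}|.
apply/existsP; exists [ffun x => enum_rank x].
apply/forallP=> x; apply/forallP=> y; apply/implyP=> xy.
rewrite !ffunE (inj_eq enum_rank_inj); apply: contraTneq xy => ->.
case: H {x} y => h hP y; rewrite /adj /edges /= setUid.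
apply/negP => eh; have /andP[/eqP] := forall_inP hP _ eh.
by rewrite cards1.
Qed.

Definition chromatic_number H : nat := ex_minn (colorable_exists H).

End Basics.

Section Kneser.
Variables (V : finType) (k : nat).
Implicit Types (G H S : sgraph V) (D : 'I_k -> sgraph V) (F : {set sgraph V}).

Definition decomposition G D : bool :=
  [&& [forall i, subgraph (D i) G],
      [forall i, forall j, (i != j) ==> edge_disjoint (D i) (D j)]
    & \bigcup_i edges (D i) == edges G].

Definition family_subgraph G D H : bool :=
  subgraph H G && [forall i, edges H :&: edges (D i) != set0].

Definition in_family F H : bool := [exists H' in F, isomorphic H H'].

(* Its vertices are graphs; rel_graph restricts adjacency to distinct ones.     *)
Definition kneser_graph G D F : sgraph (sgraph V) :=
  rel_graph [set H | family_subgraph G D H && in_family F H]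
            (@edge_disjoint V).

Definition ex_number G D F : nat :=
  \max_(S : sgraph V | spanning S G &&
          [forall H, ~~ [&& subgraph H S, family_subgraph G D H
                          & in_family F H]]) #|edges S|.

Definition tree_family G (t : nat) : {set sgraph V} :=
  [set T | [&& subgraph T G, is_tree T & #|vertices T| == t]].

(* Meaningful for 1 <= i <= #|vertices G| - 1.  Both subtractions are then     *)
(* exact, since ex_number G D F <= #|edges G|.                                 *)
Definition cut_number G D (i : nat) : nat :=
  #|edges G| - ex_number G D (tree_family G (#|vertices G| - i + 1)).

End Kneser.

(* Main.v *)
Require Import Defs.
From mathcomp Require Import all_boot perm boolp zify.
Set Implicit Arguments.
Unset Strict Implicit.
Unset Printing Implicit Defensive.

(** Write c for the cut number.

    Upper bound: fix an extremal spanning subgraph and colour every tree by one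
    of its edges outside that subgraph; trees of the same colour then share an
    edge ([chromatic_upper]).

    Lower bound: this is a topological argument in the manner of Kneser's
    conjecture.  By [kneser_alternating], a consequence of the octahedral Tucker
    lemma, it is enough to order the edges of G so well that, whenever fewer
    than c edges are deleted and the others receive alternating signs along the
    order, one of the two signs contains a tree of the family.  Deleting a whole
    class, or all the edges that leave a set U with r < |U| < n - r, destroys
    every such tree; so each class and each such cut has at least c edges.

    The order ([ordering]) is assembled from trails and gadgets.  Two
    consecutive edges at a vertex v have opposite signs when both survive.  So a
    vertex whose surviving edges all have the same sign has lost about half of
    its edges.  Two gadgets sharpen this.  A hub gadget lists the edges xa, xb,
    ya, yb, za, zb; if it survives, then x is joined to y and z through a in one
    sign and through b in the other.  There are so many hubs that few deletions
    leave one of them, x, tied to 60% of the vertices in both signs.  A bow-tie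
    consists of two 4-cycles through u; it costs three deletions, rather than
    two, when the edges at u have one sign only.  The bow-ties pay for the ends
    of the trails, so that such a u really loses half of its degree.

    Now let U_b be the set of vertices that the edges of sign b do not connect
    to x.  A vertex without an edge of sign b to the vertices tied to x has lost
    n/100 edges, hence there are O(r) of them, and U_b is among them.  If
    |U_b| <= r, then a forest with one edge of each class can be chosen
    greedily in the component of x ([rainbow_forest]) and extended to a tree
    with n - r vertices ([tree_of_inner]), unless a class misses the component
    or three classes meet it in very few edges.  The lower bound on the three
    smallest classes excludes the latter ([no_sparse_triple]).  A class that
    misses the component contains all deleted edges, and all its other edges
    have the sign opposite to b; if this happens for both signs, nothing is
    deleted and two classes are single edges of opposite signs, which the
    beginning of the order forbids ([two_failures]).  There remains the case
    that both U_b have more than r vertices.  No edge of sign b leaves U_b.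
    Therefore a vertex of only one of the two sets has lost half of its degree,
    up to terms for which the bow-ties pay, and the edges from a vertex of both
    sets to the outside are all deleted.  So twice the number of deleted edges is
    at least the sum of the sizes of the two cuts, that is at least 2c
    ([no_double_cut]): a contradiction. *)

(** * Parity of alternating label sets *)

Lemma odd_sum (I : Type) (r : seq I) (P : pred I) (F : I -> nat) :
  odd (\sum_(i <- r | P i) F i) = \big[addb/false]_(i <- r | P i) odd (F i).
Proof. by elim/big_rec2: _ => // i b m _ <-; rewrite oddD. Qed.

Lemma even_involution (T : finType) (A : {set T}) (phi : T -> T) :
  {in A, forall x, [/\ phi x \in A, phi x != x & phi (phi x) = x]} ->
  ~~ odd #|A|.
Proof.
move: {2}(#|A|) (leqnn #|A|) => m; elim: m A => [|m IH] A.
  by rewrite leqn0 => /eqP->.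
move=> leAm phiA; have [->|[x xA]] := set_0Vmem A; first by rewrite cards0.
have [pxA pxx ppx] := phiA _ xA.
have pxA' : phi x \in A :\ x by rewrite in_setD1 pxx.
rewrite (cardsD1 x) xA (cardsD1 (phi x)) pxA' !add1n /= negbK.
apply: IH; first by move: leAm; rewrite (cardsD1 x) xA (cardsD1 (phi x)) pxA'; lia.
move=> y; rewrite !in_setD1 => /and3P[ypx yx yA].
have [pyA pyy ppy] := phiA _ yA.
split=> //; rewrite pyA andbT; apply/andP; split.
  by apply: contra yx => /eqP e; rewrite -ppy e ppx.
by apply: contra ypx => /eqP e; rewrite -ppy e.
Qed.

(** A label +a or -a is encoded as a natural number whose half is a and whose
    parity is the sign. *)
Fixpoint alts (s : bool) (L : seq nat) : bool :=
  if L is x :: L' then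
    [&& odd x == s, all (fun y => x./2 < y./2) L' & alts (~~ s) L']
  else true.

Definition antipodal_free (L : seq nat) :=
  {in L &, forall x y, x./2 = y./2 -> x = y}.

Lemma alts_uniq s L : alts s L -> uniq L.
Proof.
elim: L s => //= x L IH s /and3P[_ al /IH->]; rewrite andbT.
by apply/negP => /(allP al); rewrite ltnn.
Qed.

(** If L alternates, exactly one deletion keeps the sign of the first entry,
    namely that of the last entry, and exactly one reverses it, namely that of
    the first.  If L does not alternate but a deletion makes it so, the deleted
    entry has a neighbour with the same sign, which can be deleted instead: the
    good deletions come in pairs. *)
Lemma alts_del s L : sorted leq L -> antipodal_free L ->
  odd (\sum_(x <- L) alts s (rem x L)) = alts s L (+) alts (~~ s) L.
Proof.
elim: L s => [|x L IH] s sL fL; first by rewrite big_nil.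
have fL' : antipodal_free L by move=> y z yL zL; apply: fL; rewrite inE ?yL ?zL orbT.
have sL' : sorted leq L by apply: path_sorted sL.
have lex : all (leq x) L by move: sL; rewrite /= (path_sortedE leq_trans) => /andP[].
rewrite big_cons /= eqxx.
have [xL|xL] := boolP (x \in L).
  have -> : all (fun y => x./2 < y./2) L = false.
    by apply/negbTE/negP => /allP/(_ _ xL); rewrite ltnn.
  rewrite !andbF /=.
  rewrite (eq_big_seq (fun y => if y == x then nat_of_bool (alts s L) else 0)); last first.
    move=> y yL; rewrite (eq_sym x).
    case: eqP => // yx /=.
    case: (boolP (all _ (rem y L))) => [/allP/(_ x)|]; last by rewrite andbF.
    rewrite ltnn => h; have // : false by apply: h; move: xL; rewrite (perm_mem (perm_to_rem yL)) inE => /orP[/eqP e|//]; case: yx.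
  rewrite -big_mkcond /= big_const_seq iter_addn_0 oddD oddM.
  case aL: (alts s L); rewrite ?andbF //=.
  by rewrite (count_uniq_mem _ (alts_uniq aL)) xL.
have ltx : all (fun y => x./2 < y./2) L.
  apply/allP => y yL; rewrite ltn_neqAle half_leq ?(allP lex) // andbT.
  apply: contra xL => /eqP h.
  by rewrite (fL x y _ _ h) // inE ?eqxx // yL orbT.
rewrite (eq_big_seq (fun y => (odd x == s) * alts (~~ s) (rem y L))); last first.
  move=> y yL; rewrite [x == y](negbTE _); last by apply: contraNneq xL => ->.
  rewrite /= (_ : all _ (rem y L)) ?mulnb //.
  by apply/allP => z /mem_rem; apply: (allP ltx).
rewrite -big_distrr /= oddD oddM IH // negbK ltx /=.
by case: (odd x) s => -[] /=; case: (alts true L); case: (alts false L).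
Qed.

Definition altl s L := alts s (sort leq L).

Lemma altl_perm s L1 L2 : perm_eq L1 L2 -> altl s L1 = altl s L2.
Proof.
by move=> p; rewrite /altl; congr alts; apply/perm_sortP;
  [exact: leq_total|exact: leq_trans|exact: anti_leq|].
Qed.

(** * An octahedral Tucker lemma *)

Definition flip (v : nat) : nat := ~~ odd v + (v./2).*2.

Lemma odd_flip v : odd (flip v) = ~~ odd v.
Proof. by rewrite /flip oddD odd_double addbF oddb. Qed.

Lemma half_flip v : (flip v)./2 = v./2.
Proof. by rewrite /flip half_bit_double. Qed.

Lemma altl_flip s L : antipodal_free L -> altl s (map flip L) = altl (~~ s) L.
Proof.
move=> fL; have hL : {in L &, {homo flip : x y / x <= y}}.
  move=> x y xL yL lexy; move: (half_leq lexy); rewrite leq_eqVlt => /orP[/eqP e|lt].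
    by rewrite (fL x y).
  by rewrite -(odd_double_half (flip x)) -(odd_double_half (flip y)) !half_flip;
    case: (odd _) (odd _) => -[]; lia.
have -> : altl s (map flip L) = alts s (map flip (sort leq L)).
  congr alts; apply: (sorted_eq leq_trans anti_leq).
  - exact: (sort_sorted leq_total).
  - have : sorted leq (sort leq L) by exact: (sort_sorted leq_total).
    have sub : {subset sort leq L <= L} by move=> x; rewrite mem_sort.
    elim: (sort leq L) sub => //= x [|y r] IH //= sub /andP[lexy sr].
    rewrite hL ?sub ?inE ?eqxx ?orbT //=; apply: IH => // z zr.
    by apply: sub; rewrite inE zr orbT.
  - by rewrite perm_sort perm_map // perm_sym perm_sort.
rewrite /altl; elim: (sort leq L) s => //= x r IH s.
rewrite odd_flip IH all_map; congr [&& _, _ & _]; first by case: (odd x) s => -[].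
by apply: eq_all => y /=; rewrite !half_flip.
Qed.

Lemma perm_del (I : eqType) (f : I -> nat) (J : seq I) i : i \in J ->
  perm_eq (map f (rem i J)) (rem (f i) (map f J)).
Proof.
move=> iJ; have := perm_map f (perm_to_rem iJ); rewrite /= => p.
have fJ : f i \in map f J by apply: map_f.
by rewrite -(perm_cons (f i)) perm_sym -(permPl (perm_to_rem fJ)).
Qed.

Lemma altl_del s (I : eqType) (f : I -> nat) (J : seq I) :
  antipodal_free (map f J) ->
  odd (\sum_(i <- J) altl s (map f (rem i J))) =
  altl s (map f J) (+) altl (~~ s) (map f J).
Proof.
move=> fJ; set L := map f J in fJ *.
rewrite (eq_big_seq (fun i => altl s (rem (f i) L) : nat)); last first.
  by move=> i iJ; rewrite (altl_perm _ (perm_del f iJ)).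
rewrite -(big_map f xpredT (fun x => altl s (rem x L) : nat)) -/L.
have pL : perm_eq (sort leq L) L by rewrite perm_sort.
rewrite -(perm_big _ pL) /=.
rewrite (eq_big_seq (fun x => alts s (rem x (sort leq L)) : nat)).
  apply: alts_del; first exact: (sort_sorted leq_total).
  by move=> x y; rewrite !mem_sort; apply: fJ.
move=> x; rewrite mem_sort => xL; congr nat_of_bool; congr alts.
apply: (sorted_eq leq_trans anti_leq); first exact: (sort_sorted leq_total).
  apply: (subseq_sorted leq_trans (rem_subseq _ _)); exact: (sort_sorted leq_total).
rewrite perm_sort -(perm_cons x) -(permPl (perm_to_rem xL)).
rewrite perm_sym in pL; rewrite (permPl pL).
by apply: perm_to_rem; rewrite mem_sort.
Qed.

Section Tucker.
Variables (n : nat) (lam : {set 'I_n * bool} -> nat).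
Implicit Types A B : {set 'I_n * bool}.

Definition opp (x : 'I_n * bool) := (x.1, ~~ x.2).
Definition oppset A := [set opp x | x in A].
(** The nonempty consistent sets of signed coordinates are the faces of the
    boundary of the n-dimensional cross-polytope. *)
Definition consistent A := forall i, ~ ((i, true) \in A /\ (i, false) \in A).

Hypothesis lam_opp : forall A, A != set0 -> consistent A ->
  lam (oppset A) = flip (lam A).
(** Nested faces never carry opposite labels. *)
Hypothesis lam_mono : forall A B, A != set0 -> consistent B -> A \subset B ->
  (lam A)./2 = (lam B)./2 -> lam A = lam B.

Section Chains.
Variable d : nat.
Implicit Types w : {ffun 'I_d -> 'I_n * bool}.

(** The prefixes of w form a maximal flag of faces of the d-dimensional
    cross-polytope; chains are the facets of its barycentric subdivision. *)
Definition chain w := injectiveb (fun i => (w i).1) && [forall i, (w i).1 < d].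
Definition prefix_set w (i : 'I_d) := [set w j | j : 'I_d & j <= i].
Definition lab w i := lam (prefix_set w i).
Definition labs w := [seq lab w i | i <- enum 'I_d].

Lemma chain_inj w : chain w -> injective (fun i => (w i).1).
Proof. by case/andP => /injectiveP. Qed.

Lemma prefix_neq0 w i : prefix_set w i != set0.
Proof. by apply/set0Pn; exists (w i); apply: imset_f; rewrite inE. Qed.

Lemma prefix_consistent w i : chain w -> consistent (prefix_set w i).
Proof.
move=> /chain_inj wI c [/imsetP[j _ ej] /imsetP[k _ ek]].
have jk : j = k by apply: wI; rewrite -ej -ek.
by move: ek; rewrite -jk -ej.
Qed.

Lemma prefixS w (i j : 'I_d) : i <= j -> prefix_set w i \subset prefix_set w j.
Proof.
move=> leij; apply: imsetS; apply/subsetP => k; rewrite !inE => h.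
exact: leq_trans h leij.
Qed.

Lemma labs_free w : chain w -> antipodal_free (labs w).
Proof.
move=> cw x y /mapP[i _ ->] /mapP[j _ ->].
wlog leij : i j / (i <= j)%N.
  by move=> H h; case/orP: (leq_total i j) => [/H|/H e]; [exact|exact/esym/e/esym].
apply: lam_mono; [exact: prefix_neq0|exact: prefix_consistent|exact: prefixS].
Qed.

Definition oppw w := [ffun i => opp (w i)].

Lemma oppK : involutive opp.
Proof. by case=> a b; rewrite /opp negbK. Qed.

Lemma oppwK : involutive oppw.
Proof. by move=> w; apply/ffunP => i; rewrite !ffunE oppK. Qed.

Lemma chain_opp w : chain (oppw w) = chain w.
Proof.
rewrite /chain; congr andb.
  by apply/injectiveP/injectiveP => h i j; have := h i j; rewrite !ffunE.
by apply: eq_forallb => i; rewrite ffunE.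
Qed.

Lemma prefix_opp w i : prefix_set (oppw w) i = oppset (prefix_set w i).
Proof.
apply/setP => x; apply/imsetP/imsetP.
  by move=> [j ji ->]; exists (w j); [apply: imset_f|rewrite ffunE].
by move=> [y /imsetP[j ji ->] ->]; exists j => //; rewrite ffunE.
Qed.

Lemma labs_opp w : chain w -> labs (oppw w) = map flip (labs w).
Proof.
move=> cw; rewrite /labs -map_comp; apply: eq_map => i /=.
rewrite /lab prefix_opp lam_opp //; [exact: prefix_neq0|exact: prefix_consistent].
Qed.

End Chains.

Definition nalt d := #|[set w : {ffun 'I_d -> 'I_n * bool} | chain w && altl true (labs w)]|.

Section Step.
Variables (d : nat) (ltdn : d < n).
Let cd : 'I_n := Ordinal ltdn.
Implicit Types w : {ffun 'I_d.+1 -> 'I_n * bool}.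

(** A chain of length d+1 uses the axis d; its sign there tells the hemisphere. *)
Definition up w := [exists j, w j == (cd, true)].

Lemma chain_top w : chain w -> exists j, (w j).1 = cd.
Proof.
move=> /andP[/injectiveP wI /forallP wd].
pose f (i : 'I_d.+1) : 'I_d.+1 := Ordinal (wd i).
have fI : injective f by move=> i j [e]; apply: wI; apply: val_inj.
have [g fK gK] := injF_bij fI.
by exists (g ord_max); apply: val_inj; have := congr1 val (gK ord_max).
Qed.

Lemma up_opp w : chain w -> up (oppw w) = ~~ up w.
Proof.
move=> cw; have [j ej] := chain_top cw.
have E b : [exists i, w i == (cd, b)] = ((w j).2 == b).
  apply/existsP/eqP => [[i /eqP ei]|ej2].
    have -> : j = i by apply: (chain_inj cw); rewrite ej ei.
    by rewrite ei.
  by exists j; rewrite -ej2 -ej; case: (w j).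
transitivity ((w j).2 == false); last by rewrite /up E; case: (w j).2.
rewrite -E; apply: eq_existsb => i; rewrite ffunE /opp.
by case: (w i) => a []; rewrite !xpair_eqE.
Qed.

Definition labsD w i := [seq lab w j | j <- rem i (enum 'I_d.+1)].

Definition facets i := [set w | [&& chain w, up w & altl true (labsD w i)]].

(** The antipodal map turns a chain of the lower hemisphere whose labels
    alternate with first sign + into one of the upper hemisphere with first sign
    -, so both kinds can be counted in the upper hemisphere, where [alts_del]
    exchanges them for pairs of a chain and a good deletion. *)
Lemma nalt_facets : odd (nalt d.+1) = odd (\sum_i #|facets i|).
Proof.
rewrite /nalt -sum1_card big_mkcond /=.
rewrite (eq_bigr (fun w => if chain w then altl true (labs w) : nat else 0)); last first.
  by move=> w _; rewrite inE; case: (chain w); case: (altl _ _).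
rewrite -big_mkcond (bigID up) /=.
rewrite [X in _ + X](reindex_inj (can_inj (@oppwK _))) /=.
rewrite [X in _ + X](eq_big (fun w => chain w && up w)
   (fun w => altl false (labs w) : nat)); last 2 first.
- move=> w; rewrite chain_opp; case cw: (chain w) => //=.
  by rewrite up_opp // negbK.
- move=> w /andP[]; rewrite chain_opp => cw _.
  by rewrite labs_opp // altl_flip //; apply: labs_free.
rewrite -big_split /= odd_sum.
rewrite (eq_bigr (fun w => odd (\sum_(i <- enum 'I_d.+1) (altl true (labsD w i) : nat)))); last first.
  move=> w /andP[cw _].
  by rewrite altl_del ?oddD ?oddb //; apply: labs_free.
rewrite -odd_sum exchange_big /= big_enum /=; congr odd; apply: eq_bigr => i _.
rewrite -sum1_card [in RHS]big_mkcond [in LHS]big_mkcond /=.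
apply: eq_bigr => w _; rewrite inE.
by case: (chain w); case: (up w); case: (altl _ _).
Qed.

(** Exchanging the entries i and i+1 affects only the prefix that ends at i. *)
Lemma facets_even (i : 'I_d.+1) : i != ord_max -> ~~ odd #|facets i|.
Proof.
move=> imax; have lti : i < d.
  by rewrite ltn_neqAle -ltnS ltn_ord andbT; apply: contra imax => /eqP e; apply/eqP/val_inj.
pose i' : 'I_d.+1 := inord i.+1.
have i'E : i' = i.+1 :> nat by rewrite inordK // ltnS.
have ii' : i != i' by apply/eqP => /(congr1 val) /= e; move: i'E; rewrite -e; lia.
pose phi w : {ffun 'I_d.+1 -> 'I_n * bool} := [ffun j => w (tperm i i' j)].
have phiK w : phi (phi w) = w by apply/ffunP => j; rewrite !ffunE tpermK.
apply: (@even_involution _ _ phi) => w; rewrite inE => /and3P[cw uw aw].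
have cpw : chain (phi w).
  move/andP: cw => [/injectiveP wI /forallP wd]; apply/andP; split.
    apply/injectiveP => j k; rewrite !ffunE => /wI; exact: perm_inj.
  by apply/forallP => j; rewrite ffunE.
split=> //.
- rewrite inE cpw /=; apply/andP; split.
    move/existsP: uw => [j ej]; apply/existsP; exists (tperm i i' j).
    by rewrite ffunE tpermK.
  rewrite (_ : labsD _ _ = labsD w i) //; rewrite /labsD; apply/eq_in_map => j.
  rewrite mem_rem_uniq ?enum_uniq // !inE => /andP[ji _].
  congr lam; apply/setP => x; apply/imsetP/imsetP => -[k kj ->].
    exists (tperm i i' k); rewrite ?ffunE // inE; move: kj; rewrite inE.
    case: tpermP => [->|->|] //; rewrite ?i'E; move: ji; rewrite -(inj_eq val_inj) /=; lia.
  exists (tperm i i' k); rewrite ?ffunE ?tpermK // inE; move: kj; rewrite inE.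
  case: tpermP => [->|->|] //; rewrite ?i'E; move: ji; rewrite -(inj_eq val_inj) /=; lia.
- apply/eqP => /ffunP/(_ i); rewrite ffunE tpermL => e.
  by move: ii'; rewrite (chain_inj cw (congr1 fst e)) eqxx.
Qed.

(** Reversing the sign of the last entry affects only the longest prefix, but
    it leaves the upper hemisphere when that entry is on the axis d.  The chains
    for which it is are the chains of length d with (d, +) appended. *)
Lemma facets_top : odd #|facets ord_max| = odd (nalt d).
Proof.
rewrite -(cardsID [set w : {ffun 'I_d.+1 -> 'I_n * bool} | w ord_max == (cd, true)]) oddD.
set B := _ :&: _; set C := _ :\: _.
have /negbTE -> : ~~ odd #|C|.
  pose phi w : {ffun 'I_d.+1 -> 'I_n * bool} :=
    [ffun j => if j == ord_max then opp (w j) else w j].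
  have phiK w : phi (phi w) = w.
    by apply/ffunP => j; rewrite !ffunE; case: eqP => // _; rewrite oppK.
  apply: (@even_involution _ _ phi) => w; rewrite !inE => /andP[wm /and3P[cw uw aw]].
  have phi1 j : (phi w j).1 = (w j).1 by rewrite ffunE; case: ifP.
  have cpw : chain (phi w).
    move/andP: cw => [/injectiveP wI /forallP wd]; apply/andP; split.
      by apply/injectiveP => j k; rewrite !phi1 => /wI.
    by apply/forallP => j; rewrite phi1.
  have [j /eqP ej] := existsP uw.
  have jm : j != ord_max by apply: contraNneq wm => <-; rewrite ej.
  split=> //.
  - rewrite cpw /=; apply/and3P; split.
    + apply/eqP => e; have := congr1 fst e; rewrite phi1 /= => e1.
      by move/eqP: jm; apply; apply: (chain_inj cw); rewrite e1 ej.
    + by apply/existsP; exists j; rewrite ffunE (negbTE jm) ej.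
    + rewrite (_ : labsD _ _ = labsD w ord_max) //; rewrite /labsD; apply/eq_in_map => k.
      rewrite mem_rem_uniq ?enum_uniq // !inE => /andP[km _].
      congr lam; apply: eq_in_imset => l; rewrite inE ffunE => lk.
      case: eqP => // e; move: km; rewrite -(inj_eq val_inj) /=.
      by move: lk; rewrite e /=; have := ltn_ord k; lia.
  - by apply/eqP => /ffunP/(_ ord_max); rewrite ffunE eqxx /opp; case: (w _) => a [].
rewrite addbF; congr odd; rewrite /nalt.
pose ext (w : {ffun 'I_d -> 'I_n * bool}) : {ffun 'I_d.+1 -> 'I_n * bool} :=
  [ffun j => if unlift ord_max j is Some j' then w j' else (cd, true)].
have ext_lift (w : {ffun 'I_d -> 'I_n * bool}) j : ext w (lift ord_max j) = w j by rewrite ffunE liftK.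
have ext_max (w : {ffun 'I_d -> 'I_n * bool}) : ext w ord_max = (cd, true) by rewrite ffunE unlift_none.
have extI : injective ext.
  by move=> w1 w2 e; apply/ffunP => j; rewrite -!ext_lift e.
have cext (w : {ffun 'I_d -> 'I_n * bool}) : chain w -> chain (ext w).
  move=> /andP[/injectiveP wI /forallP wd]; apply/andP; split.
    apply/injectiveP => j k.
    case: (unliftP ord_max j) => [j'|] ->; case: (unliftP ord_max k) => [k'|] ->;
      rewrite ?ext_lift ?ext_max //=.
    - by move/wI => ->.
    - by move=> e; have := wd j'; rewrite e ltnn.
    - by move=> e; have := wd k'; rewrite -e ltnn.
  apply/forallP => j; case: (unliftP ord_max j) => [j'|] ->; rewrite ?ext_lift ?ext_max //=.
  by apply: ltnW; rewrite ltnS.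
have remE : rem ord_max (enum 'I_d.+1) = [seq lift ord_max j | j <- enum 'I_d].
  rewrite enum_ordSr -cats1.
  have -> : [seq widen_ord (leqnSn d) i | i <- enum 'I_d] = [seq lift ord_max j | j <- enum 'I_d].
    by apply: eq_map => i; apply: val_inj; rewrite /= /bump leqNgt ltn_ord.
  elim: (enum 'I_d) => /= [|j s ->]; rewrite ?eqxx //.
  by rewrite eq_sym (negbTE (neq_lift _ _)).
have labE (w : {ffun 'I_d -> 'I_n * bool}) : labsD (ext w) ord_max = labs w.
  rewrite /labsD remE -map_comp; apply: eq_map => i /=; congr lam.
  apply/setP => x; apply/imsetP/imsetP => -[j].
    rewrite inE lift_max; case: (unliftP ord_max j) => [j'|] ->; rewrite ?lift_max.
      by move=> le ->; exists j'; rewrite ?inE ?ext_lift.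
    by rewrite leqNgt /= ltn_ord.
  rewrite inE => le ->; exists (lift ord_max j); last by rewrite ext_lift.
  by rewrite inE !lift_max.
rewrite -(card_imset _ extI); apply: eq_card => w; rewrite !inE.
apply/andP/imsetP => [[wB /eqP wm]|[w']]; last first.
  rewrite inE => /andP[cw' aw'] ->; rewrite cext //= labE aw' ext_max andbT; split=> //.
  by apply/existsP; exists ord_max; rewrite ext_max.
move/and3P: wB => [cw uw aw].
pose w' : {ffun 'I_d -> 'I_n * bool} := [ffun j => w (lift ord_max j)].
have wE : w = ext w'.
  apply/ffunP => j; case: (unliftP ord_max j) => [j'|] ->; rewrite ?ext_lift ?ext_max //.
  by rewrite ffunE.
exists w' => //; rewrite inE -labE -wE aw andbT.
move/andP: (cw) => [/injectiveP wI /forallP wd]; apply/andP; split.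
  by apply/injectiveP => j k; rewrite !ffunE => /wI /lift_inj.
apply/forallP => j; rewrite ffunE ltn_neqAle -ltnS wd andbT.
apply/eqP => e; have : lift ord_max j = ord_max.
  by apply: wI; rewrite wm; apply: val_inj.
by move/eqP; rewrite eq_sym (negbTE (neq_lift _ _)).
Qed.

Lemma nalt_step : odd (nalt d.+1) = odd (nalt d).
Proof.
rewrite nalt_facets (bigD1 ord_max) //= oddD facets_top odd_sum.
by rewrite big1 ?addbF // => i imax; apply/negbTE/facets_even.
Qed.

End Step.

Lemma nalt_odd d : d <= n -> odd (nalt d).
Proof.
elim: d => [|d IH] ledn; last by rewrite nalt_step // IH // ltnW.
rewrite /nalt (_ : [set _ | _] = setT) ?cardsT ?card_ffun ?card_ord //.
apply/setP => w; rewrite !inE /chain /labs.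
have -> : enum 'I_0 = [::] by apply/eqP; rewrite -size_eq0 size_enum_ord.
rewrite andbT; apply/andP; split; first by apply/injectiveP; case.
by apply/forallP; case.
Qed.

Lemma alts_size s L M : alts s L -> {in L, forall x, x./2 < M} ->
  forall m, {in L, forall x, m <= x./2} -> size L <= M - m.
Proof.
elim: L s => //= x L IH s /and3P[_ /allP al aL] ltM m gem.
have xm : m <= x./2 by apply: gem; rewrite inE eqxx.
have xM : x./2 < M by apply: ltM; rewrite inE eqxx.
have ltM' : {in L, forall y, y./2 < M} by move=> y yL; apply: ltM; rewrite inE yL orbT.
by have := IH _ aL ltM' _ al; lia.
Qed.

(** Some chain of length n has alternating labels, since their number is odd;
    the absolute values of these labels are n distinct numbers below M. *)
Theorem octahedral_tucker M :
  (forall A, A != set0 -> consistent A -> (lam A)./2 < M) -> n <= M.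
Proof.
move=> lamM; have := nalt_odd (leqnn n).
case: (set_0Vmem [set w : {ffun 'I_n -> 'I_n * bool} | chain w && altl true (labs w)]).
  by rewrite /nalt => ->; rewrite cards0.
move=> [w]; rewrite inE => /andP[cw aw] _.
have := alts_size aw; rewrite size_sort size_map size_enum_ord => /(_ M) h.
have := h _ 0; rewrite subn0; apply=> // x.
rewrite mem_sort => /mapP[i _ ->].
by apply: lamM; [exact: prefix_neq0|exact: prefix_consistent].
Qed.

End Tucker.

(** * Kneser colourings and alternating orders *)

Definition alternating (T : Type) (p : pred T) (l : seq T) :=
  sorted (fun x y => p x != p y) l.

Section AltLength.
Variable n : nat.
Implicit Types (A B : {set 'I_n * bool}) (l : seq 'I_n).

(** Length of a longest subsequence of l whose signs in A alternate, starting
    with s.  The greedy choice is optimal, as [altlen_mono] witnesses. *)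
Fixpoint altlen A s l : nat :=
  if l is i :: l' then
    if (i, s) \in A then (altlen A (~~ s) l').+1 else altlen A s l'
  else 0.

Fixpoint altpick A s l : seq 'I_n :=
  if l is i :: l' then
    if (i, s) \in A then i :: altpick A (~~ s) l' else altpick A s l'
  else [::].

Lemma altlen_lip A s l : altlen A s l <= (altlen A (~~ s) l).+1.
Proof.
elim: l s => //= i l IH s.
have := IH s; have := IH (~~ s); rewrite negbK.
by case: ifP => _; case: ifP => _; lia.
Qed.

Lemma altlen_mono A B s l : A \subset B -> altlen A s l <= altlen B s l.
Proof.
move=> sAB; elim: l s => //= i l IH s.
case: ifP => iA; first by rewrite (subsetP sAB _ iA) ltnS IH.
case: ifP => _ //; apply: leq_trans (altlen_lip _ _ _) _; exact: IH.
Qed.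

(** If the first signed index has sign s, the length for s is one more than that
    for the opposite sign.  So the comparison of the lengths is an antipodal
    sign. *)
Lemma altlen_neq A l : consistent A -> has (fun i => ((i, true) \in A) || ((i, false) \in A)) l ->
  altlen A true l != altlen A false l.
Proof.
move=> cA; elim: l => //= i l IH.
case: (boolP ((i, true) \in A)) => iT; case: (boolP ((i, false) \in A)) => iF //=.
- by case: (cA i).
- by move=> _; lia.
- by move=> _; lia.
Qed.

Lemma mem_oppset A i s : ((i, s) \in oppset A) = ((i, ~~ s) \in A).
Proof.
have -> : (i, s) = opp (i, ~~ s) by rewrite /opp negbK.
by rewrite mem_imset //; apply: (can_inj (@oppK _)).
Qed.

Lemma altlen_opp A s l : altlen (oppset A) s l = altlen A (~~ s) l.
Proof.
elim: l s => //= i l IH s; rewrite !IH.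
by rewrite mem_oppset.
Qed.

Lemma size_altpick A s l : size (altpick A s l) = altlen A s l.
Proof. by elim: l s => //= i l IH s; case: ifP => //= _; rewrite IH. Qed.

Lemma altpick_subseq A s l : subseq (altpick A s l) l.
Proof.
elim: l s => //= i l IH s; case: ifP => _; first by rewrite eqxx.
by apply: subseq_trans (IH s) (subseq_cons _ _).
Qed.

Lemma mem_altpick A s l i : i \in altpick A s l -> exists b, (i, b) \in A.
Proof.
elim: l s => //= j l IH s; case: ifP => [jA|_]; last exact: IH.
by rewrite inE => /orP[/eqP->|/IH//]; exists s.
Qed.

Lemma altpick_alt A s l : consistent A ->
  alternating (fun i => (i, true) \in A) (altpick A s l) /\
  (forall i, ohead (altpick A s l) = Some i -> (i, s) \in A).
Proof.
move=> cA; elim: l s => //= i l IH s; case: ifP => [iA|_]; last exact: IH.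
have [alt hd] := IH (~~ s); split => /=; last by move=> j [<-].
case E: (altpick A (~~ s) l) alt hd => [|j r] //= alt /(_ j erefl) jA.
rewrite [path _ _ _]alt andbT.
case: s iA jA {E IH} => iA jA.
  by rewrite iA; apply/negP => /eqP/esym jT; case: (cA j).
by rewrite jA; apply/negP => /eqP iT; case: (cA i).
Qed.

End AltLength.

Section KneserAlternating.
Variables (T : finType) (sigma : seq T) (F : {set {set T}}) (c m : nat).
Variable col : {set T} -> 'I_m.
Hypothesis sigma_uniq : uniq sigma.
Hypothesis col_proper :
  forall f g : {set T}, f \in F -> g \in F -> [disjoint f & g] -> col f != col g.
Hypothesis c_le : c <= size sigma.
Hypothesis fullness : forall (S : {set T}) (p : pred T),
  {subset S <= sigma} -> alternating p [seq x <- sigma | x \in S] ->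
  size sigma < #|S| + c ->
  exists2 f, f \in F & (f \subset [set x in S | p x]) || (f \subset [set x in S | ~~ p x]).

Let N := size sigma.
Let el (i : 'I_N) : T := tnth (in_tuple sigma) i.
Implicit Types A B : {set 'I_N * bool}.

Let el_inj : injective el.
Proof. by apply/tuple_uniqP. Qed.

Definition signed_part A b := [set el i | i : 'I_N & (i, b) \in A].
Definition hits A b x := [exists f in F, (f \subset signed_part A b) && (col f == x)].
Definition captures A := [exists x, hits A true x || hits A false x].
Definition topcol A := \max_(x | hits A true x || hits A false x) val x.
Definition altA A s := altlen A s (enum 'I_N).

(** If neither part of A contains a member of F, the absolute value is the
    alternation length less one, which is below N - c by [fullness].  Otherwise
    it is N - c plus the largest colour of a member inside a part, and the sign
    tells which part: both cannot contain members of this colour, since they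
    would be disjoint. *)
Definition tucker_label A : nat :=
  if captures A then
    [exists x : 'I_m, (val x == topcol A) && hits A true x] + (N - c + topcol A).*2
  else (altA A true > altA A false) + ((maxn (altA A true) (altA A false)).-1).*2.

Lemma signed_partS A B b : A \subset B -> signed_part A b \subset signed_part B b.
Proof.
move=> sAB; apply: imsetS; apply/subsetP => i; rewrite !inE; exact: (subsetP sAB).
Qed.

Lemma hitsS A B b x : A \subset B -> hits A b x -> hits B b x.
Proof.
move=> sAB /exists_inP[f fF /andP[fA fx]]; apply/exists_inP; exists f => //.
by rewrite fx (subset_trans fA) // signed_partS.
Qed.

Lemma signed_part_opp A b : signed_part (oppset A) b = signed_part A (~~ b).
Proof.
by apply/setP => x; apply/imsetP/imsetP => -[i];
  rewrite inE => iA ->; exists i => //; move: iA; rewrite inE mem_oppset.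
Qed.

Lemma hits_opp A b x : hits (oppset A) b x = hits A (~~ b) x.
Proof. by rewrite /hits signed_part_opp. Qed.

Lemma hits_proper A x : consistent A -> hits A true x -> hits A false x -> False.
Proof.
move=> cA /exists_inP[f fF /andP[fA /eqP fx]] /exists_inP[g gF /andP[gA /eqP gx]].
have : [disjoint f & g].
  apply: disjointWl fA _; apply: disjointWr gA _.
  rewrite -setI_eq0; apply/eqP/setP => y; rewrite !inE.
  apply/negP => /andP[/imsetP[i]]; rewrite inE => iA -> /imsetP[j]; rewrite inE => jA /el_inj ij.
  by apply: (cA i); rewrite {2}ij.
by move/(col_proper fF gF); rewrite fx gx eqxx.
Qed.

Lemma topcol_hit A : captures A ->
  exists2 x : 'I_m, val x = topcol A & hits A true x || hits A false x.
Proof.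
move=> /existsP[x0 hx0]; rewrite /topcol.
have h : 0 < #|[pred x | hits A true x || hits A false x]| by apply/card_gt0P; exists x0.
by have [x hx e] := eq_bigmax_cond (fun x : 'I_m => val x) h; exists x.
Qed.

Lemma altA_small A : A != set0 -> consistent A -> ~~ captures A ->
  [/\ altA A true != altA A false, altA A true + c <= N & altA A false + c <= N].
Proof.
move=> A0 cA nA.
have alt s : altA A s + c <= N.
  rewrite leqNgt; apply/negP => lt.
  pose pk := altpick A s (enum 'I_N).
  pose S := [set x in map el pk]; pose p x := x \in signed_part A true.
  have upk : uniq pk by rewrite (subseq_uniq (altpick_subseq _ _ _)) // enum_uniq.
  have sE : sigma = map el (enum 'I_N).
    have := map_tnth_enum (in_tuple sigma); rewrite /= => {1}<- //.
  have fE : [seq x <- sigma | x \in S] = map el pk.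
    have uS : uniq (map el (enum 'I_N)) by rewrite -sE.
    rewrite sE; have := subseq_uniqP uS (map_subseq el (altpick_subseq A s (enum 'I_N))).
    by move=> ->; apply: eq_filter => x; rewrite inE.
  have pE i : p (el i) = ((i, true) \in A).
    by rewrite /p mem_imset // inE.
  have h1 : {subset S <= sigma}.
    by move=> x; rewrite inE sE => /mapP[i _ ->]; apply: map_f; rewrite mem_enum.
  have h2 : alternating p [seq x <- sigma | x \in S].
    rewrite fE /alternating sorted_map.
    have [+ _] := altpick_alt s (enum 'I_N) cA.
    by rewrite /alternating; congr is_true; apply: eq_sorted => i j /=; rewrite !pE.
  have h3 : size sigma < #|S| + c.
    rewrite /S cardsE; have /card_uniqP -> : uniq (map el pk) by rewrite map_inj_uniq.
    by rewrite size_map size_altpick.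
  have [f fF] := fullness h1 h2 h3.
  have Sp b i : i \in pk -> p (el i) = b -> (i, b) \in A.
    rewrite pE => /mem_altpick[b' ib'] <-.
    by case: (boolP ((i, true) \in A)) => // iT; case: b' ib' iT => // ->.
  move=> /orP[] /subsetP sf; case/negP: nA; apply/existsP; exists (col f); apply/orP;
    [left|right]; apply/exists_inP; exists f => //; rewrite eqxx andbT;
    apply/subsetP => x /sf; rewrite !inE => /andP[/mapP[i ipk ->]] pi;
    apply: imset_f; rewrite inE; apply: Sp => //; exact/negbTE.
split=> //; apply: altlen_neq => //.
have [[i b] ib] := set0Pn _ A0; apply/hasP; exists i; first by rewrite mem_enum.
by case: b ib => ->; rewrite ?orbT.
Qed.

(** Tucker's lemma compares the N coordinates with the N - c + m absolute values
    that [tucker_label] can take. *)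
Theorem kneser_alternating : c <= m.
Proof.
suff : N <= N - c + m by move: c_le; rewrite -/N; lia.
apply: (@octahedral_tucker N tucker_label) => [A A0 cA|A B A0 cB sAB|A A0 cA].
- have topE : topcol (oppset A) = topcol A.
    by apply: eq_bigl => x; rewrite !hits_opp orbC.
  have nE : captures (oppset A) = captures A.
    by apply: eq_existsb => x; rewrite !hits_opp orbC.
  rewrite /tucker_label nE topE; case: ifP => nA.
    rewrite /flip oddD odd_double addbF oddb half_bit_double; congr (nat_of_bool _ + _).
    have [x xt xh] := topcol_hit nA.
    have sE b : [exists y : 'I_m, (val y == topcol A) && hits A b y] = hits A b x.
      apply/existsP/idP => [[y /andP[/eqP yt]]|h]; last by exists x; rewrite xt eqxx.
      by have -> : y = x by apply: val_inj; rewrite yt.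
    rewrite sE -[RHS]negbK -sE.
    under eq_existsb do rewrite hits_opp.
    rewrite !sE negbK; move: xh (@hits_proper A x cA).
    by case: (hits A true x); case: (hits A false x) => // _ h; case: h.
  have [ne _ _] := altA_small A0 cA (negbT nA).
  rewrite /altA !altlen_opp -!/(altA _ _) /= maxnC /flip oddD odd_double addbF oddb half_bit_double.
  by congr (nat_of_bool _ + _); move: ne; rewrite -leqNgt [in RHS]leq_eqVlt => /negbTE->.
- have cA : consistent A by move=> i [iT iF]; apply: (cB i); rewrite !(subsetP sAB).
  have B0 : B != set0 by apply: contraNneq A0 => e; rewrite e subset0 in sAB.
  have nAB : captures A -> captures B.
    by move=> /existsP[x /orP[] /(hitsS sAB) h]; apply/existsP; exists x; rewrite h ?orbT.
  rewrite /tucker_label; case: ifP => nA; case: ifP => nB.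
  + rewrite !half_bit_double => /addnI e; rewrite e; congr (nat_of_bool _ + _).
    apply/existsP/existsP => -[x /andP[/eqP xt xh]].
      by exists x; rewrite xt eqxx /=; apply: hitsS xh.
    have [y yt yh] := topcol_hit nA.
    have xy : x = y by apply: val_inj; rewrite yt xt.
    exists x; rewrite xt eqxx /= xy; case/orP: yh => // /(hitsS sAB) yF.
    by case: (hits_proper cB xh); rewrite xy.
  + by rewrite nAB in nB.
  + rewrite !half_bit_double.
    have [] := altA_small A0 cA (negbT nA); lia.
  + rewrite !half_bit_double.
    have := altlen_mono true (enum 'I_N) sAB; have := altlen_mono false (enum 'I_N) sAB.
    rewrite -!/(altA _ _).
    have [] := altA_small A0 cA (negbT nA); have [] := altA_small B0 cB (negbT nB).
    by move=> *; congr (nat_of_bool _ + _.*2); lia.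
- rewrite /tucker_label; case: ifP => nA; rewrite half_bit_double.
    by have [x <- _] := topcol_hit nA; rewrite ltn_add2l ltn_ord.
  have [] := altA_small A0 cA (negbT nA).
  have : 0 < m by apply: leq_ltn_trans (leq0n _) (ltn_ord (col set0)).
  lia.
Qed.

End KneserAlternating.

(** * Passages of a trail through a vertex *)

Section Passages.
Variable V : finType.
Implicit Types (v x y z : V) (e : {set V}) (l : seq {set V}) (E : {set {set V}}).

Definition deg v l := count (fun e => v \in e) l.

Lemma deg_cons v e l : deg v (e :: l) = (v \in e) + deg v l.
Proof. by []. Qed.

(** Size of a greedy family of disjoint pairs of consecutive edges at v. *)
Fixpoint npass v l : nat :=
  if l is e :: l' then
    if l' is e' :: l'' then
      if (v \in e) && (v \in e') then (npass v l'').+1 else npass v l'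
    else 0
  else 0.

Lemma npass2 v e e' l : npass v [:: e, e' & l] =
  if (v \in e) && (v \in e') then (npass v l).+1 else npass v (e' :: l).
Proof. by []. Qed.

Lemma npass_cons v e l : npass v l <= npass v (e :: l) <= (npass v l).+1.
Proof.
elim: l e => [//|e' l IH] e; rewrite npass2.
by have := IH e'; case: ifP => _; lia.
Qed.

Lemma npass_cat v l1 l2 : npass v l1 + npass v l2 <= npass v (l1 ++ l2).
Proof.
have [m] := ubnP (size l1); elim: m l1 => // m IH [|e [|e' l]] // lt.
  by have /andP[] := npass_cons v e l2.
have lt1 : size (e' :: l) < m by [].
have := IH _ lt1; have := IH l (ltnW lt1).
by rewrite !cat_cons !npass2; case: ifP => _; lia.
Qed.

Lemma deg_cat v l1 l2 : deg v (l1 ++ l2) = deg v l1 + deg v l2.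
Proof. exact: count_cat. Qed.

Fixpoint walk_edges x (q : seq V) : seq {set V} :=
  if q is y :: q' then [set x; y] :: walk_edges y q' else [::].

Lemma walk_edges_cons x y q :
  walk_edges x (y :: q) = [set x; y] :: walk_edges y q.
Proof. by []. Qed.

Lemma size_walk_edges x q : size (walk_edges x q) = size q.
Proof. by elim: q x => //= y q IH x; rewrite IH. Qed.

Lemma walk_edges_rcons x q z :
  walk_edges x (rcons q z) = rcons (walk_edges x q) [set last x q; z].
Proof. by elim: q x => //= y q IH x; rewrite IH. Qed.

Lemma walk_passages v x q :
  (forall e, e \in walk_edges x q -> #|e| = 2) ->
  deg v (walk_edges x q) <=
    (npass v (walk_edges x q)).*2 + (v == x) + (v == last x q).
Proof.
have [m] := ubnP (size q); elim: m q x => // m IH [|y [|z q]] x lt c2 //.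
  have xy : x != y.
    have := c2 [set x; y]; rewrite cards2 mem_seq1 eqxx => /(_ isT).
    by case: (x != y).
  by rewrite /= /deg /= in_set2; case: (v == x); case: (v == y).
have xy : x != y.
  have := c2 [set x; y]; rewrite cards2 mem_head => /(_ isT).
  by case: (x != y).
have yz : y != z.
  have := c2 [set y; z]; rewrite cards2 !inE eqxx orbT => /(_ isT).
  by case: (y != z).
have IH1 := IH (z :: q) y _ _; have IH2 := IH q z _ _.
have {}IH1 : deg v (walk_edges y (z :: q)) <=
    (npass v (walk_edges y (z :: q))).*2 + (v == y) + (v == last z q).
  by apply: IH1 => [|e el]; [move: lt => /=; lia|apply: c2; rewrite /= inE el orbT].
have {}IH2 : deg v (walk_edges z q) <=
    (npass v (walk_edges z q)).*2 + (v == z) + (v == last z q).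
  by apply: IH2 => [|e el]; [move: lt => /=; lia|apply: c2; rewrite /= !inE el !orbT].
rewrite walk_edges_cons deg_cons [last x _]/= in_set2.
have /andP[npm _] := npass_cons v [set x; y] (walk_edges y (z :: q)).
have [vx|vx] := eqVneq v x.
  have vy : (v == y) = false by rewrite vx; apply/negbTE.
  by move: IH1; rewrite vy; lia.
have [vy|vy] := eqVneq v y; last by move: IH1; rewrite (negbTE vy); lia.
have vz : (v == z) = false by rewrite vy; apply/negbTE.
rewrite walk_edges_cons npass2 deg_cons !in_set2 vz vy !eqxx !orbT andbT -vy.
by move: IH2; rewrite vz orbF; lia.
Qed.

Definition trail E x q := all (fun e => e \in E) (walk_edges x q) && uniq (walk_edges x q).

Lemma trail_size E x q : trail E x q -> size q <= #|E|.
Proof.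
case/andP => /allP sE u; rewrite -(size_walk_edges x) cardE.
by apply: uniq_leq_size => // e /sE; rewrite mem_enum.
Qed.

(** Remove a longest trail and repeat.  A longest trail exhausts the edges at
    its two ends, so each vertex is an end of at most one of the trails, and the
    defect 2 arises only once. *)
Lemma trail_order E : (forall e, e \in E -> #|e| = 2) ->
  exists l, [/\ uniq l, l =i E & forall v, deg v l <= (npass v l).*2 + 2].
Proof.
have [m] := ubnP #|E|; elim: m E => // m IH E lt c2.
have [->|[e0 e0E]] := set_0Vmem E.
  by exists [::]; split=> // e; rewrite !inE.
have /eqP/cards2P[x0 [y0 [xy0 e0E2]]] := c2 _ e0E.
pose P k := [exists x, exists q : k.-tuple V, trail E x q].
have exP : exists k, P k.
  exists 1; apply/existsP; exists x0; apply/existsP; exists [tuple y0].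
  by rewrite /trail /= -e0E2 e0E.
have ubP k : P k -> k <= #|E|.
  by case/existsP => x /existsP[q /trail_size]; rewrite size_tuple.
have [k /existsP[x /existsP[q tq]] max_k] := ex_maxnP exP ubP.
have k1 : 0 < k.
  apply: max_k; apply/existsP; exists x0; apply/existsP; exists [tuple y0].
  by rewrite /trail /= -e0E2 e0E.
have [/allP tE tu] := andP tq.
have endx e : e \in E -> x \in e -> e \in walk_edges x q.
  move=> eE xe; apply/negPn/negP => en.
  have [y ey] : exists y, e = [set y; x].
    have /eqP/cards2P[a [b [_ E2]]] := c2 _ eE.
    by move: xe; rewrite E2 !inE => /orP[]/eqP->; [exists b; rewrite setUC|exists a].
  have : k.+1 <= k.
    apply: max_k; apply/existsP; exists y; apply/existsP; exists [tuple of x :: q].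
    by rewrite /trail /= -ey eE en.
  by rewrite ltnn.
have endl e : e \in E -> last x q \in e -> e \in walk_edges x q.
  move=> eE xe; apply/negPn/negP => en.
  have [y ey] : exists y, e = [set last x q; y].
    have /eqP/cards2P[a [b [_ E2]]] := c2 _ eE.
    by move: xe; rewrite E2 !inE => /orP[]/eqP->; [exists b|exists a; rewrite setUC].
  have : k.+1 <= k.
    apply: max_k; apply/existsP; exists x; apply/existsP; exists [tuple of rcons q y].
    by rewrite /trail /= walk_edges_rcons -ey all_rcons rcons_uniq en eE; exact: tq.
  by rewrite ltnn.
pose E' := E :\: [set e in walk_edges x q].
have ltE' : #|E'| < m.
  rewrite -ltnS; apply: leq_ltn_trans lt; apply: proper_card; apply/properP; split.
    exact: subsetDl.
  have [e ew] : exists e, e \in walk_edges x q.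
    case: (q : seq V) (size_tuple q) => [|y q'] sz; first by move: k1; rewrite -sz.
    by exists [set x; y]; rewrite mem_head.
  by exists e; [exact: tE|rewrite in_setD inE ew].
have [l' [ul' l'E dl']] := IH _ ltE' (fun e eE' => c2 e (subsetP (subsetDl _ _) _ eE')).
exists (walk_edges x q ++ l'); split.
- rewrite cat_uniq tu ul' andbT; apply/hasPn => e; rewrite l'E !inE.
  by case/andP.
- move=> e; rewrite mem_cat l'E !inE; case: (boolP (e \in walk_edges x q)) => //= /tE.
  by move=> ->.
move=> v; have := npass_cat v (walk_edges x q) l'.
have := @walk_passages v x q (fun e el => c2 _ (tE _ el)).
rewrite deg_cat; have := dl' v.
have [vend|vend] := boolP ((v == x) || (v == last x q)); last first.
  by move: vend; rewrite negb_or => /andP[/negbTE-> /negbTE->]; lia.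
suff -> : deg v l' = 0 by case: (v == x) (v == last x q) => -[]; lia.
apply/eqP; rewrite -leqn0 leqNgt -has_count; apply/hasPn => e.
rewrite l'E !inE => /andP[en eE]; apply: contra en => ve.
by case/orP: vend => /eqP ev; [apply: endx|apply: endl]; rewrite -?ev.
Qed.

(** If both edges of a pair at v were clean survivors, they would be consecutive
    survivors of the same sign. *)
Lemma npass_cost v (S p dirty : pred {set V}) (b : bool) l :
  alternating p [seq e <- l | S e] ->
  (forall e, e \in l -> v \in e -> ~~ dirty e -> S e -> p e = b) ->
  npass v l <= count (fun e => (v \in e) && (dirty e || ~~ S e)) l.
Proof.
have [m] := ubnP (size l); elim: m l => // m IH [|e [|e' l]] // lt alt mono.
have alt_tl f r : alternating p [seq e <- f :: r | S e] -> alternating p [seq e <- r | S e].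
  rewrite /alternating /=; case: (S f) => //; exact: path_sorted.
have mono1 f : f \in e' :: l -> v \in f -> ~~ dirty f -> S f -> p f = b.
  by move=> fl; apply: mono; rewrite inE fl orbT.
have mono2 f : f \in l -> v \in f -> ~~ dirty f -> S f -> p f = b.
  by move=> fl; apply: mono; rewrite !inE fl !orbT.
have alt1 := alt_tl _ _ alt; have alt2 := alt_tl _ _ alt1.
rewrite npass2; case: ifP => [/andP[ve ve']|_]; last first.
  have := IH (e' :: l) lt alt1 mono1; rewrite /=; lia.
have := IH l (ltnW lt) alt2 mono2; rewrite [count _ (e :: _)]/= ve ve' /=.
suff : (dirty e || ~~ S e) || (dirty e' || ~~ S e') by case: (dirty e || ~~ S e); case: (dirty e' || ~~ S e') => //=; lia.
apply/negPn/negP; rewrite !negb_or !negbK => /andP[/andP[ce Se] /andP[ce' Se']].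
move: alt; rewrite /alternating /= Se Se' /= => /andP[].
by rewrite !(mono _ _ _ _ _) ?inE ?eqxx ?orbT.
Qed.

End Passages.

(** * Hub gadgets and bow-ties *)

Lemma set2_eq (T : finType) (a b c d : T) :
  ([set a; b] == [set c; d]) = (a == c) && (b == d) || (a == d) && (b == c).
Proof.
apply/eqP/orP => [/setP e|[] /andP[/eqP-> /eqP->] //]; last by rewrite setUC.
have := e a; have := e b; have := e c; have := e d; rewrite !in_set2 !eqxx ?orbT /=.
move=> /esym hd /esym hc hb ha; move: ha hb hc hd; rewrite ![c == _]eq_sym ![d == _]eq_sym.
by case: (a == c) (b == d) (a == d) (b == c) => -[] [] []; auto.
Qed.

Fixpoint bits n : seq (seq bool) :=
  if n is n'.+1 then [seq b :: s | b <- [:: true; false], s <- bits n'] else [:: [::]].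

Lemma mem_bits s : s \in bits (size s).
Proof.
elim: s => //= b s IH; rewrite mem_cat cats0.
by case: b; rewrite map_f ?orbT.
Qed.

(** The positions 0, 3, 4 and 7 are those of the edges at the centre. *)
Definition bowtie_check (c : bool) (s p : seq bool) :=
  let q := mask s p in
  [&& sorted (fun x y => x != y) q,
      nth false s 0 ==> (nth false p 0 == c), nth false s 3 ==> (nth false p 3 == c),
      nth false s 4 ==> (nth false p 4 == c) & nth false s 7 ==> (nth false p 7 == c)]
  ==> (3 <= count negb s).

Lemma bowtie_checked c s p : size s = 8 -> size p = 8 -> bowtie_check c s p.
Proof.
have : all (fun s => all (fun p => bowtie_check true s p && bowtie_check false s p)
  (bits 8)) (bits 8) by vm_compute.
move=> /allP h ss sp; move: (mem_bits s) (mem_bits p); rewrite ss sp => /h /allP hs /hs.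
by case: c => /andP[].
Qed.

Section Gadgets.
Variable V : finType.
Implicit Types (v x y z : V) (e : {set V}) (l : seq {set V}) (E K : {set {set V}}).
Implicit Types (g : seq V).

(** In this order the edges at a and the edges at b take turns. *)
Definition hub_gadget x g : seq {set V} :=
  if g is [:: a; b; y; z] then
    [:: [set x; a]; [set x; b]; [set y; a]; [set y; b]; [set z; a]; [set z; b]]
  else [::].
Definition hub_leaves g : seq V := drop 2 g.

(** A closed walk of length four from x. *)
Definition petal x a b c : seq {set V} :=
  [:: [set x; a]; [set a; b]; [set b; c]; [set c; x]].

Definition bowtie x g : seq {set V} :=
  if g is [:: a; b; c; a'; b'; c'] then petal x a b c ++ petal x a' b' c'
  else [::].

Lemma bowtie_others x g v : uniq (x :: g) -> v != x ->
  deg v (bowtie x g) <= (npass v (bowtie x g)).*2 /\ deg v (bowtie x g) <= (v \in g).*2.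
Proof.
case: g => [|a [|b [|c [|a' [|b' [|c' [|]]]]]]] //.
rewrite /= !inE !negb_or -!andbA => /and5P[xa xb xc xa'].
move=> /and5P[xb' xc' ab ac] /and5P[aa' ab' ac' bc] /and5P[ba' bb' bc' ca'].
move=> /and5P[cb' cc' ab2 ac2 /andP[bc2 _]] vx; rewrite /deg /= ?in_set2 (negbTE vx).
have [->|va] := eqVneq v a; rewrite ?(negbTE ab) ?(negbTE ac) ?(negbTE aa') ?(negbTE ab') ?(negbTE ac') //=.
have [->|vb] := eqVneq v b; rewrite ?(negbTE bc) ?(negbTE ba') ?(negbTE bb') ?(negbTE bc') //=.
have [->|vc] := eqVneq v c; rewrite ?(negbTE ca') ?(negbTE cb') ?(negbTE cc') //=.
have [->|va'] := eqVneq v a'; rewrite ?(negbTE ab2) ?(negbTE ac2) //=.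
have [->|vb'] := eqVneq v b'; rewrite ?(negbTE bc2) //=.
by case: (v == c').
Qed.

Lemma bowtie_passages x g v : uniq (x :: g) -> v != x ->
  deg v (bowtie x g) <= (npass v (bowtie x g)).*2.
Proof. by move=> ug /(bowtie_others ug)[]. Qed.

Lemma bowtie_deg x g v : uniq (x :: g) -> v != x -> deg v (bowtie x g) <= (v \in g).*2.
Proof. by move=> ug /(bowtie_others ug)[]. Qed.

Lemma bowtie_centre x g : uniq (x :: g) -> size g = 6 ->
  deg x (bowtie x g) = 4 /\ npass x (bowtie x g) = 1.
Proof.
case: g => [|a [|b [|c [|a' [|b' [|c' [|]]]]]]] //.
rewrite /= !inE !negb_or -!andbA => /and5P[xa xb xc xa'] /andP[xb' /andP[xc' _]] _.
by rewrite /deg /= ?in_set2 !eqxx (negbTE xa) (negbTE xb) (negbTE xc) (negbTE xa')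
  (negbTE xb') (negbTE xc').
Qed.

Lemma hub_passages x g v : uniq (x :: g) -> v \notin g ->
  deg v (hub_gadget x g) <= (npass v (hub_gadget x g)).*2.
Proof.
case: g => [|a [|b [|y [|z [|]]]]] //; rewrite /= !inE !negb_or -!andbA.
move=> _ /and4P[va vb vy vz]; rewrite /deg /= ?in_set2 (negbTE va) (negbTE vb) (negbTE vy) (negbTE vz).
by rewrite !orbF; case: (v == x).
Qed.

Lemma hub_deg x g v : uniq (x :: g) -> v != x -> deg v (hub_gadget x g) <= 3 * (v \in g).
Proof.
case: g => [|a [|b [|y [|z [|]]]]] //; rewrite /= !inE !negb_or -!andbA.
move=> /and5P[xa xb xy xz] /and5P[ab ay az by_] /andP[bz /andP[yz _]] vx.
rewrite /deg /= ?in_set2 (negbTE vx).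
have [->|va] := eqVneq v a; rewrite ?(negbTE ab) ?(negbTE ay) ?(negbTE az) //=.
have [->|vb] := eqVneq v b; rewrite ?(negbTE by_) ?(negbTE bz) //=.
have [->|vy] := eqVneq v y; rewrite ?(negbTE yz) //=.
by case: (v == z).
Qed.

Lemma hub_centre x g : uniq (x :: g) -> deg x (hub_gadget x g) <= 2.
Proof.
case: g => [|a [|b [|y [|z [|]]]]] //; rewrite /= !inE !negb_or -!andbA.
move=> /and5P[xa xb xy xz _]; rewrite /deg /= ?in_set2 eqxx.
by rewrite (negbTE xa) (negbTE xb) (negbTE xy) (negbTE xz).
Qed.

(** All edges at a have one sign and all edges at b the other, so for either
    sign c one of the two middle vertices serves. *)
Lemma hub_tie x a b y z (S p : pred {set V}) (c : bool) :
  all S (hub_gadget x [:: a; b; y; z]) ->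
  alternating p [seq e <- hub_gadget x [:: a; b; y; z] | S e] ->
  exists2 w, w \in [:: a; b] & [/\ p [set x; w] = c, p [set y; w] = c & p [set z; w] = c]
    /\ [/\ S [set x; w], S [set y; w] & S [set z; w]].
Proof.
move=> aS; have /all_filterP -> := aS; move: aS.
move=> /and5P[s1 s2 s3 s4 /and3P[s5 s6 _]] /and5P[h1 h2 h3 h4 /andP[h5 _]].
exists (if p [set x; a] == c then a else b); first by case: ifP; rewrite !inE eqxx ?orbT.
move: h1 h2 h3 h4 h5.
case Ex: (p [set x; a]); case Ex': (p [set x; b]); case Ey: (p [set y; a]);
  case Ey': (p [set y; b]); case Ez: (p [set z; a]); case Ez': (p [set z; b]);
  case: c => //= _ _ _ _ _; by rewrite ?Ex ?Ex' ?Ey ?Ey' ?Ez ?Ez' ?s1 ?s2 ?s3 ?s4 ?s5 ?s6.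
Qed.

(** The passages at x alone would cost two deletions.  The two edges of a petal at
    x, at odd distance, would alternate to opposite signs if the petal survived;
    this makes it three, by inspection of all patterns of deletions and signs.  A dirty edge is exempt
    from the sign condition and is charged the full price. *)
Lemma bowtie_cost x g (S p dirty : pred {set V}) (c : bool) :
  size g = 6 ->
  alternating p [seq e <- bowtie x g | S e] ->
  (forall e, e \in bowtie x g -> x \in e -> ~~ dirty e -> S e -> p e = c) ->
  3 <= 3 * count dirty (bowtie x g)
       + count (fun e => ~~ dirty e && ~~ S e) (bowtie x g).
Proof.
move=> s6 alt mono.
have [hd|nd] := boolP (has dirty (bowtie x g)).
  by move: hd; rewrite has_count; lia.
have cl e : e \in bowtie x g -> ~~ dirty e by move=> el; apply: (hasPn nd).
rewrite (@eq_in_count _ (fun e => ~~ dirty e && ~~ S e) (predC S)); last by move=> e /cl ->.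
apply: leq_trans (leq_addl _ _).
have m e : e \in bowtie x g -> x \in e -> S e ==> (p e == c).
  by move=> el xe; apply/implyP => Se; rewrite (mono _ el xe (cl _ el) Se).
have := @bowtie_checked c (map S (bowtie x g)) (map p (bowtie x g)).
rewrite !size_map.
have s8 : size (bowtie x g) = 8.
  by case: g s6 {alt mono nd cl m} => [|a [|b [|d [|a' [|b' [|d' [|]]]]]]].
rewrite s8 => /(_ erefl erefl) /implyP.
rewrite count_map => ->; first by [].
rewrite -map_mask -filter_mask sorted_map.
apply/and5P; split; first exact: alt.
all: case: g s6 m {alt mono nd cl s8} => [|a [|b [|d [|a' [|b' [|d' [|]]]]]]] // _ m.
all: by apply: m; rewrite !inE ?eqxx ?orbT.
Qed.
End Gadgets.

(** * Packing gadgets greedily *)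

Lemma pick_two (T : finType) (A X : {set T}) : #|X| + 2 <= #|A| ->
  exists a b, [/\ a != b, a \in A :\: X & b \in A :\: X].
Proof.
move=> h; have : 2 <= #|A :\: X|.
  by have := cardsID X A; have := subset_leq_card (subsetIr A X); lia.
rewrite leq_eqVlt => h2; have {h2} : 1 < #|A :\: X| by case/orP: h2 => [/eqP<-|/ltnW].
by case/card_gt1P => a [b [aA bA ab]]; exists a, b.
Qed.

Lemma cardU_le (T : finType) (A B : {set T}) : #|A :|: B| <= #|A| + #|B|.
Proof. by rewrite cardsU leq_subr. Qed.

Section Greedy.
Variable V : finType.
Implicit Types (v x y z : V) (e : {set V}) (l : seq {set V}) (g : seq V) (T : seq V).
Variables (VG : {set V}) (K : {set {set V}}).
Hypothesis K2 : forall e, e \in K -> #|e| = 2 /\ e \subset VG.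

Definition nbr v := [set w | [set v; w] \in K].
Definition used_nbr l v := [set w | [set v; w] \in l].
Definition saturated s l := [set v | s <= deg v l].

Lemma used_nbr_deg l v : #|used_nbr l v| <= deg v l.
Proof.
have inj : {in used_nbr l v &, injective (fun w => [set v; w])}.
  move=> w w' _ _ /eqP; rewrite set2_eq eqxx /= => /orP[/eqP//|/andP[/eqP-> /eqP]].
  by move->.
rewrite -(card_in_imset inj) /deg -size_filter cardE.
apply: uniq_leq_size; first exact: enum_uniq.
by move=> e; rewrite mem_enum => /imsetP[w]; rewrite inE mem_filter => wl ->; rewrite wl set21.
Qed.

Lemma sum_deg l : (forall e, e \in l -> #|e| = 2) -> \sum_v deg v l = 2 * size l.
Proof.
elim: l => [|e l IH] c2; first by rewrite big1.
under eq_bigr do rewrite deg_cons; rewrite big_split /= IH; last first.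
  by move=> f fl; apply: c2; rewrite inE fl orbT.
have -> : \sum_(v : V) (v \in e : nat) = 2.
  transitivity #|e|; last by apply: c2; rewrite mem_head.
  by rewrite -sum1_card [RHS]big_mkcond; apply: eq_bigr => v _; case: (v \in e).
by rewrite /=; lia.
Qed.

Lemma saturated_card s l : (forall e, e \in l -> #|e| = 2) ->
  s * #|saturated s l| <= 2 * size l.
Proof.
move=> c2; rewrite -(sum_deg c2) mulnC -sum_nat_const big_mkcond.
by apply: leq_sum => v _; rewrite inE; case: ifP.
Qed.

Hypothesis mindeg : forall v, v \in VG -> 5 * #|VG| <= 6 * #|nbr v| + 6.

Lemma nbr_sub v : nbr v \subset VG.
Proof.
apply/subsetP => w; rewrite inE => /K2[_ /subsetP]; apply; exact: set22.
Qed.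

Lemma nbr_in v w : w \in nbr v -> w \in VG.
Proof. exact: (subsetP (nbr_sub v)). Qed.

(** The vertices a and b are neighbours of x, and y and z are common neighbours
    of a and b, of which there are at least 2n/3 - 2.  Enough of them remain
    without the vertices reached by edges of l, those of degree at least s in l
    and those of T1 or T2. *)
Lemma find_four x l s B Sb t1 t2 (T1 T2 : {set V}) :
  x \in VG -> deg x l <= B -> #|saturated s l| <= Sb -> #|T1| <= t1 -> #|T2| <= t2 ->
  6 * (B + Sb + t1) + 18 <= 5 * #|VG| ->
  12 * s + 6 * (Sb + t2) + 30 <= 4 * #|VG| ->
  exists a b y z,
    [/\ [/\ a != b, y != z, y != x & z != x],
      all (fun w => deg w l < s) [:: a; b; y; z],
      [/\ a \notin T1, b \notin T1, y \notin T2 & z \notin T2],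
      all (mem K) [:: [set x; a]; [set x; b]; [set y; a]; [set y; b]; [set z; a]; [set z; b]] &
      all (predC (mem l)) [:: [set x; a]; [set x; b]; [set y; a]; [set y; b]; [set z; a]; [set z; b]]].
Proof.
move=> xV dB sat hT1 hT2 n1 n2.
have [a [b [ab]]] : exists a b, [/\ a != b,
   a \in nbr x :\: (used_nbr l x :|: saturated s l :|: T1) &
   b \in nbr x :\: (used_nbr l x :|: saturated s l :|: T1)].
  apply: pick_two; have := mindeg xV; have := used_nbr_deg l x.
  have := cardU_le (used_nbr l x :|: saturated s l) T1.
  have := cardU_le (used_nbr l x) (saturated s l).
  lia.
rewrite !in_setD !in_setU !negb_or -!andbA => /and4P[xa sa aT ax] /and4P[xb sb bT bx].
have da : deg a l < s by move: sa; rewrite inE -ltnNge.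
have db : deg b l < s by move: sb; rewrite inE -ltnNge.
pose X := used_nbr l a :|: used_nbr l b :|: saturated s l :|: T2 :|: [set x].
have [y [z [yz]]] : exists y z, [/\ y != z,
   y \in (nbr a :&: nbr b) :\: X & z \in (nbr a :&: nbr b) :\: X].
  apply: pick_two; have := mindeg (nbr_in ax); have := mindeg (nbr_in bx).
  have := used_nbr_deg l a; have := used_nbr_deg l b.
  have : #|nbr a :|: nbr b| <= #|VG|.
    by apply: subset_leq_card; rewrite subUset !nbr_sub.
  have := cardsUI (nbr a) (nbr b).
  have := cardU_le (used_nbr l a :|: used_nbr l b :|: saturated s l :|: T2) [set x].
  have := cardU_le (used_nbr l a :|: used_nbr l b :|: saturated s l) T2.
  have := cardU_le (used_nbr l a :|: used_nbr l b) (saturated s l).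
  have := cardU_le (used_nbr l a) (used_nbr l b).
  by rewrite cards1 -/X; move: da db sat hT2 n2; clear; lia.
rewrite /X !in_setD !in_setU !negb_or !in_setI !in_set1 -!andbA.
move=> /and5P[ya yb sy yT /and3P[yx ay by_]] /and5P[za zb sz zT /and3P[zx az bz]].
have dy : deg y l < s by move: sy; rewrite inE -ltnNge.
have dz : deg z l < s by move: sz; rewrite inE -ltnNge.
exists a, b, y, z; split => //=; first by rewrite da db dy dz.
  rewrite ![[set y; _]]setUC ![[set z; _]]setUC.
  by move: ax bx ay by_ az bz; rewrite !inE => -> -> -> -> -> ->.
rewrite ![[set y; _]]setUC ![[set z; _]]setUC.
by move: xa xb ya yb za zb; rewrite !inE => -> -> -> -> -> ->.
Qed.

Section Pack.
(** The gadget with centre x and further vertices g has edges ge x g; the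
    vertices gt g must differ between the gadgets at one centre.  A gadget has sz
    further vertices and es edges, of which cd are at the centre; pairing its
    edges leaves c edges at the centre unpaired.  Each centre gets q gadgets. *)
Variables (ge : V -> seq V -> seq {set V}) (gt : seq V -> seq V).
Variables (sz es ts cd c q s Lmax Bx : nat).
Hypothesis ge_size : forall x g, size g = sz -> size (ge x g) = es.
Hypothesis gt_size : forall g, size g = sz -> size (gt g) = ts.
Hypothesis ge_deg : forall x g v, uniq (x :: g) -> v != x -> deg v (ge x g) <= 3 * (v \in g).
Hypothesis ge_cen : forall x g, uniq (x :: g) -> deg x (ge x g) <= cd.
Hypothesis ge_loss : forall x g v, uniq (x :: g) -> v \notin g ->
  deg v (ge x g) <= (npass v (ge x g)).*2 + c * (v == x).
Hypothesis find_gadget : forall x l T, x \in VG ->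
  {subset l <= K} -> deg x l <= Bx -> size l <= Lmax -> size T <= ts * q ->
  exists g, [/\ uniq (x :: g), size g = sz, all (fun v => deg v l < s) g,
    uniq (T ++ gt g) <-> uniq T & [/\ uniq (ge x g), all (mem K) (ge x g) & all (predC (mem l)) (ge x g)]].

Definition gadgets_of x gs := flatten [seq ge x g | g <- gs].

Definition shaped x gs := all (fun g => uniq (x :: g) && (size g == sz)) gs.

(** New gadgets only use vertices of degree below s, apart from the centre, so
    other vertices stop at degree s + 2.  This also bounds the unpaired edges at
    a vertex in any final segment of the list: below degree s everything may be
    unpaired, and beyond it the vertex occurs as a centre only. *)
Lemma pack_centre x l k : x \in VG -> uniq l -> {subset l <= K} ->
  size l + es * k <= Lmax -> deg x l + cd * k <= Bx -> k <= q ->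
  exists gs, let L := gadgets_of x gs in
   [/\ size gs = k, shaped x gs, uniq (flatten (map gt gs)),
      uniq (l ++ L) /\ {subset L <= K} &
    [/\ size L = es * k, deg x L <= cd * k,
       forall v, v != x -> deg v (l ++ L) <= maxn (deg v l) (s + 2) &
       forall v l0 l1 j, l = l0 ++ l1 -> deg v l1 <= (npass v l1).*2 + (s + 2) + j ->
         deg v (l1 ++ L) <= (npass v (l1 ++ L)).*2 + (s + 2) + j + c * k * (v == x)]].
Proof.
move=> xV ul lK; elim: k => [|k IH] hL hB hk.
  exists [::]; split=> //=; first by rewrite cats0.
  split=> [||v _|v l0 l1 j _]; rewrite ?cats0 ?muln0 ?mul0n ?addn0 //; exact: leq_maxl.
have [||| gs [szs sh ut [uL LK] [sL dx dv dl]]] := IH; try lia.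
set L := gadgets_of x gs in uL LK sL dx dv dl *.
have LK' : {subset l ++ L <= K} by move=> e; rewrite mem_cat => /orP[/lK|/LK].
have [||| g [ug sg fg tg [ueg geK gel]]] := find_gadget (x := x) (l := l ++ L) (T := flatten (map gt gs)) xV LK'.
- by rewrite deg_cat; lia.
- by rewrite size_cat sL; lia.
- have -> : size (flatten (map gt gs)) = ts * k.
    rewrite -szs; move: sh; rewrite /shaped; clear -gt_size; elim: gs => [|g gs IH] /=; first by rewrite muln0.
    by case/andP => /andP[_ /eqP sg] sh; rewrite size_cat gt_size // IH //; lia.
  by rewrite leq_mul2l (ltnW hk) orbT.
exists (rcons gs g).
have LE : gadgets_of x (rcons gs g) = L ++ ge x g.
  by rewrite /gadgets_of map_rcons flatten_rcons.
rewrite LE; split.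
- by rewrite size_rcons szs.
- by rewrite /shaped all_rcons ug sg eqxx.
- by rewrite map_rcons flatten_rcons; apply/tg.
- split; last by move=> e; rewrite mem_cat => /orP[/LK|/(allP geK)].
  rewrite catA cat_uniq uL ueg andbT; apply/hasPn => e /(allP gel) /=.
  by [].
split.
- by rewrite size_cat sL ge_size // mulnS addnC.
- by rewrite deg_cat mulnS addnC leq_add // ge_cen.
- move=> v vx; rewrite catA deg_cat; have := dv v vx; have := ge_deg ug vx.
  case: (boolP (v \in g)) => vg; last by clear; lia.
  by have := allP fg v vg; rewrite deg_cat; clear; lia.
move=> v l0 l1 j lE hl1; rewrite catA; have {dl} dl := dl v l0 l1 j lE hl1.
have np := npass_cat v (l1 ++ L) (ge x g).
case: (boolP (v \in g)) => vg.
  have vx : v != x by move: ug => /= /andP[xg _]; apply: contraNneq xg => <-.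
  have := allP fg v vg; have := ge_deg ug vx; rewrite vg lE !deg_cat.
  move: (npass v ((l1 ++ L) ++ ge x g)); clear; lia.
have := ge_loss ug vg; rewrite (deg_cat v (l1 ++ L)).
move: dl np; move: (npass v (l1 ++ L)) (npass v (ge x g)) (npass v ((l1 ++ L) ++ ge x g)).
by case: (v == x); rewrite ?muln1 ?muln0 ?addn0 /= ?mulnS; clear; lia.
Qed.

Definition gadgets_all (hs : seq (V * seq (seq V))) :=
  flatten [seq gadgets_of h.1 h.2 | h <- hs].

Lemma pack_all (xs : seq V) l : uniq xs -> {subset xs <= VG} -> uniq l -> {subset l <= K} ->
  size l + es * q * size xs <= Lmax ->
  (forall v, maxn (deg v l) (s + 2) + cd * q <= Bx) ->
  exists hs, let L := gadgets_all hs in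
   [/\ map fst hs = xs,
      all (fun h => [&& size h.2 == q, shaped h.1 h.2 & uniq (flatten (map gt h.2))]) hs,
      uniq (l ++ L) /\ {subset L <= K}, size L = es * q * size xs &
    forall v, deg v (l ++ L) <= maxn (deg v l) (s + 2) + cd * q * (v \in xs) /\
       deg v L <= (npass v L).*2 + (s + 2) + c * q * (v \in xs)].
Proof.
elim/last_ind: xs => [|xs x IH].
  move=> _ _ ul lK _ _; exists [::]; split=> //=; rewrite ?cats0 ?muln0 //.
  by move=> v; rewrite addn0; split=> //; apply: leq_maxl.
rewrite rcons_uniq size_rcons => /andP[xxs uxs] sV ul lK hL hB.
have [||hs [hE hsh [uL LK] sL dv]] := IH uxs _ ul lK _ hB.
- by move=> v vx; apply: sV; rewrite mem_rcons inE vx orbT.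
- lia.
set L := gadgets_all hs in uL LK sL dv *.
have LK' : {subset l ++ L <= K} by move=> e; rewrite mem_cat => /orP[/lK|/LK].
have xV : x \in VG by apply: sV; rewrite mem_rcons mem_head.
have [|||gs [szs sh ut [uL2 L2K] [sL2 dx dv2 dl2]]] := pack_centre (k := q) xV uL LK'.
- by rewrite size_cat sL; lia.
- by have [h _] := dv x; have := hB x; move: h; rewrite (negbTE xxs) muln0; lia.
- by [].
exists (rcons hs (x, gs)).
have LE : gadgets_all (rcons hs (x, gs)) = L ++ gadgets_of x gs.
  by rewrite /gadgets_all map_rcons flatten_rcons.
rewrite LE; split.
- by rewrite map_rcons hE.
- by rewrite all_rcons /= szs eqxx sh ut.
- by rewrite catA; split=> // e; rewrite mem_cat => /orP[/LK|/L2K].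
- by rewrite size_cat sL sL2 mulnS addnC.
move=> v; have [h1 h2] := dv v; split; last first.
  have := dl2 v l L _ erefl h2; rewrite mem_rcons inE.
  case: (eqVneq v x) => [->|vx] /=; first by rewrite (negbTE xxs) muln0 addn0.
  by rewrite muln0 addn0.
rewrite catA; have [->|vx] := eqVneq v x.
  rewrite deg_cat mem_rcons mem_head muln1; have [h _] := dv x; move: h.
  by rewrite (negbTE xxs) muln0 addn0 => h; apply: leq_add.
rewrite mem_rcons inE (negbTE vx) /=; apply: leq_trans (dv2 v vx) _.
by rewrite geq_max h1 /=; apply: leq_trans (leq_addr _ _); exact: leq_maxr.
Qed.

End Pack.
End Greedy.

Definition same_pair (p q : nat * nat) :=
  (p.1 == q.1) && (p.2 == q.2) || (p.1 == q.2) && (p.2 == q.1).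

Lemma uniq_edges (V : finType) (x : V) (s : seq V) (prs : seq (nat * nat)) :
  uniq s -> all (fun p => (p.1 < size s) && (p.2 < size s)) prs ->
  pairwise (fun p q => ~~ same_pair p q) prs ->
  uniq [seq [set nth x s p.1; nth x s p.2] | p <- prs].
Proof.
move=> us; elim: prs => //= p prs IH /andP[/andP[p1 p2] ap] /andP[np pp].
rewrite IH // andbT; apply/mapP => -[q qp /eqP].
have /andP[q1 q2] := allP ap q qp.
rewrite set2_eq !nth_uniq // => h; by have := allP np q qp; rewrite /same_pair h.
Qed.

Section Instances.
Variable V : finType.
Implicit Types (v x y z : V) (e : {set V}) (l : seq {set V}) (g : seq V) (T : seq V).
Variables (VG : {set V}) (K : {set {set V}}).
Hypothesis K2 : forall e, e \in K -> #|e| = 2 /\ e \subset VG.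
Hypothesis mindeg : forall v, v \in VG -> 5 * #|VG| <= 6 * #|nbr K v| + 6.

Lemma hub_uniq x g : uniq (x :: g) -> uniq (hub_gadget x g).
Proof.
case: g => [|a [|b [|y [|z [|]]]]] //.
move=> /(@uniq_edges _ x _ [:: (0,1); (0,2); (3,1); (3,2); (4,1); (4,2)]); exact.
Qed.

Lemma bowtie_uniq x g : uniq (x :: g) -> uniq (bowtie x g).
Proof.
case: g => [|a [|b [|c [|a' [|b' [|c' [|]]]]]]] //.
move=> /(@uniq_edges _ x _ [:: (0,1); (1,2); (2,3); (3,0); (0,4); (4,5); (5,6); (6,0)]); exact.
Qed.

Lemma card2_neq x y : [set x; y] \in K -> x != y.
Proof. by move/K2 => []; rewrite cards2; case: (x != y). Qed.

Lemma saturated_le s Sb L l : {subset l <= K} -> size l <= L -> 2 * L <= s * Sb -> 0 < s ->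
  #|saturated s l| <= Sb.
Proof.
move=> lK hl hL s0; rewrite -(leq_pmul2l s0).
apply: leq_trans (saturated_card _ _) _ => [e /lK/K2[]//|].
by apply: leq_trans hL; rewrite leq_mul2l hl orbT.
Qed.

Lemma hub_find s Sb Lmax Bx q :
  0 < s -> 2 * Lmax <= s * Sb -> 6 * (Bx + Sb) + 18 <= 5 * #|VG| ->
  12 * s + 6 * (Sb + 2 * q) + 30 <= 4 * #|VG| ->
  forall x l T, x \in VG -> {subset l <= K} -> deg x l <= Bx -> size l <= Lmax ->
  size T <= 2 * q ->
  exists g, [/\ uniq (x :: g), size g = 4, all (fun v => deg v l < s) g,
    uniq (T ++ hub_leaves g) <-> uniq T &
    [/\ uniq (hub_gadget x g), all (mem K) (hub_gadget x g) & all (predC (mem l)) (hub_gadget x g)]].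
Proof.
move=> s0 hL n1 n2 x l T xV lK dB sl sT.
have sat := saturated_le lK sl hL s0.
have cT : #|[set v in T]| <= 2 * q by rewrite cardsE; apply: leq_trans (card_size _) _.
have [||a [b [y [z [[ab yz yx zx] fr [_ _ yT zT] gK gl]]]]] :=
  find_four K2 mindeg (x := x) (T1 := set0) (t1 := 0) xV dB sat _ cT _ n2.
- by rewrite cards0.
- by rewrite addn0.
exists [:: a; b; y; z].
have ug : uniq [:: x; a; b; y; z].
  move/and5P: (gK) => /= [/card2_neq xa /card2_neq xb /card2_neq ya /card2_neq yb].
  move=> /and3P[/card2_neq za /card2_neq zb _].
  rewrite !inE !negb_or xa xb (eq_sym x y) yx (eq_sym x z) zx ab.
  by rewrite (eq_sym a y) ya (eq_sym a z) za (eq_sym b y) yb (eq_sym b z) zb yz.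
split=> //; last by split=> //; apply: hub_uniq.
rewrite /= cat_uniq /= !inE !orbF in yT zT *.
by rewrite (negbTE yT) (negbTE zT) yz /= andbT.
Qed.

(** Three of the four vertices of [find_four] give a petal.  The second petal
    must avoid the first, whence the margins 2, 3 and 4 in the hypotheses. *)
Lemma bowtie_find s Sb Lmax Bx q :
  0 < s -> 2 * (Lmax + 4) <= s * Sb -> 6 * (Bx + 2 + Sb + (6 * q + 3)) + 18 <= 5 * #|VG| ->
  12 * s + 6 * (Sb + (6 * q + 3)) + 30 <= 4 * #|VG| ->
  forall x l T, x \in VG -> {subset l <= K} -> deg x l <= Bx -> size l <= Lmax ->
  size T <= 6 * q ->
  exists g, [/\ uniq (x :: g), size g = 6, all (fun v => deg v l < s) g,
    uniq (T ++ g) <-> uniq T &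
    [/\ uniq (bowtie x g), all (mem K) (bowtie x g) & all (predC (mem l)) (bowtie x g)]].
Proof.
move=> s0 hL n1 n2 x l T xV lK dB sl sT.
have cT : #|[set v in T]| <= 6 * q + 3.
  by rewrite cardsE; apply: leq_trans (card_size _) _; move: sT; clear; lia.
have sat : #|saturated s l| <= Sb by apply: saturated_le lK sl _ s0; apply: leq_trans hL; rewrite leq_mul2l leq_addr orbT.
have [|a [c [b [z [[ac _ bx _] /and5P[fa fc fb _ _] [aT cT' bT _] gK gl]]]]] :=
  find_four K2 mindeg (x := x) (T1 := [set v in T]) xV dB sat cT cT _ n2; first by move: n1; clear; lia.
move/and5P: gK => /= [xaK xcK baK bcK _]; move/and5P: gl => /= [xal xcl bal bcl _].
have xa := card2_neq xaK; have xc := card2_neq xcK; have ba := card2_neq baK; have bc := card2_neq bcK.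
pose l' := l ++ petal x a b c; pose T' := [set v in T ++ [:: a; b; c]].
have pK : {subset petal x a b c <= K}.
  by move=> e; rewrite !inE => /or4P[]/eqP->; rewrite ?xaK ?bcK // setUC.
have lK' : {subset l' <= K} by move=> e; rewrite mem_cat => /orP[/lK|/pK].
have dB' : deg x l' <= Bx + 2.
  rewrite deg_cat /deg /= !in_set2 eqxx (negbTE xa) (negbTE xc) (eq_sym x b) (negbTE bx) /= -/(deg x l).
  move: dB; clear; lia.
have sat' : #|saturated s l'| <= Sb.
  by apply: saturated_le lK' _ hL s0; rewrite size_cat /=; move: sl; clear; lia.
have cT2 : #|T'| <= 6 * q + 3.
  by rewrite cardsE; apply: leq_trans (card_size _) _; rewrite size_cat /=; move: sT; clear; lia.
have [|a' [c' [b' [z' [[ac' _ bx' _] /and5P[fa' fc' fb' _ _] [aT' cT3 bT' _] gK gl]]]]] :=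
  find_four K2 mindeg (x := x) (T1 := T') xV dB' sat' cT2 cT2 _ n2; first by move: n1; clear; lia.
move/and5P: gK => /= [xaK' xcK' baK' bcK' _]; move/and5P: gl => /= [xal' xcl' bal' bcl' _].
have xa' := card2_neq xaK'; have xc' := card2_neq xcK'.
have ba' := card2_neq baK'; have bc' := card2_neq bcK'.
exists [:: a; b; c; a'; b'; c'].
rewrite !inE in aT cT' bT.
rewrite !inE !mem_cat !inE !negb_or in aT' cT3 bT'.
move: aT' cT3 bT' => /and4P[aT' aa' ab' ac2] /and4P[cT2' ca' cb' cc'] /and4P[bT' ba2 bb' bc2].
have ug : uniq [:: x; a; b; c; a'; b'; c'].
  rewrite /= !inE !negb_or xa xc (eq_sym x b) bx xa' xc' (eq_sym x b') bx'.
  rewrite (eq_sym a b) ba ac bc ac' bc' (eq_sym a' b') ba'.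
  by rewrite ![a == _]eq_sym ![b == _]eq_sym ![c == _]eq_sym aa' ba2 ca' ab' bb' cb' ac2 bc2 cc'.
have low v : deg v l' < s -> deg v l < s by rewrite deg_cat; clear; lia.
split=> //.
- by rewrite /= fa fb fc !low.
- rewrite cat_uniq; have -> : uniq [:: a; b; c; a'; b'; c'] by case/andP: ug.
  rewrite andbT (_ : ~~ has _ _) ?andbT //=.
  by rewrite !negb_or aT bT cT' aT' bT' cT2'.
split; first exact: bowtie_uniq.
  apply/allP => e; rewrite [bowtie _ _]/bowtie mem_cat => /orP[/pK//|].
  by rewrite !inE => /or4P[]/eqP->; rewrite ?xaK' ?bcK' // setUC.
move: xal' xcl' bal' bcl'; rewrite /l' !mem_cat !negb_or.
move=> /andP[xal' _] /andP[xcl' _] /andP[bal' _] /andP[bcl' _].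
apply/allP => e; rewrite [bowtie _ _]/bowtie mem_cat !inE => /orP[] /or4P[]/eqP->;
  by rewrite /= ?xal ?bcl ?xal' ?bcl' // setUC.
Qed.

End Instances.

(** * Vertices tied to a hub *)

Lemma alternating_infix (T : Type) (S p : pred T) l1 l2 l3 :
  alternating p [seq e <- l1 ++ l2 ++ l3 | S e] -> alternating p [seq e <- l2 | S e].
Proof.
rewrite /alternating !filter_cat.
have catr (a b : seq T) : sorted (fun x y => p x != p y) (a ++ b) -> sorted (fun x y => p x != p y) b.
  by elim: a => // x a IH /path_sorted; apply: IH.
by move/catr; case: [seq e <- l2 | S e] => // x a; rewrite cat_cons /= cat_path => /andP[].
Qed.

Lemma alternating_balanced (T : Type) (p : pred T) l : alternating p l ->
  count p l <= (count (predC p) l).+1 /\ count (predC p) l <= (count p l).+1.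
Proof.
have bal (x : T) r : path (fun x y => p x != p y) x r ->
   count p (x :: r) + ~~ p x + ~~ p (last x r) = (count (predC p) (x :: r)).+1.
  elim: r x => [|y r IH] x; first by rewrite /=; case: (p x).
  rewrite [path _ _ _]/= => /andP[xy /IH]; rewrite [last _ _]/= ![count _ (x :: _)]/=.
  by move: xy => /=; case: (p x); case: (p y); case: (p (last y r)) => //= _; lia.
case: l => // x r /bal; case: (p x); case: (p (last x r)) => /=; lia.
Qed.

Lemma count_set (T : finType) (l : seq T) (P : pred T) (A : {set T}) :
  uniq l -> (forall e, e \in l -> P e -> e \in A) -> count P l <= #|A|.
Proof.
move=> ul h; rewrite -size_filter cardE; apply: uniq_leq_size; first exact: filter_uniq.
by move=> e; rewrite mem_filter mem_enum => /andP[Pe el]; apply: h.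
Qed.

Lemma card_count (T : finType) (l : seq T) (P : pred T) :
  uniq l -> #|[set e | (e \in l) && P e]| = count P l.
Proof.
move=> ul; rewrite -size_filter -(card_uniqP (filter_uniq P ul)).
by apply: eq_card => e; rewrite inE mem_filter andbC.
Qed.

Section HubReach.
Variable V : finType.
Implicit Types (x y : V) (g : seq V) (S p : pred {set V}).

(** Vertices joined to x by a path of two surviving edges of K of sign c. *)
Definition hub_reach (K : {set {set V}}) S p (c : bool) x :=
  [set y | [exists w, [&& [set x; w] \in K, [set y; w] \in K, S [set x; w], S [set y; w],
     p [set x; w] == c & p [set y; w] == c]]].

(** An intact gadget ties its two leaves to x, the leaves of different gadgets
    are distinct, and a deletion spoils only one gadget. *)
Lemma hub_reach_card (K : {set {set V}}) S p c x gs :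
  shaped 4 x gs -> uniq (flatten (map (@hub_leaves V) gs)) ->
  {subset gadgets_of (@hub_gadget V) x gs <= K} ->
  alternating p [seq e <- gadgets_of (@hub_gadget V) x gs | S e] ->
  2 * size gs <= #|hub_reach K S p c x| + 2 * count (predC S) (gadgets_of (@hub_gadget V) x gs).
Proof.
move=> sh ul gK alt; pose ok g := all S (hub_gadget x g).
have cnt : size gs <= size (filter ok gs) + count (predC S) (gadgets_of (@hub_gadget V) x gs).
  clear; elim: gs => //= g gs IH; rewrite /gadgets_of /= count_cat.
  rewrite -/(gadgets_of _ _ _); case: ifP => [_|no] /=.
    by move: IH; clear; lia.
  have : 0 < count (predC S) (hub_gadget x g) by rewrite -has_count has_predC -/(ok g) no.
  by move: IH; clear; lia.
have sz2 : size (flatten (map (@hub_leaves V) (filter ok gs))) = 2 * size (filter ok gs).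
  clear -sh; elim: gs sh => //= g gs IH /andP[/andP[_ /eqP sg] /IH].
  by case: ifP => _ //=; rewrite size_cat /hub_leaves size_drop sg => ->; rewrite mulnS.
have sub : {subset flatten (map (@hub_leaves V) (filter ok gs)) <= hub_reach K S p c x}.
  move=> y /flatten_mapP[g]; rewrite mem_filter => /andP[okg gin] yg.
  case/splitPr: gin sh gK alt {ul cnt sz2} => gs1 gs2 sh gK alt.
  move: sh; rewrite /shaped all_cat /= => /and3P[_ /andP[ug /eqP sg] _].
  move: gK alt; rewrite /gadgets_of map_cat flatten_cat /= => gK /alternating_infix alt.
  have {}gK : {subset hub_gadget x g <= K}.
    by move=> e eg; apply: gK; rewrite !mem_cat eg orbT.
  case: g sg {ug} yg okg gK alt => [|a [|b [|y' [|z [|]]]]] // _ yg okg gK alt.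
  have [w wab [[e1 e2 e3] [s1 s2 s3]]] := hub_tie c okg alt.
  have inK : [/\ [set x; w] \in K, [set y'; w] \in K & [set z; w] \in K].
    by move: wab; rewrite !inE => /orP[] /eqP->; split; apply: gK; rewrite !inE eqxx ?orbT.
  have [k1 k2 k3] := inK.
  rewrite inE; apply/existsP; exists w.
  by move: yg; rewrite !inE => /orP[] /eqP->; rewrite ?k1 ?k2 ?k3 ?s1 ?s2 ?s3 ?e1 ?e2 ?e3 !eqxx.
have uf : uniq (flatten (map (@hub_leaves V) (filter ok gs))).
  clear -ul; elim: gs ul => //= g gs IH; rewrite cat_uniq => /and3P[u1 hn u2].
  case: ifP => _ /=; last exact: IH.
  rewrite cat_uniq u1 IH // andbT /=; apply: contra hn => /hasP[y yf yg].
  apply/hasP; exists y => //; move: yf => /flatten_mapP[g']; rewrite mem_filter => /andP[_ g'in] yg'.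
  by apply/flatten_mapP; exists g'.
have : 2 * size (filter ok gs) <= #|hub_reach K S p c x|.
  by rewrite -sz2 cardE; apply: uniq_leq_size => // y /sub; rewrite mem_enum.
by move: cnt; clear; lia.
Qed.
End HubReach.

(** * Classes with a single edge *)

Lemma alternating_catl (T : Type) (S p : pred T) l1 l2 :
  alternating p [seq e <- l1 ++ l2 | S e] -> alternating p [seq e <- l1 | S e].
Proof. exact: (@alternating_infix _ _ _ [::]). Qed.

Lemma alternating_catr (T : Type) (S p : pred T) l1 l2 :
  alternating p [seq e <- l1 ++ l2 | S e] -> alternating p [seq e <- l2 | S e].
Proof. by rewrite -[l2 in X in X -> _]cats0; apply: alternating_infix. Qed.

Lemma uniq_flatten_map (I T : eqType) (tl : I -> seq T) (s : seq I) : uniq s ->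
  (forall i, i \in s -> uniq (tl i)) ->
  (forall i j x, i \in s -> j \in s -> x \in tl i -> x \in tl j -> i = j) ->
  uniq (flatten (map tl s)).
Proof.
elim: s => //= i s IH /andP[ni us] ut dis.
rewrite cat_uniq ut ?mem_head // IH //=.
- rewrite andbT; apply/hasPn => x /flatten_mapP[j js xj]; apply/negP => xi.
  by move: ni; rewrite (dis i j x) ?mem_head ?inE ?js ?orbT.
- by move=> j js; apply: ut; rewrite inE js orbT.
- by move=> j k x js ks; apply: dis; rewrite inE ?js ?ks orbT.
Qed.

Section Prefix.
Variables (V I : finType) (K : {set {set V}}) (E : I -> {set {set V}}).
Hypothesis EK : forall i e, e \in E i -> e \notin K.
Hypothesis EE : forall i j e, e \in E i -> e \in E j -> i = j.
Hypothesis K0 : K != set0.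
Hypothesis singles : forall i j k, uniq [:: i; j; k] ->
  ~ [/\ #|E i| = 1, #|E j| = 1 & #|E k| = 1].

(** If two classes are single edges, these edges are put in front with an edge
    of K between them: they are two places apart and receive the same sign.  The
    list idx holds the classes that remain to be ordered. *)
Lemma prefix_exists : exists (pre : seq {set V}) (idx : seq I),
  [/\ [/\ uniq pre, uniq idx & size pre <= 3],
      forall e, e \in pre -> e \in K \/ exists2 i, i \notin idx & e \in E i,
      forall i, i \notin idx -> #|E i| = 1 /\ {subset E i <= pre},
      forall e f, e \in pre -> f \in pre -> e \in K -> f \in K -> e = f &
      forall p, alternating p pre -> forall i j e f, i != j -> #|E i| = 1 -> #|E j| = 1 ->
        e \in E i -> f \in E j -> p e = p f].
Proof.
have [/existsP[i /existsP[j /and3P[ij /eqP Ei /eqP Ej]]]|none] :=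
  boolP [exists i, exists j, [&& i != j, #|E i| == 1 & #|E j| == 1]]; last first.
  exists [::], (enum I); split=> //; first by rewrite enum_uniq.
    by move=> i; rewrite mem_enum.
  move=> p _ i j e f ij Ei Ej; case/negP: none; apply/existsP; exists i.
  by apply/existsP; exists j; rewrite ij Ei Ej.
have [ei Eei] := cards1P (introT eqP Ei); have [ej Eej] := cards1P (introT eqP Ej).
have [f fK] := set0Pn _ K0.
have eiE : ei \in E i by rewrite Eei set11.
have ejE : ej \in E j by rewrite Eej set11.
have eiK := EK eiE; have ejK := EK ejE.
have eif : ei != f by apply: contraNneq eiK => ->.
have ejf : f != ej by apply: contraNneq ejK => <-.
have eij : ei != ej by apply: contraNneq ij => h; apply/eqP; apply: EE eiE _; rewrite h.
exists [:: ei; f; ej], [seq k <- enum I | (k != i) && (k != j)]; split.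
- by rewrite /= !inE negb_or eif eij ejf filter_uniq // enum_uniq.
- move=> e; rewrite !inE => /or3P[]/eqP->; [right|by left|right].
    by exists i => //; rewrite mem_filter eqxx.
  by exists j => //; rewrite mem_filter eqxx andbF.
- move=> k; rewrite mem_filter mem_enum andbT negb_and !negbK => /orP[]/eqP->; split=> // e.
    by rewrite Eei => /set1P->; rewrite mem_head.
  by rewrite Eej => /set1P->; rewrite !inE eqxx !orbT.
- move=> e e'; rewrite !inE => /or3P[]/eqP-> /or3P[]/eqP-> //;
    by rewrite ?(negbTE eiK) ?(negbTE ejK).
move=> p /and3P[h1 h2 _] i' j' e e' ij' Ei' Ej' eE eE'.
have pe : p ei = p ej by move: h1 h2; case: (p ei); case: (p f); case: (p ej).
have mem2 k : #|E k| = 1 -> k = i \/ k = j.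
  move=> Ek; have [->|ki] := eqVneq k i; first by left.
  have [->|kj] := eqVneq k j; first by right.
  by case: (@singles k i j); rewrite //= !inE negb_or ki kj ij.
case: (mem2 _ Ei') eE ij' => ->; case: (mem2 _ Ej') eE' => ->; rewrite ?eqxx //.
  by rewrite Eei Eej => /set1P-> /set1P->.
by rewrite Eei Eej => /set1P-> /set1P->.
Qed.
End Prefix.

(** * Packings in a graph of large minimum degree *)

Section Packings.
Variables (V : finType) (VG : {set V}) (K : {set {set V}}).
Variables (rho m sh : nat).
Let n := #|VG|.
Let gq := (5 * n) %/ 16.
Let N1 := n %/ 100.
Hypothesis K2 : forall e, e \in K -> #|e| = 2 /\ e \subset VG.
Hypothesis mindeg : forall v, v \in VG -> 5 * n <= 6 * #|nbr K v| + 6.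
Hypothesis m_small : 4000 * m <= N1.
Hypothesis sh_small : 10 * sh <= m.
Hypothesis rho_small : 200 * (360 * rho) <= sh.
Hypothesis m_large : 100 <= m.
Hypothesis rho_gt0 : 0 < rho.

Definition size_ok q sz (gt : seq V -> seq V) (h : V * seq (seq V)) :=
  [&& size h.2 == q, shaped sz h.1 h.2 & uniq (flatten (map gt h.2))].

Let gq16 : 16 * gq <= 5 * n.
Proof. by rewrite mulnC; exact: leq_trunc_div. Qed.

Let N100 : 100 * N1 <= n.
Proof. by rewrite mulnC; exact: leq_trunc_div. Qed.

Let n200 : n <= 200 * N1.
Proof.
have := divn_eq n 100; have := ltn_pmod n (isT : 0 < 100); rewrite -/N1.
by move: m_small m_large; clear; lia.
Qed.

(** At most N1 vertices reach degree sh in the hub gadgets. *)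
Lemma hub_total : 2 * (6 * gq * (96 * rho)) <= sh * N1.
Proof.
have e1 : 2 * (6 * gq * (96 * rho)) = 72 * rho * (16 * gq) by clear; lia.
rewrite e1; apply: leq_trans (_ : 72 * rho * (5 * (200 * N1)) <= _).
  by rewrite leq_mul2l (leq_trans gq16) ?orbT // leq_mul2l n200 orbT.
by rewrite !mulnA leq_mul2r; apply/orP; right; move: rho_small; clear; lia.
Qed.

(** There are gq = 5n/16 gadgets per hub, with two leaves each, so an undamaged
    hub is tied to 5n/8 > 60n/100 vertices. *)
Lemma hubs_exist : exists hs, let L := gadgets_all (@hub_gadget V) hs in
  [/\ size hs = 96 * rho,
     all (fun h => h.1 \in VG) hs,
     all (size_ok gq 4 (@hub_leaves V)) hs,
     uniq L /\ {subset L <= K} &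
     size L = 6 * gq * (96 * rho) /\
     forall v, deg v L <= sh + 2 + 2 * gq /\ deg v L <= (npass v L).*2 + (sh + 2)].
Proof.
have hn : 96 * rho <= size (enum VG).
  rewrite -cardE -/n; have := leq_trunc_div n 100; rewrite -/N1.
  by move: m_small sh_small rho_small; clear; lia.
pose xs := take (96 * rho) (enum VG).
have sxs : size xs = 96 * rho by rewrite size_takel.
have sh0 : 0 < sh by move: rho_small rho_gt0; clear; lia.
have n1 : 6 * ((sh + 2 + 2 * gq) + N1) + 18 <= 5 * n.
  by move: gq16 N100 m_small sh_small m_large; clear; lia.
have n2 : 12 * sh + 6 * (N1 + 2 * gq) + 30 <= 4 * n.
  by move: gq16 N100 m_small sh_small m_large; clear; lia.
have := @pack_all V VG K (@hub_gadget V) (@hub_leaves V) 4 6 2 2 0 gq sh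
  (6 * gq * (96 * rho)) (sh + 2 + 2 * gq).
move=> /(_ _ _ _ _ _ _ xs [::]) [].
- by move=> x [|a [|b [|y [|z [|]]]]].
- by move=> g sg; rewrite /hub_leaves size_drop sg.
- exact: hub_deg.
- exact: hub_centre.
- move=> x g v ug vg; rewrite mul0n addn0; exact: hub_passages.
- move=> x l T xV lK dB sl sT.
  exact: (@hub_find _ _ _ K2 mindeg sh N1 _ _ _ sh0 hub_total n1 n2 x l T xV lK dB sl sT).
- by rewrite take_uniq // enum_uniq.
- by move=> x /mem_take; rewrite mem_enum.
- by [].
- by [].
- by rewrite sxs.
- by move=> v; rewrite max0n.
move=> hs [hE hok [uL LK] sL dv]; exists hs; split=> //.
- by rewrite -(size_map fst) hE.
- by apply/allP => h hin; have /mem_take : h.1 \in xs by [rewrite -hE map_f]; rewrite mem_enum.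
- by rewrite sL sxs; split=> // v; have [] := dv v; rewrite /= max0n mul0n addn0 => h1 h2; split=> //;
    apply: leq_trans h1 _; rewrite leq_add2l; case: (v \in xs); rewrite ?muln1 ?muln0.
Qed.

(** The degrees may rise to N1 this time, since there are m bow-ties at every
    vertex and the total number of edges used is quadratic in n. *)
Lemma bowties_exist (lh : seq {set V}) : uniq lh -> {subset lh <= K} ->
  size lh = 6 * gq * (96 * rho) ->
  (forall v, deg v lh <= sh + 2 + 2 * gq) ->
  exists hs, let L := gadgets_all (@bowtie V) hs in
  [/\ map fst hs = enum VG,
     all (size_ok m 6 id) hs,
     uniq (lh ++ L) /\ {subset L <= K} &
     forall v, deg v L <= (npass v L).*2 + (N1 + 2) + 2 * m].
Proof.
move=> ulh lhK slh dlh.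
have N0 : 0 < N1 by move: m_small m_large; clear; lia.
pose Lf := size lh + 8 * m * n.
have b0 : 2 * (Lf + 4) <= N1 * N1.
  have h1 := hub_total; rewrite -slh in h1.
  have h2 : 16 * m * n <= 3200 * m * N1.
    by rewrite (_ : 3200 * m * N1 = 16 * m * (200 * N1)) ?leq_mul2l ?n200 ?orbT //; clear; lia.
  have h3 : (sh + 3200 * m + 8) * N1 <= N1 * N1.
    by rewrite leq_mul2r; apply/orP; right; move: m_small sh_small m_large; clear; lia.
  apply: leq_trans h3; rewrite (mulnDl (sh + 3200 * m)) (mulnDl sh).
  have -> : 2 * (Lf + 4) = 2 * size lh + 16 * m * n + 8 by rewrite /Lf; clear; lia.
  apply: leq_add; last by move: N0; clear; lia.
  exact: leq_add h1 h2.
pose Bf := (sh + 2 + 2 * gq) + (N1 + 2) + 4 * m.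
have b1 : 6 * (Bf + 2 + N1 + (6 * m + 3)) + 18 <= 5 * n.
  by rewrite /Bf; move: gq16 N100 m_small sh_small m_large; clear; lia.
have b2 : 12 * N1 + 6 * (N1 + (6 * m + 3)) + 30 <= 4 * n.
  by move: gq16 N100 m_small sh_small m_large; clear; lia.
have := @pack_all V VG K (@bowtie V) id 6 8 6 4 2 m N1 Lf Bf.
move=> /(_ _ _ _ _ _ _ (enum VG) lh) [].
- by move=> x [|a [|b [|y [|z [|a' [|b' [|]]]]]]].
- by [].
- move=> x g v ug vx; apply: leq_trans (bowtie_deg ug vx) _.
  by rewrite -muln2 mulnC leq_mul2r orbT.
- move=> x g; case: g => [|a [|b [|c [|a' [|b' [|c' [|]]]]]]] // ug.
  by have [-> _] := bowtie_centre ug erefl.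
- move=> x g v ug vg; have [->|vx] := eqVneq v x; last first.
    by rewrite muln0 addn0; apply: bowtie_passages.
  case: g {vg} ug => [|a [|b [|c [|a' [|b' [|c' [|]]]]]]] // ug.
  by have [-> ->] := bowtie_centre ug erefl.
- move=> x l T xV lK dB sl sT.
  exact: (@bowtie_find _ _ _ K2 mindeg N1 N1 _ _ _ N0 b0 b1 b2 x l T xV lK dB sl sT).
- by rewrite enum_uniq.
- by move=> x; rewrite mem_enum.
- by [].
- by [].
- by rewrite -cardE /Lf.
- move=> v; rewrite /Bf leq_add2r; have := dlh v; move: (deg v lh); clear; lia.
move=> hs [hE hok [uL LK] sL dv]; exists hs; split=> //.
move=> v; have [_ h] := dv v; apply: leq_trans h _; rewrite leq_add2l.
by case: (v \in _); rewrite ?muln1 ?muln0.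
Qed.
End Packings.

(** * The order of the edges *)

Lemma gadgets_all_cat (V : finType) ge hs1 hs2 :
  gadgets_all ge (hs1 ++ hs2) = gadgets_all ge hs1 ++ gadgets_all ge hs2 :> seq {set V}.
Proof. by rewrite /gadgets_all map_cat flatten_cat. Qed.

Lemma gadgets_all_cons (V : finType) ge h hs :
  gadgets_all ge (h :: hs) = gadgets_of ge h.1 h.2 ++ gadgets_all ge hs :> seq {set V}.
Proof. by []. Qed.

Lemma gadgets_of_passages (V : finType) (v x : V) gs : v != x -> shaped 6 x gs ->
  deg v (gadgets_of (@bowtie V) x gs) <= (npass v (gadgets_of (@bowtie V) x gs)).*2.
Proof.
move=> vx; elim: gs => //= g gs IH /andP[/andP[ug _] /IH h].
rewrite /gadgets_of /= -/(gadgets_of _ _ _) deg_cat.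
have := npass_cat v (bowtie x g) (gadgets_of (@bowtie V) x gs).
by move: (bowtie_passages ug vx) h; clear; lia.
Qed.

Lemma gadgets_all_passages (V : finType) (v : V) m hs : v \notin map fst hs ->
  all (size_ok m 6 id) hs ->
  deg v (gadgets_all (@bowtie V) hs) <= (npass v (gadgets_all (@bowtie V) hs)).*2.
Proof.
elim: hs => //= h hs IH; rewrite inE negb_or => /andP[vh vhs] /andP[/and3P[_ sh _] /(IH vhs) le].
rewrite gadgets_all_cons deg_cat.
have := npass_cat v (gadgets_of (@bowtie V) h.1 h.2) (gadgets_all (@bowtie V) hs).
by move: (gadgets_of_passages vh sh) le; clear; lia.
Qed.

Lemma gadgets_of_centre (V : finType) (x : V) gs : shaped 6 x gs ->
  deg x (gadgets_of (@bowtie V) x gs) = 4 * size gs.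
Proof.
elim: gs => //= g gs IH /andP[/andP[ug /eqP sg] /IH h].
rewrite /gadgets_of /= -/(gadgets_of _ _ _) deg_cat h.
by have [-> _] := bowtie_centre ug sg; rewrite mulnS.
Qed.

Lemma gadgets_of_deg (V : finType) (v x : V) gs : v != x -> shaped 6 x gs ->
  deg v (gadgets_of (@bowtie V) x gs) <= (count_mem v (flatten gs)).*2.
Proof.
move=> vx; elim: gs => //= g gs IH /andP[/andP[ug _] /IH h].
rewrite /gadgets_of /= -/(gadgets_of _ _ _) deg_cat count_cat doubleD leq_add //.
apply: leq_trans (bowtie_deg ug vx) _; rewrite leq_double.
by case: (boolP (v \in g)) => // vg; rewrite -has_count has_pred1.
Qed.

Lemma gadgets_of_cost (V : finType) (x : V) gs (S p dirty : pred {set V}) (c : bool) :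
  shaped 6 x gs ->
  alternating p [seq e <- gadgets_of (@bowtie V) x gs | S e] ->
  (forall e, e \in gadgets_of (@bowtie V) x gs -> x \in e -> ~~ dirty e -> S e -> p e = c) ->
  3 * size gs <= 3 * count dirty (gadgets_of (@bowtie V) x gs)
       + count (fun e => ~~ dirty e && ~~ S e) (gadgets_of (@bowtie V) x gs).
Proof.
elim: gs => [|g gs IH]; first by rewrite muln0.
rewrite /= => /andP[/andP[ug /eqP sg] sh].
rewrite /gadgets_of /= -/(gadgets_of _ _ _) => alt mono; rewrite !count_cat.
have h1 := bowtie_cost (c := c) sg (alternating_catl alt)
  (fun e eg => mono e (mem_subseq (prefix_subseq _ _) eg)).
have h2 := IH sh (alternating_catr alt) (fun e eg => mono e (mem_subseq (suffix_subseq _ _) eg)).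
by rewrite mulnS mulnDr addnACA leq_add.
Qed.

Section Ordering.
Variables (V I : finType) (VG : {set V}) (K : {set {set V}}) (E : I -> {set {set V}}).
Variables (rho m sh : nat).
Let n := #|VG|.
Let N1 := n %/ 100.
Hypothesis K2 : forall e, e \in K -> #|e| = 2 /\ e \subset VG.
Hypothesis E2 : forall i e, e \in E i -> #|e| = 2.
Hypothesis EK : forall i e, e \in E i -> e \notin K.
Hypothesis EE : forall i j e, e \in E i -> e \in E j -> i = j.
Hypothesis singles : forall i j k, uniq [:: i; j; k] ->
  ~ [/\ #|E i| = 1, #|E j| = 1 & #|E k| = 1].
Hypothesis mindeg : forall v, v \in VG -> 5 * n <= 6 * #|nbr K v|.
Hypothesis m_small : 4000 * m <= N1.
Hypothesis sh_small : 10 * sh <= m.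
Hypothesis rho_small : 200 * (360 * rho) <= sh.
Hypothesis I_small : 10 * #|I| <= m.
Hypothesis m_large : 100 <= m.
Hypothesis rho_gt0 : 0 < rho.

Let EG := K :|: \bigcup_i E i.

(** The order consists of the prefix for single classes, a trail order of each
    further class, the hub gadgets, the bow-ties and a trail order of the rest of
    K.  Along this order, alternation has five consequences: each class is
    balanced; two single classes agree when nothing is deleted; a vertex whose
    clean edges in K have one sign pays nearly half of the minimum degree 5n/6;
    few deletions spare a hub; and, thanks to the bow-ties, a vertex with clean
    edges of one sign in the whole graph pays half of its degree with m to spare,
    where the deletions in its own bow-ties count as well. *)
Lemma ordering : exists (sigma : seq {set V}) (Bow : V -> {set {set V}}),
  [/\ uniq sigma, sigma =i EG,
    [/\ forall u, Bow u \subset K, forall u v, u != v -> [disjoint Bow u & Bow v] &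
        forall u y, y != u -> #|[set e in Bow u | y \in e]| <= 2] &
    forall S p : pred {set V}, alternating p [seq e <- sigma | S e] ->
    [/\ forall i c, #|[set e in E i | S e && (p e == c)]|
                 <= #|[set e in E i | S e && (p e == ~~ c)]|.+1,
        (forall e, e \in EG -> S e) -> forall i j e f, i != j -> #|E i| = 1 -> #|E j| = 1 ->
          e \in E i -> f \in E j -> p e = p f,
        forall u (dirty : pred {set V}) c, u \in VG ->
          (forall e, e \in K -> u \in e -> ~~ dirty e -> S e -> p e = c) ->
          41 * n <= 100 * #|[set e in K | (u \in e) && (dirty e || ~~ S e)]|,
        #|[set e in EG | ~~ S e]| < rho * n ->
          exists2 x, x \in VG & forall c, 60 * n <= 100 * #|hub_reach K S p c x| &
        forall u (dirty : pred {set V}) c, u \in VG ->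
          (forall e, e \in EG -> u \in e -> ~~ dirty e -> S e -> p e = c) ->
          #|[set e in EG | u \in e]| + m <=
            2 * (#|[set e in EG | [&& (u \in e) || (e \in Bow u), ~~ dirty e & ~~ S e]]|
                 + #|[set e in EG | (u \in e) && dirty e]|
                 + 3 * #|[set e in Bow u | dirty e]|)]].
Proof.
have N100 : 100 * N1 <= n by rewrite mulnC; exact: leq_trunc_div.
have [v0 v0V] : exists v, v \in VG.
  by apply/card_gt0P; rewrite -/n; move: N100 m_small m_large; clear; lia.
have Kn0 : K != set0.
  apply: contraTneq (mindeg v0V) => Ke; rewrite -ltnNge.
  have -> : nbr K v0 = set0 by apply/setP => w; rewrite !inE Ke inE.
  by rewrite cards0 muln0; move: N100 m_small m_large; clear; lia.
have [pre [idx [[upre uidx spre] preE idxE preK preS]]] := prefix_exists EK EE Kn0 singles.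
pose K0 := K :\: [set e in pre].
have K0K : {subset K0 <= K} by move=> e; rewrite inE => /andP[].
have K02 e : e \in K0 -> #|e| = 2 /\ e \subset VG by move/K0K/K2.
have mindeg0 v : v \in VG -> 5 * n <= 6 * #|nbr K0 v| + 6.
  move=> vV; have le1 : #|nbr K v| <= #|nbr K0 v| + 1.
    rewrite -(cardsID (nbr K0 v) (nbr K v)) leq_add //.
      by apply: subset_leq_card; apply: subsetIr.
    rewrite leqNgt; apply/negP => /card_gt1P[w [w' []]].
    rewrite !inE => /andP[nw wK] /andP[nw' wK'].
    rewrite wK wK' !andbT !negbK in nw nw'.
    have := preK _ _ nw nw' wK wK' => /eqP; rewrite set2_eq eqxx /=.
    by case/orP => [/eqP->|/andP[/eqP-> /eqP->]]; rewrite eqxx.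
  by have := mindeg vV; move: le1; clear; lia.
have [hh [shh hhV hhok [uh hK0] [sh_size dh]]] :=
  hubs_exist K02 mindeg0 m_small sh_small rho_small m_large rho_gt0.
set lh := gadgets_all (@hub_gadget V) hh in uh hK0 sh_size dh.
have [bs [bsE bsok [ub bK0] db]] := bowties_exist K02 mindeg0 m_small sh_small rho_small
  m_large uh hK0 sh_size (fun v => proj1 (dh v)).
set lf := gadgets_all (@bowtie V) bs in ub bK0 db.
pose R := K0 :\: [set e in lh ++ lf].
have R2 e : e \in R -> #|e| = 2 by rewrite inE => /andP[_ /K02[]].
have [lr [ur rR dr]] := trail_order R2.
have [tl tlP] : exists tl : I -> seq {set V}, forall i,
   [/\ uniq (tl i), tl i =i E i & forall v, deg v (tl i) <= (npass v (tl i)).*2 + 2].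
  by have h i := trail_order (@E2 i); apply: (fin_all_exists h).
pose lc := flatten [seq tl i | i <- idx].
have ulc : uniq lc.
  apply: uniq_flatten_map => // [i _|i j e _ _]; first by have [] := tlP i.
  by have [_ -> _] := tlP i; have [_ -> _] := tlP j; apply: EE.
have lcE e : e \in lc -> exists2 i, i \in idx & e \in E i.
  by case/flatten_mapP => i ii; have [_ -> _] := tlP i; exists i.
have lKE e : (e \in lh ++ (lf ++ lr)) = (e \in K0).
  rewrite catA mem_cat rR !inE /= -/(e \in K0).
  have : e \in lh ++ lf -> e \in K0 by rewrite mem_cat => /orP[/hK0|/bK0].
  rewrite !inE mem_cat; case: (_ || _) => //= h; by rewrite h.
have ulK : uniq (lh ++ (lf ++ lr)).
  rewrite catA cat_uniq ub ur andbT; apply/hasPn => e; rewrite rR inE /=.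
  by rewrite inE => /andP[].
pose sigma := pre ++ (lc ++ (lh ++ (lf ++ lr))).
have usigma : uniq sigma.
  rewrite /sigma cat_uniq upre cat_uniq ulc ulK andbT /=; apply/andP; split.
    apply/hasPn => e; rewrite mem_cat => /orP[/lcE[i ii ei]|]; last first.
      by rewrite lKE !inE => /andP[].
    apply/negP => /preE[eK|[j nj ej]]; first by have := EK ei; rewrite eK.
    by move: nj; rewrite -(EE ei ej) ii.
  apply/hasPn => e; rewrite lKE => /K0K eK; apply/negP => /lcE[i _ /EK].
  by rewrite eK.
have sigmaE : sigma =i EG.
  move=> e; rewrite /sigma (mem_cat e pre) (mem_cat e lc) lKE.
  apply/idP/setUP => [|[eK|/bigcupP[i _ ei]]].
  - case/or3P => [/preE[]|/lcE[i _ ei]|/K0K]; first by left.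
    + by case=> i _ ei; right; apply/bigcupP; exists i.
    + by right; apply/bigcupP; exists i.
    + by left.
  - by rewrite !inE eK andbT; case: (e \in pre); rewrite ?orbT.
  case: (boolP (i \in idx)) => ii; last first.
    by have [_ sub] := idxE _ ii; rewrite sub.
  apply/orP; right; apply/orP; left; apply/flatten_mapP; exists i => //.
  by have [_ -> _] := tlP i.
pose Bow u := [set e | has (fun h => (h.1 == u) && (e \in gadgets_of (@bowtie V) h.1 h.2)) bs].
have bsuniq : uniq (map fst bs) by rewrite bsE enum_uniq.
have bow_split u : u \in VG -> exists hs1 gs hs2,
    [/\ bs = hs1 ++ (u, gs) :: hs2, u \notin map fst hs1, u \notin map fst hs2 &
        Bow u =i gadgets_of (@bowtie V) u gs].
  move=> uV; have : u \in map fst bs by rewrite bsE mem_enum.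
  case/mapP => -[u' gs] hin /= uu'; rewrite -uu' in hin.
  have [hs1 [hs2 bE]] : exists hs1 hs2, bs = hs1 ++ (u, gs) :: hs2.
    by case/splitPr: hin => a b; exists a, b.
  exists hs1, gs, hs2; move: (bsuniq); rewrite {1}bE map_cat cat_uniq /= => /and4P[_ /norP[n1 _] n2 _].
  split=> // e; rewrite inE bE has_cat /= eqxx /=.
  have no hs : u \notin map fst hs ->
      has (fun h => (h.1 == u) && (e \in gadgets_of (@bowtie V) h.1 h.2)) hs = false.
    move=> nu; apply/negbTE/hasPn => h hi; rewrite negb_and; apply/orP; left.
    by apply: contra nu => /eqP <-; apply: map_f.
  by rewrite !no // orbF.
have bow_sub u : Bow u \subset K.
  apply/subsetP => e; rewrite inE => /hasP[h hin /andP[_ eh]]; apply/K0K/bK0.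
  by apply/flatten_mapP; exists h.
have bow_nil u : u \notin VG -> Bow u = set0.
  move=> uV; apply/setP => e; rewrite !inE; apply/negbTE/hasPn => h hin.
  rewrite negb_and; apply/orP; left; apply: contra uV => /eqP <-.
  by rewrite -mem_enum -bsE map_f.
have ulf : uniq lf by move: ub; rewrite cat_uniq => /and3P[].
exists sigma, Bow; split=> //; first split=> //.
- move=> u v uv; rewrite -setI_eq0; apply/eqP/setP => e; rewrite !inE.
  apply/negP => /andP[/hasP[h hin /andP[/eqP hu eh]] /hasP[h' hin' /andP[/eqP hv eh']]].
  have hh' : h != h' by apply: contraNneq uv => k; rewrite -hu -hv k.
  move: ulf; rewrite /lf /gadgets_all.
  case/splitPr: hin hin' => b1 b2; rewrite mem_cat inE (eq_sym h') (negbTE hh') /= => hin'.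
  rewrite map_cat flatten_cat /= cat_uniq has_cat cat_uniq => /and3P[_ /norP[n1 _] /and3P[_ n2 _]].
  case/orP: hin' => hin'.
    case/negP: n1; apply/hasP; exists e => //=; apply/flatten_mapP; by exists h'.
  case/negP: n2; apply/hasP; exists e => //; apply/flatten_mapP; by exists h'.
- move=> u y yu; have [uV|uV] := boolP (u \in VG); last first.
    rewrite (_ : [set _ | _] = set0) ?cards0 //.
    by apply/setP => e; rewrite bow_nil // !inE.
  have [hs1 [gs [hs2 [bE _ _ BE]]]] := bow_split u uV.
  have := bsok; rewrite bE all_cat /= => /and3P[_ /and3P[_ sg ug] _].
  rewrite /= map_id in sg ug.
  have : deg y (gadgets_of (@bowtie V) u gs) <= 2.
    apply: leq_trans (gadgets_of_deg yu sg) _.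
    by rewrite (count_uniq_mem _ ug); case: (y \in _).
  apply: leq_trans; rewrite /deg -size_filter cardE.
  apply: uniq_leq_size; first exact: enum_uniq.
  by move=> e; rewrite mem_enum mem_filter !inE -BE !inE andbC.
move=> S p alt.
have alt' := alternating_catr alt.
have altK := alternating_catr alt'.
have altc := alternating_catl alt'.
have alth := alternating_catl altK.
have altf := alternating_catl (alternating_catr altK).
have altr := alternating_catr (alternating_catr altK).
split.
- move=> i c; case: (boolP (i \in idx)) => ii; last first.
    have [Ei _] := idxE _ ii; apply: leq_trans (_ : #|E i| <= _); last by rewrite Ei.
    by apply: subset_leq_card; apply/subsetP => e; rewrite inE => /andP[].
  have [ui iE _] := tlP i.
  have alti : alternating p [seq e <- tl i | S e].
    move: altc; rewrite /lc; case/splitPr: ii => a b; rewrite map_cat flatten_cat /=.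
    exact: alternating_infix.
  have cE b : #|[set e in E i | S e && (p e == b)]| = count (fun e => p e == b) [seq e <- tl i | S e].
    rewrite count_filter -(card_count _ ui); apply: eq_card => e.
    by rewrite !inE iE [_ && S e]andbC.
  have [b1 b2] := alternating_balanced alti; rewrite !cE.
  have eT l : count (fun e => p e == true) l = count p l by apply: eq_count => e; case: (p e).
  have eF l : count (fun e => p e == false) l = count (predC p) l by apply: eq_count => e /=; case: (p e).
  by case: c => /=; rewrite eT eF.
- move=> allS; apply: preS; have := alternating_catl alt.
  rewrite (_ : [seq e <- pre | S e] = pre) //; apply/all_filterP/allP => e epre.
  by apply: allS; rewrite -sigmaE mem_cat epre.
- move=> u dirty c uV mono.
  have := npass_cost altK (v := u) (dirty := dirty) (b := c).
  move=> /(_ (fun e el => mono e (K0K _ (etrans (esym (lKE e)) el)))) cost.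
  have cle : count (fun e : {set V} => (u \in e) && (dirty e || ~~ S e)) (lh ++ lf ++ lr)
      <= #|[set e in K | (u \in e) && (dirty e || ~~ S e)]|.
    by apply: count_set => // e; rewrite lKE => /K0K eK h; rewrite inE eK.
  have dgK : #|nbr K0 u| <= deg u (lh ++ lf ++ lr).
    apply: leq_trans (used_nbr_deg _ _); apply: subset_leq_card; apply/subsetP => w.
    by rewrite [w \in nbr _ _]in_set -lKE => h; rewrite in_set.
  have := npass_cat u lh (lf ++ lr); have := npass_cat u lf lr.
  move: dgK cost cle (mindeg0 u uV) (dh u) (db u) (dr u); rewrite !deg_cat.
  move: #|[set _ in _ | _]| (count _ _) #|nbr K0 u| (npass u (lh ++ lf ++ lr)) => T c0 d0 np.
  move=> h1 h2 h3 h4 [_ h5] h6 h7.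
  move: (npass u (lf ++ lr)) (npass u lh) (npass u lf) (npass u lr) (deg u lh) (deg u lf) (deg u lr) h1 h2 h3 h4 h5 h6 h7.
  move: N100 m_small sh_small m_large; clear; rewrite -/n -/N1; move: n N1 => n0 N0; lia.
(* Fewer than rho n deletions leave one of the 96 rho hubs with at most n/96. *)
- move=> few.
  have cz : count (predC S) lh < rho * n.
    apply: leq_ltn_trans few; apply: count_set => [|e el]; first by move: ub; rewrite cat_uniq => /and3P[].
    by move=> /= nS; rewrite in_set nS andbT -sigmaE !mem_cat el !orbT.
  have [/hasP[h hin hz]|none] := boolP (has (fun h => 96 * count (predC S) (gadgets_of (@hub_gadget V) h.1 h.2) <= n) hh).
    exists h.1; first exact: (allP hhV).
    move=> c; have /and3P[/eqP szh sgh ugh] := allP hhok h hin.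
    have hK : {subset gadgets_of (@hub_gadget V) h.1 h.2 <= K}.
      by move=> e eh; apply/K0K/hK0/flatten_mapP; exists h.
    have alth' : alternating p [seq e <- gadgets_of (@hub_gadget V) h.1 h.2 | S e].
      move: alth; rewrite /lh /gadgets_all; case/splitPr: hin => a b.
      rewrite map_cat flatten_cat /=; exact: alternating_infix.
    have := hub_reach_card c sgh ugh hK alth'; rewrite szh.
    have : 5 * n < 16 * ((5 * n) %/ 16) + 16.
      have := divn_eq (5 * n) 16; have := ltn_pmod (5 * n) (isT : 0 < 16); clear; lia.
    move: hz N100 m_small m_large; clear; rewrite -/n; move: ((5 * n) %/ 16) (count _ _) #|hub_reach _ _ _ _ _| n N1 => g z R0 n0 N0; lia.
  have : n * size hh <= 96 * count (predC S) lh.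
    rewrite /lh; elim: hh none {shh hhV hhok uh hK0 sh_size dh alth cz altK alt' alt ub sigmaE usigma sigma ulK lKE R2 rR R lh} => [|h hs IH] /=.
      by move=> _; rewrite muln0.
    rewrite negb_or -ltnNge => /andP[lt /IH le].
    by rewrite gadgets_all_cons count_cat mulnS mulnDr leq_add // ltnW.
  by rewrite shh; move: cz; clear; move: (count _ _) n => x n0; nia.
move=> u dirty c uV mono.
have [hs1 [gs [hs2 [bE n1 n2 BE]]]] := bow_split u uV.
have := bsok; rewrite bE all_cat /= => /and3P[ok1 /and3P[/eqP szg sg ug] ok2].
set B := gadgets_of (@bowtie V) u gs in BE.
pose lf1 := gadgets_all (@bowtie V) hs1; pose lf2 := gadgets_all (@bowtie V) hs2.
have lfE : lf = lf1 ++ (B ++ lf2) by rewrite /lf bE gadgets_all_cat gadgets_all_cons.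
have alt1 := altf; rewrite lfE in alt1.
have altB := alternating_catl (alternating_catr alt1).
have alt2 := alternating_catr (alternating_catr alt1).
have {}alt1 := alternating_catl alt1.
pose w (e : {set V}) := [&& (u \in e) || (e \in Bow u), ~~ dirty e & ~~ S e].
pose d (e : {set V}) := (u \in e) && dirty e.
have blk l : {subset l <= sigma} -> alternating p [seq e <- l | S e] ->
    npass u l <= count w l + count d l.
  move=> sl al; have := npass_cost al (v := u) (dirty := dirty) (b := c).
  move=> /(_ (fun e el => mono e (etrans (esym (sigmaE e)) (sl e el)))) le.
  apply: leq_trans le _; rewrite -(count_predUI w d).
  apply: leq_trans (leq_addr _ _); apply: sub_count => e /andP[ue] /=.
  by rewrite /w /d ue /=; case: (dirty e) => //=; rewrite orbF.
(* The bow-ties at u contain 4m edges at u and cost 3m, which is m more than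
   half; in all other blocks an edge costs one half, up to bounded defects. *)
have blkB : 3 * m <= 3 * count dirty B + count w B.
  rewrite -szg; have := gadgets_of_cost (c := c) sg altB (dirty := dirty).
  move=> /(_ _) le; apply: leq_trans (le _) _.
    move=> e eB; apply: mono; rewrite -sigmaE /sigma lfE !mem_cat eB.
    by rewrite !orbT.
  rewrite leq_add2l (@eq_in_count _ _ w) // => e eB.
  by rewrite /w BE eB orbT.
have sgE : sigma = pre ++ (lc ++ (lh ++ ((lf1 ++ (B ++ lf2)) ++ lr))) by rewrite /sigma lfE.
have T1 : #|[set e in EG | w e]| = count w sigma.
  by rewrite -card_count //; apply: eq_card => e; rewrite !in_set sigmaE in_set.
have T2 : #|[set e in EG | d e]| = count d sigma.
  by rewrite -card_count //; apply: eq_card => e; rewrite !in_set sigmaE in_set.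
have T3 : #|[set e in Bow u | dirty e]| = count dirty B.
  have uB : uniq B by move: ulf; rewrite lfE !cat_uniq => /and3P[_ _ /and3P[]].
  by rewrite -card_count //; apply: eq_card => e; rewrite [in RHS]in_set -BE; apply: in_set.
have T4 : #|[set e in EG | u \in e]| = deg u sigma.
  by rewrite /deg -card_count //; apply: eq_card => e; rewrite !in_set sigmaE in_set.
rewrite -/w in T1 *; rewrite T1 T2 T3 T4 sgE !deg_cat !count_cat.
have sub l : {subset l <= lf1 ++ (B ++ lf2)} -> {subset l <= sigma}.
  by move=> sl e /sl; rewrite sgE !mem_cat => ->; rewrite !orbT.
have b_lc := blk lc _ altc; have b_lh := blk lh _ alth; have b_lr := blk lr _ altr.
have b_1 := blk lf1 _ alt1; have b_2 := blk lf2 _ alt2.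
have {}b_lc : npass u lc <= count w lc + count d lc.
  by apply: b_lc => e el; rewrite /sigma !mem_cat el !orbT.
have {}b_lh : npass u lh <= count w lh + count d lh.
  by apply: b_lh => e el; rewrite /sigma !mem_cat el !orbT.
have {}b_lr : npass u lr <= count w lr + count d lr.
  by apply: b_lr => e el; rewrite /sigma !mem_cat el !orbT.
have {}b_1 : npass u lf1 <= count w lf1 + count d lf1.
  by apply/b_1/sub => e el; rewrite !mem_cat el.
have {}b_2 : npass u lf2 <= count w lf2 + count d lf2.
  by apply/b_2/sub => e el; rewrite !mem_cat el !orbT.
have d_pre : deg u pre <= 3 by apply: leq_trans (count_size _ _) _.
have d_lc : deg u lc <= (npass u lc).*2 + 2 * #|I|.
  have : size idx <= #|I| by rewrite cardE; apply: uniq_leq_size => // i _; rewrite mem_enum.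
  move=> si; apply: leq_trans (_ : (npass u lc).*2 + 2 * size idx <= _); last by rewrite leq_add2l leq_mul2l si.
  rewrite /lc; elim: (idx) => //= i s IH; rewrite deg_cat mulnS.
  have [_ _ /(_ u)] := tlP i; have := npass_cat u (tl i) (flatten [seq tl i | i <- s]).
  by move: IH; clear; lia.
have d_1 : deg u lf1 <= (npass u lf1).*2 by apply: gadgets_all_passages n1 ok1.
have d_2 : deg u lf2 <= (npass u lf2).*2 by apply: gadgets_all_passages n2 ok2.
have d_B : deg u B = 4 * m by rewrite gadgets_of_centre // szg.
have [_ d_h] := dh u; have d_r := dr u.
move: b_lc b_lh b_lr b_1 b_2 d_pre d_lc d_1 d_2 d_B d_h d_r blkB sh_small I_small m_large.
clear.
move: (deg u pre) (deg u lc) (deg u lh) (deg u lf1) (deg u B) (deg u lf2) (deg u lr).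
move: (npass u lc) (npass u lh) (npass u lf1) (npass u lf2) (npass u lr).
move: (count w pre) (count w lc) (count w lh) (count w lf1) (count w B) (count w lf2) (count w lr).
move: (count d pre) (count d lc) (count d lh) (count d lf1) (count d B) (count d lf2) (count d lr).
move: (count dirty B) #|I|; lia.
Qed.
End Ordering.

(** * Rainbow forests *)

Section Forests.
Variable V : finType.
Implicit Types (E F H : {set {set V}}) (u v x y a b : V) (A : {set V}).

Definition eadj E : rel V := fun x y => [set x; y] \in E.

Lemma eadj_sym E : symmetric (eadj E).
Proof. by move=> x y; rewrite /eadj setUC. Qed.

Lemma connectC E x y : connect (eadj E) x y = connect (eadj E) y x.
Proof. by rewrite (sym_connect_sym (@eadj_sym E)). Qed.

Lemma connectS E F x y : E \subset F -> connect (eadj E) x y -> connect (eadj F) x y.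
Proof.
by move=> sEF; apply: connect_sub => a b ab; apply: connect1; apply: (subsetP sEF).
Qed.

Lemma pair_eq a b c d : [set a; b] = [set c; d] -> (a = c /\ b = d) \/ (a = d /\ b = c).
Proof.
by move/eqP; rewrite set2_eq => /orP[] /andP[/eqP-> /eqP->]; [left|right].
Qed.

Lemma connect_add F u v a b : connect (eadj ([set u; v] |: F)) a b ->
  [\/ connect (eadj F) a b, connect (eadj F) a u /\ connect (eadj F) v b
    | connect (eadj F) a v /\ connect (eadj F) u b].
Proof.
case/connectP => p; elim: p a => [|c p IH] a /=; first by move=> _ ->; constructor 1.
case/andP => ac /IH h /h {IH h} IH.
move: ac IH; rewrite /eadj in_setU1 => /orP[/eqP /pair_eq [[-> ->]|[-> ->]]|ac] IH.
- by case: IH => [h|[h1 h2]|[h1 h2]]; [constructor 2|constructor 2|constructor 1].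
- by case: IH => [h|[h1 h2]|[h1 h2]]; [constructor 3|constructor 1|constructor 3].
have ac1 : connect (eadj F) a c by apply: connect1.
case: IH => [h|[h1 h2]|[h1 h2]]; [constructor 1|constructor 2|constructor 3].
- exact: connect_trans h.
- by split=> //; apply: connect_trans h1.
- by split=> //; apply: connect_trans h1.
Qed.

(** Each edge of F merges at most two labels. *)
Lemma component_labels F : (forall e, e \in F -> #|e| = 2) -> exists f : {ffun V -> V},
  (forall x y, connect (eadj F) x y -> f x = f y) /\ #|V| <= #|f @: [set: V]| + #|F|.
Proof.
have [k] := ubnP #|F|; elim: k F => // k IH F lt F2.
have [->|[e eF]] := set_0Vmem F.
  exists [ffun x => x]; split=> [x y|].
    by case/connectP => -[|c p] /= => [_ ->//|]; rewrite /eadj inE.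
  rewrite (_ : _ @: _ = setT) ?cardsT ?leq_addr //.
  by apply/setP => x; rewrite !inE; apply/imsetP; exists x; rewrite ?ffunE.
have /eqP/cards2P[u [v [uv eE]]] := F2 e eF.
have := cardsD1 e F; rewrite eF => cF.
have [||f [fF cf]] := IH (F :\ e); first by move: lt; rewrite cF; lia.
  by move=> e' /setD1P[_ /F2].
exists [ffun x => if f x == f v then f u else f x]; split.
  move=> x y; rewrite -(setD1K eF) eE => /connect_add; rewrite -eE !ffunE.
  case=> [/fF->//|[/fF-> /fF->]|[/fF-> /fF->]]; rewrite !eqxx //.
    by case: ifP.
  by case: ifP.
have sub : f @: setT :\ f v \subset [ffun x => if f x == f v then f u else f x] @: setT.
  apply/subsetP => y /setD1P[yv /imsetP[x _ yx]]; apply/imsetP; exists x => //.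
  by rewrite ffunE -yx (negbTE yv).
have := subset_leq_card sub; have := cardsD1 (f v) (f @: setT); rewrite imset_f //.
by move: cf cF; lia.
Qed.

Lemma card_bigcup_le (I T : finType) (P : pred I) (D : I -> {set T}) :
  #|\bigcup_(i | P i) D i| <= \sum_(i | P i) #|D i|.
Proof.
elim/big_rec2: _ => [|i m B _ h]; first by rewrite cards0.
by apply: leq_trans (_ : #|D i| + #|B| <= _); [rewrite cardsU leq_subr|rewrite leq_add2l].
Qed.

Lemma bin2_double k : 2 * 'C(k, 2) = k * k.-1.
Proof. by rewrite -mul_bin_diag bin1. Qed.

(** Components with sizes s_1, s_2, ... satisfy sum (s_i - 1) <= |F|, and by
    convexity the number of pairs is largest for a single component. *)
Lemma connected_pairs F (P : {set {set V}}) : (forall e, e \in F -> #|e| = 2) ->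
  (forall e, e \in P -> #|e| = 2) ->
  (forall u v, [set u; v] \in P -> connect (eadj F) u v) ->
  #|P| <= 'C(#|F|.+1, 2).
Proof.
move=> F2 P2 cP; have [f [fF cf]] := component_labels F2.
pose fib y := [set x | f x == y]; set s := #|F| in cf *.
have sub : P \subset \bigcup_(y in f @: [set: V]) [set B : {set V} | B \subset fib y & #|B| == 2].
  apply/subsetP => e eP; have e2 := P2 e eP; have /eqP/cards2P[u [v [uv eE]]] := e2.
  apply/bigcupP; exists (f u); first exact: imset_f.
  rewrite inE e2 eqxx andbT; apply/subsetP => x; rewrite inE eE !inE.
  by case/orP => /eqP-> //; rewrite (fF u v) //; apply: cP; rewrite -eE.
have h1 := leq_trans (subset_leq_card sub) (card_bigcup_le _ _).
have h2 : \sum_(y in f @: [set: V]) #|fib y| = #|V|.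
  rewrite -[RHS]sum1_card [RHS](partition_big f (mem (f @: [set: V]))) /=; last first.
    by move=> x _; apply: imset_f.
  by apply: eq_bigr => y _; rewrite -sum1_card; apply: eq_bigl => x; rewrite inE.
have fpos y : y \in f @: [set: V] -> 0 < #|fib y|.
  by case/imsetP => x _ ->; apply/card_gt0P; exists x; rewrite inE.
have h3 : \sum_(y in f @: [set: V]) (#|fib y|).-1 <= s.
  have : \sum_(y in f @: [set: V]) (#|fib y|).-1 + #|f @: [set: V]| = #|V|.
    rewrite -h2 -sum1_card -big_split /=; apply: eq_bigr => y /fpos; lia.
  by move: cf; lia.
have h4 y : y \in f @: [set: V] -> #|fib y| <= s.+1.
  move=> yi; apply: leq_trans (_ : (#|fib y|).-1.+1 <= _); first by have := fpos y yi; lia.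
  by rewrite ltnS; apply: leq_trans h3; rewrite (bigD1 y) //= leq_addr.
have : 2 * #|P| <= 2 * 'C(s.+1, 2).
  apply: leq_trans (_ : \sum_(y in f @: [set: V]) s.+1 * (#|fib y|).-1 <= _); last first.
    by rewrite -big_distrr /= bin2_double leq_mul2l h3.
  apply: leq_trans (_ : 2 * \sum_(y in f @: [set: V]) 'C(#|fib y|, 2) <= _).
    rewrite leq_mul2l /=; apply: leq_trans h1 _; apply: leq_sum => y _.
    by rewrite cards_draws.
  rewrite big_distrr /=; apply: leq_sum => y yi.
  by rewrite bin2_double leq_mul2r h4 ?orbT.
by rewrite leq_mul2l.
Qed.

(** Every edge is a bridge. *)
Definition forest F := [forall u, forall v, ([set u; v] \in F) ==>
   ~~ connect (eadj (F :\ [set u; v])) u v].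

Lemma forestP F : reflect (forall u v, [set u; v] \in F ->
   ~~ connect (eadj (F :\ [set u; v])) u v) (forest F).
Proof.
apply: (iffP idP) => [h u v uvF|h].
  by have /forallP/(_ u)/forallP/(_ v)/implyP := h; apply.
by apply/forallP => u; apply/forallP => v; apply/implyP; apply: h.
Qed.

Lemma forest0 : forest set0.
Proof. by apply/forestP => u v; rewrite inE. Qed.

Lemma forest_add F u v : forest F -> ~~ connect (eadj F) u v -> forest ([set u; v] |: F).
Proof.
move=> /forestP fF nuv; have uvF : [set u; v] \notin F.
  by apply: contra nuv => h; apply: connect1.
apply/forestP => a b; rewrite in_setU1 => /orP[/eqP abE|abF].
  rewrite abE setU1K //; case: (pair_eq abE) => -[-> ->] //.
  by rewrite connectC.
have ne : [set u; v] != [set a; b] by apply: contraNneq uvF => ->.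
have -> : ([set u; v] |: F) :\ [set a; b] = [set u; v] |: (F :\ [set a; b]).
  by apply/setP => e; rewrite !inE; have [->|] := eqVneq e [set u; v]; rewrite ?ne ?andbT.
have sF : F :\ [set a; b] \subset F by apply: subsetDl.
apply/negP => /connect_add[h|[h1 h2]|[h1 h2]].
- by have := fF a b abF; rewrite h.
- case/negP: nuv; apply: connect_trans (_ : connect _ a v).
    by rewrite connectC; apply: connectS h1.
  apply: connect_trans (_ : connect _ b v); first by apply: connect1.
  by rewrite connectC; apply: connectS h2.
case/negP: nuv; apply: connect_trans (connectS sF h2) _.
apply: connect_trans (_ : connect _ a v); last exact: connectS h1.
by apply: connect1; rewrite eadj_sym.
Qed.

(** Choose one edge from each class in turn.  If all edges of the class j were
    inside components of the j edges chosen so far, then these edges together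
    would be at most C(j+1, 2) pairs by [connected_pairs]. *)
Lemma rainbow_forest (cs : seq {set {set V}}) :
  (forall P e, P \in cs -> e \in P -> #|e| = 2) ->
  (forall i j e, i < size cs -> j < size cs ->
     e \in nth set0 cs i -> e \in nth set0 cs j -> i = j) ->
  (forall j, j < size cs -> 'C(j.+1, 2) < #|nth set0 cs j| + j) ->
  exists F, [/\ forest F, #|F| = size cs,
     forall e, e \in F -> exists2 P, P \in cs & e \in P &
     forall P, P \in cs -> F :&: P != set0].
Proof.
elim/last_ind: cs => [|cs P IH] c2 dis big.
  by exists set0; split; rewrite ?cards0 ?forest0 // => e; rewrite inE.
have nthl i : i < size cs -> nth set0 (rcons cs P) i = nth set0 cs i.
  by move=> lti; rewrite nth_rcons lti.
have nthP : nth set0 (rcons cs P) (size cs) = P by rewrite nth_rcons ltnn eqxx.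
have [|||F [fF cF sF hF]] := IH.
- by move=> Q e Qc; apply: c2; rewrite mem_rcons inE Qc orbT.
- move=> i j e lti ltj ei ej; apply: (dis i j e); rewrite ?size_rcons ?nthl //; exact: ltnW.
- by move=> j ltj; have := big j; rewrite size_rcons nthl //; apply; apply: ltnW.
have FP : [disjoint F & P].
  rewrite -setI_eq0; apply/eqP/setP => e; rewrite !inE; apply/negP => /andP[/sF[Q Qc eQ] eP].
  have ltQ : index Q cs < size cs by rewrite index_mem.
  have := dis (index Q cs) (size cs) e; rewrite size_rcons nthP nthl // nth_index // => h.
  by have := h (ltnW ltQ) (ltnSn _) eQ eP => eq; rewrite eq ltnn in ltQ.
have F2 e : e \in F -> #|e| = 2.
  by case/sF => Q Qc; apply: c2; rewrite mem_rcons inE Qc orbT.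
have P2 e : e \in P -> #|e| = 2 by apply: c2; rewrite mem_rcons mem_head.
have [u [v [uvP nuv]]] : exists u v, [set u; v] \in P /\ ~~ connect (eadj F) u v.
  have [/existsP[u /existsP[v /andP[h1 h2]]]|none] :=
    boolP [exists u, exists v, ([set u; v] \in P) && ~~ connect (eadj F) u v].
    by exists u, v.
  have allc u v : [set u; v] \in F :|: P -> connect (eadj F) u v.
    rewrite inE => /orP[uvF|uvP]; first exact: connect1.
    apply/negPn/negP => nc; case/negP: none; apply/existsP; exists u; apply/existsP; exists v.
    by rewrite uvP.
  have FP2 e : e \in F :|: P -> #|e| = 2 by rewrite inE => /orP[/F2|/P2].
  have := connected_pairs F2 FP2 allc; rewrite cF.
  have -> : #|F :|: P| = #|F| + #|P|.
    by rewrite cardsU (disjoint_setI0 FP) cards0 subn0.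
  have := big (size cs); rewrite size_rcons nthP => /(_ (ltnSn _)).
  by rewrite cF addnC ltnNge => /negbTE->.
exists ([set u; v] |: F); split.
- exact: forest_add.
- rewrite cardsU1 size_rcons cF; case: (boolP (_ \in F)) => // uvF.
  by move: nuv; rewrite connect1.
- move=> e; rewrite in_setU1 => /orP[/eqP->|/sF[Q Qc eQ]].
    by exists P; rewrite // mem_rcons mem_head.
  by exists Q; rewrite // mem_rcons inE Qc orbT.
move=> Q; rewrite mem_rcons inE => /orP[/eqP->|/hF /set0Pn[e]].
  by apply/set0Pn; exists [set u; v]; rewrite !inE eqxx.
by rewrite inE => /andP[eF eQ]; apply/set0Pn; exists e; rewrite in_setI in_setU1 eF eQ orbT.
Qed.

Lemma forest_acyclic F (c : seq V) : forest F -> 2 < size c -> ~ ucycle (eadj F) c.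
Proof.
move=> /forestP fF; case: c => [|x [|y [|z q]]] // _ /andP[].
rewrite /= => /and3P[xy yz pz] /and3P[].
rewrite !inE !negb_or => /and3P[nxy nxz xq] /andP[nyz yq] /andP[zq uq].
have := fF x y xy; rewrite connectC => /negP; apply.
set F' := F :\ _; have keep a b : eadj F a b -> a != x -> a != y -> eadj F' a b.
  move=> ab ax ay; rewrite /eadj in_setD1 [_ \in F]ab andbT.
  by apply/eqP => /pair_eq[[e _]|[e _]]; [move/eqP: ax|move/eqP: ay]; apply.
apply: connect_trans (_ : connect _ z x).
  apply: connect1; rewrite eadj_sym; apply: keep; rewrite 1?eadj_sym // eq_sym //.
have : all (fun a => (a != x) && (a != y)) (z :: q).
  apply/allP => a; rewrite inE => /orP[/eqP->|aq].
    by rewrite ![z == _]eq_sym nxz nyz.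
  by apply/andP; split; [apply: contraNneq xq|apply: contraNneq yq] => <-.
elim: q z pz {yz nxz xq nyz yq zq uq} => [|w q IH] z /=.
  by rewrite !andbT => zx /andP[z1 z2]; apply: connect1; apply: keep.
move=> /andP[zw pw] /andP[/andP[z1 z2] aw].
by apply: connect_trans (IH w pw aw); apply: connect1; apply: keep.
Qed.
End Forests.

(** * Growing a tree *)

Section Growth.
Variables (V : finType) (H : {set {set V}}) (x : V).
Hypothesis H2 : forall e, e \in H -> #|e| = 2.
Implicit Types (A P Good : {set V}) (a v : V).

Definition within A := [set e in H | e \subset A].
Definition rooted A := x \in A /\ forall a, a \in A -> connect (eadj (within A)) x a.

Lemma rooted1 : rooted [set x].
Proof. by split=> [|a /set1P->]; rewrite ?set11 ?connect0. Qed.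

Lemma rooted_add A a v : rooted A -> a \in A -> [set a; v] \in H -> rooted (v |: A).
Proof.
move=> [xA cA] aA avH; split=> [|b]; first by rewrite in_setU1 xA orbT.
have sub : within A \subset within (v |: A).
  apply/subsetP => e; rewrite !inE => /andP[-> eA] /=.
  exact: subset_trans eA (subsetUr _ _).
rewrite in_setU1 => /orP[/eqP->|/cA]; last exact: connectS.
apply: connect_trans (connectS sub (cA a aA)) _; apply: connect1.
by rewrite /eadj inE avH subUset !sub1set !in_setU1 aA eqxx orbT.
Qed.

Lemma rooted_connect A a : rooted A -> a \in A -> connect (eadj H) x a.
Proof.
move=> [_ cA] /cA; apply: connectS; apply/subsetP => e; by rewrite inE => /andP[].
Qed.

Lemma crossing_edge A a b : connect (eadj H) a b -> a \in A -> b \notin A ->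
  exists u v, [/\ u \in A, v \notin A, [set u; v] \in H & connect (eadj H) a v].
Proof.
case/connectP => p; elim: p a => [|c p IH] a /= => [_ -> -> //|/andP[ac pc] bl aA bA].
case: (boolP (c \in A)) => cA; last by exists a, c; split=> //; apply: connect1.
have [u [v [uA vA uvH cv]]] := IH c pc bl cA bA; exists u, v; split=> //.
by apply: connect_trans cv; apply: connect1.
Qed.

Lemma rooted_exact A t : rooted A -> #|A| <= t <= #|[set v | connect (eadj H) x v]| ->
  exists B, [/\ rooted B, A \subset B & #|B| = t].
Proof.
move=> rA; move e : (t - #|A|) => d.
elim: d A rA e => [|d IH] A rA e /andP[le1 le2].
  by exists A; split=> //; move: e le1; lia.
have [w wW wA] : exists2 w, w \in [set v | connect (eadj H) x v] & w \notin A.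
  apply/subsetPn; apply: contraL le2 => /subset_leq_card; rewrite -ltnNge; move: e; lia.
rewrite inE in wW; have [u [v [uA vA uvH _]]] := crossing_edge wW rA.1 wA.
have cvA : #|v |: A| = #|A|.+1 by rewrite cardsU1 vA.
have [||B [rB sB cB]] := IH (v |: A) (rooted_add rA uA uvH).
- by rewrite cvA; move: e; lia.
- by rewrite cvA le2 andbT; move: e; lia.
by exists B; split=> //; apply: subset_trans sB; apply: subsetUr.
Qed.

(** A vertex of Good is reached from x with at most three new vertices.  A path
    from x to a vertex of P outside Good leaves the union of A and Good at a
    vertex which is again in P, and its predecessor can be reached with at most
    three new vertices.  So each element of P costs at most four. *)
Lemma rooted_core P Good :
  (forall v, v \in Good -> exists w y, [/\ [set x; w] \in H, [set w; y] \in H & [set y; v] \in H]) ->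
  (forall v, v \in P -> connect (eadj H) x v) ->
  (forall v, connect (eadj H) x v -> v \notin Good -> v \in P) ->
  exists A, [/\ rooted A, P \subset A & #|A| <= 1 + 4 * #|P|].
Proof.
move=> gd cP bad.
suff core A : rooted A -> #|A| <= 1 + 4 * #|A :&: P| ->
   exists B, [/\ rooted B, P \subset B & #|B| <= 1 + 4 * #|P|].
  by apply: (core _ rooted1); rewrite cards1.
move e : (#|P :\: A|) => d; have [k ltk] := ubnP d.
elim: k d ltk A e => // k IH d ltk A e rA cA.
have [sPA|/subsetPn[p pP pA]] := boolP (P \subset A).
  by exists A; split=> //; apply: leq_trans cA _; rewrite leq_add2l leq_mul2l subset_leq_card ?subsetIr ?orbT.
have step B q : rooted B -> A \subset B -> q \in B -> q \in P -> q \notin A ->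
    #|B| <= #|A| + 4 -> exists B, [/\ rooted B, P \subset B & #|B| <= 1 + 4 * #|P|].
  move=> rB sAB qB qP qA cB.
  have c1 : #|A :&: P| < #|B :&: P|.
    apply: proper_card; apply/properP; split; first exact: setSI.
    by exists q; rewrite !inE ?qB ?qP ?(negbTE qA).
  have c2 : #|P :\: B| < #|P :\: A|.
    apply: proper_card; apply/properP; split; first exact: setDS.
    by exists q; rewrite !inE ?qP ?qB ?qA.
  apply: (IH #|P :\: B|) (erefl _) rB _; first by move: c2 ltk; rewrite e; lia.
  by move: c1 cB cA; lia.
have addgood v : v \in Good -> exists B, [/\ rooted B, A \subset B, v \in B & #|B| <= #|A| + 3].
  move=> /gd[w [y [xw wy yv]]].
  have r1 := rooted_add rA rA.1 xw.
  have r2 := rooted_add r1 (setU11 _ _) wy.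
  have r3 := rooted_add r2 (setU11 _ _) yv.
  exists (v |: (y |: (w |: A))); split=> //; last by rewrite !cardsU1; lia.
    by apply/subsetP => z zA; rewrite !inE zA !orbT.
  exact: setU11.
have [pG|pG] := boolP (p \in Good).
  have [B [rB sB pB cB]] := addgood p pG.
  by apply: step rB sB pB pP pA _; move: cB; lia.
have [||u [v [uX vX uvH cv]]] := crossing_edge (A := A :|: Good) (cP p pP) _ _.
- by rewrite inE rA.1.
- by rewrite inE negb_or pA.
move: vX; rewrite inE negb_or => /andP[vA vG].
have vP := bad v cv vG.
move: uX; rewrite inE => /orP[uA|uG].
  apply: (step (v |: A) v (rooted_add rA uA uvH)) => //; first exact: subsetUr.
    exact: setU11.
  by rewrite cardsU1 vA; lia.
have [B [rB sB uB cB]] := addgood u uG.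
apply: (step (v |: B) v (rooted_add rB uB uvH)) => //.
- by apply: subset_trans sB (subsetUr _ _).
- exact: setU11.
by rewrite cardsU1; move: cB; case: (v \notin B) => /=; lia.
Qed.

(** A maximal forest within A that contains F connects A. *)
Lemma tree_on A (F : {set {set V}}) : rooted A -> F \subset within A -> forest F ->
  exists T : sgraph V, [/\ is_tree T, vertices T = A, F \subset edges T & edges T \subset H].
Proof.
move=> [xA cA] FA fF.
pose ok (T : {set {set V}}) := forest T && (T \subset within A).
have okF : ok F by rewrite /ok fF FA.
have [T /maxsetP[/andP[fT TA] Tmax] FT] := maxset_exists okF.
have TcA u v : [set u; v] \in within A -> connect (eadj T) u v.
  move=> uvA; apply/negPn/negP => nc.
  have := Tmax ([set u; v] |: T); rewrite /ok forest_add // subUset sub1set uvA TA.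
  move=> /(_ isT (subsetUr _ _)) => eT; case/negP: nc; apply: connect1.
  by rewrite /eadj -eT setU11.
have cT a : a \in A -> connect (eadj T) x a.
  by move=> /cA; apply: connect_sub => u v; apply: TcA.
have TP : [forall e in (A, T).2, (#|e| == 2) && (e \subset (A, T).1)].
  apply/forall_inP => e /= /(subsetP TA); rewrite inE => /andP[/H2-> ->].
  by rewrite eqxx.
exists (SGraph TP); split=> //.
  apply/andP; split.
    apply/andP; split; first by apply/set0Pn; exists x.
    apply/forall_inP => a aA; apply/forall_inP => b bA.
    by apply: connect_trans (cT b bA); rewrite connectC; apply: cT.
  by apply/asboolP => c sc; apply: forest_acyclic fT sc.
by apply: subset_trans TA _; apply/subsetP => e; rewrite inE => /andP[].
Qed.

End Growth.

(** * A tree among the survivors of few deletions *)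

Section EdgeFacts.
Variable V : finType.
Implicit Types (e : {set V}) (Z : {set {set V}}) (U : {set V}).

Lemma edge_other e u : #|e| = 2 -> u \in e -> exists2 v, v != u & e = [set u; v].
Proof.
move=> e2; have /eqP/cards2P[a [b [ab ->]]] := e2.
rewrite !inE => /orP[]/eqP->; first by exists b; rewrite // eq_sym.
by exists a; rewrite // setUC.
Qed.

Lemma sum_incident Z U : (forall e, e \in Z -> #|e| = 2) ->
  \sum_(v in U) #|[set e in Z | v \in e]| <= 2 * #|Z|.
Proof.
move=> Z2; apply: leq_trans (_ : \sum_v #|[set e in Z | v \in e]| <= _).
  by rewrite [X in X <= _]big_mkcond; apply: leq_sum => v _; case: ifP.
under eq_bigr do rewrite -sum1_card.
rewrite (eq_bigr (fun v => \sum_(e in Z) (v \in e : nat))); last first.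
  move=> v _; rewrite big_mkcond [RHS]big_mkcond; apply: eq_bigr => e _.
  by rewrite inE; case: (e \in Z); case: (v \in e).
rewrite exchange_big /= (eq_bigr (fun=> 2)); first by rewrite sum_nat_const mulnC.
move=> e /Z2 <-; rewrite -sum1_card [RHS]big_mkcond; apply: eq_bigr => v _.
by case: (v \in e).
Qed.

Lemma disjoint_sum (T J : finType) (U : {set J}) (D : J -> {set T}) (X : {set T}) :
  (forall u, u \in U -> D u \subset X) ->
  (forall u v t, u \in U -> v \in U -> t \in D u -> t \in D v -> u = v) ->
  \sum_(u in U) #|D u| <= #|X|.
Proof.
move=> sub dis.
rewrite (eq_bigr (fun u => \sum_(e in X) (e \in D u : nat))); last first.
  move=> u /sub /subsetP s; rewrite -sum1_card big_mkcond [RHS]big_mkcond; apply: eq_bigr => e _.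
  by case: (boolP (e \in D u)) => [/s->|] //; case: (e \in X).
rewrite exchange_big /= -sum1_card; apply: leq_sum => e _.
have [/existsP[u /andP[uU eu]]|none] := boolP [exists u, (u \in U) && (e \in D u)].
  rewrite (bigD1 u) //= eu big1 // => v /andP[vU vu].
  by case: (boolP (e \in D v)) => // ev; rewrite (dis v u e) ?eqxx in vu.
rewrite big1 // => u uU; case: (boolP (e \in D u)) => // eu.
by case/negP: none; apply/existsP; exists u; rewrite uU.
Qed.

Lemma incident_to (Z : {set {set V}}) U u : (forall e, e \in Z -> #|e| = 2) ->
  #|[set e in Z | (u \in e) && [exists y in U, (y != u) && (y \in e)]]| <= #|U|.
Proof.
move=> Z2; apply: leq_trans (_ : #|[set [set u; y] | y in U]| <= _); last exact: leq_imset_card.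
apply: subset_leq_card; apply/subsetP => e; rewrite inE => /and3P[eZ ue /exists_inP[y yU /andP[yu ye]]].
apply/imsetP; exists y => //; have [v vu eE] := edge_other (Z2 e eZ) ue.
by move: ye; rewrite eE !inE (negbTE yu) /= => /eqP->.
Qed.

Lemma degree_le (Z : {set {set V}}) U u : (forall e, e \in Z -> #|e| = 2 /\ e \subset U) ->
  #|[set e in Z | u \in e]| <= #|U|.
Proof.
move=> Z2; apply: leq_trans (incident_to (Z := Z) U u _); last by move=> e /Z2[].
apply: subset_leq_card; apply/subsetP => e; rewrite !inE => /andP[eZ ue]; rewrite eZ ue /=.
have [e2 /subsetP eU] := Z2 e eZ; have [v vu eE] := edge_other e2 ue.
by apply/exists_inP; exists v; [apply: eU|rewrite vu]; rewrite eE set22.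
Qed.

Lemma pairs_within (Z : {set {set V}}) U : (forall e, e \in Z -> #|e| = 2 /\ e \subset U) ->
  #|Z| <= #|U| * #|U|.
Proof.
move=> Z2; have h e : e \in Z -> #|e| = 2 by case/Z2.
have -> : Z = \bigcup_(u in U) [set e in Z | u \in e].
  apply/setP => e; apply/idP/bigcupP => [eZ|[u _]]; last by rewrite inE => /andP[].
  have [e2 /subsetP eU] := Z2 e eZ; have /card_gt0P[u ue] : 0 < #|e| by rewrite e2.
  by exists u; rewrite ?eU // inE eZ.
apply: leq_trans (card_bigcup_le _ _) _; rewrite -sum_nat_const; apply: leq_sum => u _.
exact: degree_le.
Qed.

End EdgeFacts.

Section Survivors.
Variables (V I : finType) (VG : {set V}) (K : {set {set V}}) (E : I -> {set {set V}}).
(** S tells which edges survive and p is their sign; rho stands for r + 1. *)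
Variables (rho m c : nat) (Bow : V -> {set {set V}}) (S p : pred {set V}).
Let n := #|VG|.
Let EG := K :|: \bigcup_i E i.
Let Z := [set e in EG | ~~ S e].
Hypothesis EG2 : forall e, e \in EG -> #|e| = 2 /\ e \subset VG.
Hypothesis EK : forall i e, e \in E i -> e \notin K.
Hypothesis EE : forall i j e, e \in E i -> e \in E j -> i = j.
Hypothesis rho_gt0 : 0 < rho.
Hypothesis n_large : 20 * (1000 * rho) <= n.
Hypothesis m_large : 6 * (1000 * rho) <= m.
Hypothesis I_small : 10 * (#|I|.+1 * #|I|.+1) <= n.
Hypothesis triple_large : forall i j l, uniq [:: i; j; l] ->
  9 * 'C(#|I|, 2) + 3 < #|E i| + #|E j| + #|E l|.
Hypothesis c_colour : forall i, c <= #|E i|.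
Definition cut_edges (U : {set V}) :=
  [set e in EG | (e :&: U != set0) && ~~ (e \subset U)].
Hypothesis c_cut : forall U : {set V}, U \subset VG -> rho <= #|U| -> #|U| + rho <= n ->
  c <= #|cut_edges U|.
Hypothesis few : #|Z| < c.

Hypothesis Bow_dis : forall u v, u != v -> [disjoint Bow u & Bow v].
Hypothesis Bow_deg : forall u y, y != u -> #|[set e in Bow u | y \in e]| <= 2.
Hypothesis balance : forall i b, #|[set e in E i | S e && (p e == b)]|
                 <= #|[set e in E i | S e && (p e == ~~ b)]|.+1.
Hypothesis single_same : (forall e, e \in EG -> S e) -> forall i j e f, i != j ->
  #|E i| = 1 -> #|E j| = 1 -> e \in E i -> f \in E j -> p e = p f.
Hypothesis cost : forall u (dirty : pred {set V}) b, u \in VG ->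
  (forall e, e \in K -> u \in e -> ~~ dirty e -> S e -> p e = b) ->
  41 * n <= 100 * #|[set e in K | (u \in e) && (dirty e || ~~ S e)]|.
Hypothesis hub : #|[set e in EG | ~~ S e]| < rho * n ->
  exists2 x, x \in VG & forall b, 60 * n <= 100 * #|hub_reach K S p b x|.
Hypothesis cost_exact : forall u (dirty : pred {set V}) b, u \in VG ->
  (forall e, e \in EG -> u \in e -> ~~ dirty e -> S e -> p e = b) ->
  #|[set e in EG | u \in e]| + m <=
    2 * (#|[set e in EG | [&& (u \in e) || (e \in Bow u), ~~ dirty e & ~~ S e]]|
         + #|[set e in EG | (u \in e) && dirty e]|
         + 3 * #|[set e in Bow u | dirty e]|).

Let KEG e : e \in K -> e \in EG.
Proof. by move=> eK; rewrite inE eK. Qed.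
Let EEG i e : e \in E i -> e \in EG.
Proof. by move=> ei; rewrite inE; apply/orP; right; apply/bigcupP; exists i. Qed.
Let K2 e : e \in K -> #|e| = 2 /\ e \subset VG.
Proof. by move/KEG/EG2. Qed.

(** The cut around any rho vertices has at most rho * n edges. *)
Lemma few_rho : #|Z| < rho * n.
Proof.
apply: leq_trans few _; pose U := [set v in take rho (enum VG)].
have sU : U \subset VG by apply/subsetP => v; rewrite inE => /mem_take; rewrite mem_enum.
have cU : #|U| = rho.
  rewrite cardsE; have /card_uniqP -> : uniq (take rho (enum VG)) by rewrite take_uniq ?enum_uniq.
  by rewrite size_takel // -cardE -/n; move: n_large; clear; lia.
apply: leq_trans (c_cut sU _ _) _; rewrite ?cU //.
  by move: n_large; clear; lia.
apply: leq_trans (_ : #|\bigcup_(u in U) [set e in EG | u \in e]| <= _).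
  apply: subset_leq_card; apply/subsetP => e; rewrite inE => /and3P[eE /set0Pn[u]].
  by rewrite inE => /andP[ue uU] _; apply/bigcupP; exists u; rewrite // inE eE.
apply: leq_trans (card_bigcup_le _ _) _.
apply: leq_trans (_ : \sum_(u in U) n <= _); last by rewrite sum_nat_const cU.
by apply: leq_sum => u _; apply: degree_le.
Qed.

Section Hub.
Variable x : V.
Hypothesis xV : x \in VG.
Hypothesis hubx : forall b, 60 * n <= 100 * #|hub_reach K S p b x|.

Definition side b := [set e in EG | S e && (p e == b)].
Definition comp b := [set v | connect (eadj (side b)) x v].
Definition cutoff b := VG :\: comp b.
(** Such a vertex is at distance at most three from x in sign b, so only the few
    other vertices can be cut off from x. *)
Definition good b := [set v in VG | [exists y in hub_reach K S p b x, [set y; v] \in side b]].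
Definition inner b i := [set e in E i :&: side b | e \subset comp b].

Lemma side2 b e : e \in side b -> #|e| = 2.
Proof. by rewrite inE => /andP[/EG2[]]. Qed.

Lemma comp_sub b : comp b \subset VG.
Proof.
apply/subsetP => v; rewrite inE => /connectP[q]; elim/last_ind: q => [|q w _] /=.
  by move=> _ ->.
rewrite rcons_path last_rcons => /andP[_ +] ->.
by rewrite /eadj inE => /andP[/EG2[_ /subsetP h] _]; apply: h; rewrite set22.
Qed.

Lemma reach_sub b : hub_reach K S p b x \subset VG.
Proof.
apply/subsetP => y; rewrite inE => /existsP[w /and3P[_ /K2[_ /subsetP h] _]].
by apply: h; rewrite set21.
Qed.

Lemma reach_path b y : y \in hub_reach K S p b x ->
  exists2 w, [set x; w] \in side b & ([set w; y] \in side b) && ([set y; w] \in K).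
Proof.
rewrite inE => /existsP[w /and5P[xw yw sx sy /andP[px py]]]; exists w.
  by rewrite inE KEG // sx px.
by rewrite yw andbT setUC inE KEG // sy py.
Qed.

Lemma good_path b v : v \in good b -> exists w y,
  [/\ [set x; w] \in side b, [set w; y] \in side b & [set y; v] \in side b].
Proof.
rewrite inE => /andP[_ /exists_inP[y /reach_path[w xw /andP[wy _]] yv]].
by exists w, y.
Qed.

Lemma good_comp b : good b \subset comp b.
Proof.
apply/subsetP => v /good_path[w [y [h1 h2 h3]]]; rewrite inE.
apply: connect_trans (connect1 h1) _; apply: connect_trans (connect1 h2) _.
exact: connect1.
Qed.

Lemma side_comp b e u : e \in side b -> u \in e -> u \in comp b -> e \subset comp b.
Proof.
move=> es ue uc; have [v vu eE] := edge_other (side2 es) ue.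
rewrite eE subUset !sub1set uc /= inE; rewrite inE in uc.
by apply: connect_trans uc _; apply: connect1; rewrite /eadj -eE.
Qed.

(** The edges of sign b at v lead to the at most 40n/100 vertices that are not
    tied to x.  Declaring them dirty leaves edges of the other sign only, so at
    least 41n/100 edges at v are dirty or deleted. *)
Lemma bad_zeros b v : v \in VG -> v \notin good b ->
  n <= 100 * #|[set e in Z | v \in e]|.
Proof.
move=> vV vg.
have mono e : e \in K -> v \in e -> ~~ (S e && (p e == b)) -> S e -> p e = ~~ b.
  by move=> _ _ + Se; rewrite Se /=; case: (p e); case: (b).
have h1 := cost (dirty := fun e => S e && (p e == b)) vV mono.
have h2 : #|[set e in K | (v \in e) && (S e && (p e == b) || ~~ S e)]| <=
   #|[set [set v; y] | y in VG :\: hub_reach K S p b x]| + #|[set e in Z | v \in e]|.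
  apply: leq_trans (cardU_le _ _); apply: subset_leq_card; apply/subsetP => e.
  rewrite inE => /and3P[eK ve /orP[/andP[Se pe]|nS]]; apply/setUP; [left|right].
    have [e2 /subsetP eV] := K2 eK; have [y yv eE] := edge_other e2 ve.
    apply/imsetP; exists y => //; rewrite inE eV ?eE ?set22 // andbT.
    apply: contra vg => yr; rewrite inE vV; apply/exists_inP; exists y => //.
    by rewrite setUC -eE inE KEG // Se pe.
  by rewrite inE ve andbT inE KEG.
have h3 : #|[set [set v; y] | y in VG :\: hub_reach K S p b x]| <= #|VG :\: hub_reach K S p b x|.
  exact: leq_imset_card.
have h4 : #|VG :\: hub_reach K S p b x| + #|hub_reach K S p b x| = n.
  by rewrite -[RHS](cardsID (hub_reach K S p b x)) addnC (setIidPr (reach_sub b)).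
have h5 := hubx b.
have h6 := leq_trans h2 (leq_add h3 (leqnn _)).
by move: h1 h4 h5 h6; clear; lia.
Qed.

Lemma Z2 e : e \in Z -> #|e| = 2.
Proof. by rewrite inE => /andP[/EG2[]]. Qed.

Lemma n_gt0 : 0 < n.
Proof. by move: n_large rho_gt0; clear; lia. Qed.

Lemma bad_card b : #|VG :\: good b| <= 200 * rho.
Proof.
have h1 : #|VG :\: good b| * n <= 100 * (2 * #|Z|).
  apply: leq_trans (_ : 100 * \sum_(v in VG :\: good b) #|[set e in Z | v \in e]| <= _).
    rewrite -sum_nat_const big_distrr /=; apply: leq_sum => v.
    by rewrite inE => /andP[vg vV]; exact: bad_zeros vV vg.
  by rewrite leq_mul2l sum_incident // => e /Z2.
have h2 : 100 * (2 * #|Z|) <= 200 * rho * n.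
  by have := ltnW few_rho; clear; lia.
by rewrite -(leq_pmul2r n_gt0); apply: leq_trans h1 h2.
Qed.

Lemma cutoff_bad b : cutoff b \subset VG :\: good b.
Proof. by apply: setDS; apply: good_comp. Qed.

Lemma cutoff_card b : #|cutoff b| <= 200 * rho.
Proof. exact: leq_trans (subset_leq_card (cutoff_bad b)) (bad_card b). Qed.

(** An edge of sign b would put u into the component of the other end. *)
Lemma cutoff_clean b u e : u \in cutoff b -> e \in EG -> u \in e ->
  ~~ [exists y in cutoff b, (y != u) && (y \in e)] -> S e -> p e = ~~ b.
Proof.
move=> uU eE ue cl Se; have [e2 /subsetP eV] := EG2 eE.
have [v vu eE2] := edge_other e2 ue.
suff : p e != b by case: (p e); case: (b).
apply/eqP => pe; case/exists_inP: cl; exists v; last by rewrite vu eE2 set22.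
have vV : v \in VG by apply: eV; rewrite eE2 set22.
rewrite inE vV andbT; apply/negP => vc.
have es : e \in side b by rewrite inE eE Se pe eqxx.
have ve : v \in e by rewrite eE2 set22.
by move: uU; rewrite in_setD (subsetP (side_comp es ve vc) u ue).
Qed.

(** An edge with a single end in the cut-off set is counted at that end only. *)
Lemma cutoff_zeros b : 40 * n * #|cutoff b| <= 100 * #|Z :&: K|.
Proof.
pose dirty u := fun e : {set V} => [exists y in cutoff b, (y != u) && (y \in e)].
pose D u := [set e in K | [&& u \in e, ~~ dirty u e & ~~ S e]].
have hD u : u \in cutoff b -> 40 * n <= 100 * #|D u|.
  move=> uU; have uV : u \in VG by move: uU; rewrite inE => /andP[].
  have h1 := cost (dirty := dirty u) uV
    (fun e eK ue cl Se => cutoff_clean uU (KEG eK) ue cl Se).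
  have h2 : #|[set e in K | (u \in e) && (dirty u e || ~~ S e)]| <= #|cutoff b| + #|D u|.
    apply: leq_trans (leq_add (incident_to (Z := K) (cutoff b) u _) (leqnn _)); last by move=> e /K2[].
    apply: leq_trans (cardU_le _ _); apply: subset_leq_card; apply/subsetP => e.
    rewrite !inE => /and3P[-> ->]; rewrite -/(dirty u e) /=; by case: (dirty u e).
  by move: h1 h2 (cutoff_card b) n_large; clear; lia.
apply: leq_trans (_ : 100 * \sum_(u in cutoff b) #|D u| <= _).
  by rewrite mulnC -sum_nat_const big_distrr /=; apply: leq_sum.
rewrite leq_mul2l /=; apply: disjoint_sum => [u uU|u v e uU vU].
  apply/subsetP => e; rewrite in_set => /and4P[eK _ _ nS].
  by rewrite in_setI eK andbT in_set nS KEG.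
rewrite !in_set => /and4P[_ ue ndu _] /and4P[_ ve _ _]; apply/eqP.
by apply: contraR ndu => uv; apply/exists_inP; exists v; rewrite // eq_sym uv.
Qed.

Lemma hidden_within b e : e \in side b -> ~~ (e \subset comp b) -> e \subset cutoff b.
Proof.
move=> es nc; have [_ /subsetP eV] : #|e| = 2 /\ e \subset VG by apply: EG2; move: es; rewrite in_set => /andP[].
apply/subsetP => u ue; rewrite inE eV // andbT.
by apply: contra nc => uc; apply: side_comp es ue uc.
Qed.

Definition has_tree b := exists T : sgraph V,
  [/\ is_tree T, vertices T \subset VG /\ #|vertices T| = n - rho.-1, edges T \subset side b,
      forall i, edges T :&: E i != set0 & edges T :&: K != set0].

Lemma comp_card b : #|comp b| + #|cutoff b| = n.
Proof. by rewrite -[RHS](cardsID (comp b)) (setIidPr (comp_sub b)). Qed.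

(** The class K, of which the component contains plenty. *)
Definition inner_last b := [set e in K :&: side b | e \subset comp b].

Lemma inner_last_card b : 'C(#|I|.+1, 2) < #|inner_last b|.
Proof.
have h1 : #|hub_reach K S p b x| <= 2 * #|inner_last b|.
  have il2 e : e \in inner_last b -> #|e| = 2.
    by rewrite in_set => /andP[/setIP[_ /side2]].
  have h2 : \sum_(y in hub_reach K S p b x) 1 <= 2 * #|inner_last b|.
    apply: leq_trans (sum_incident (hub_reach K S p b x) il2); apply: leq_sum => y yr.
    have [w xw /andP[wy ywK]] := reach_path yr; apply/card_gt0P; exists [set y; w].
    rewrite in_set set21 andbT in_set in_setI ywK setUC wy /=.
    apply: (side_comp wy (set21 _ _)); rewrite in_set; exact: connect1.
  by rewrite sum1_card in h2.
have h2 : 2 * 'C(#|I|.+1, 2) <= #|I|.+1 * #|I|.+1.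
  by rewrite bin2_double leq_mul2l leqnSn orbT.
move: (hubx b) I_small n_gt0 h1 h2; clear.
by move: (#|I|.+1 * #|I|.+1) ('C(_, 2)) n => a d n0; lia.
Qed.

(** The classes with few edges inside the component, at most two by assumption,
    are served first in [rainbow_forest]: in the places 0 and 1 a single edge is
    enough.  The vertices of the forest and the vertices that are not good form
    the core of a connected set, which is then enlarged to n - r vertices. *)
Lemma tree_of_inner b : #|cutoff b| < rho -> (forall i, inner b i != set0) ->
  (forall i j l, uniq [:: i; j; l] ->
    ~ [/\ #|inner b i| <= 'C(#|I|, 2), #|inner b j| <= 'C(#|I|, 2) & #|inner b l| <= 'C(#|I|, 2)]) ->
  has_tree b.
Proof.
move=> cU ne triple.
pose small i := #|inner b i| <= 'C(#|I|, 2).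
pose idx := filter small (enum I) ++ filter (predC small) (enum I).
have pidx : perm_eq idx (enum I) by rewrite perm_filterC.
have uidx : uniq idx by rewrite (perm_uniq pidx) enum_uniq.
have sidx : size idx = #|I| by rewrite (perm_size pidx) -cardE.
have midx i : i \in idx by rewrite (perm_mem pidx) mem_enum.
have small2 : size (filter small (enum I)) <= 2.
  have := filter_uniq small (enum_uniq I); have := filter_all small (enum I).
  case: (filter small (enum I)) => [|i [|j [|l s]]] //= /and4P[si sj sl _].
  rewrite !inE !negb_or => /and4P[/and3P[ij il _] /andP[jl _] _ _].
  by case: (@triple i j l); rewrite //= !inE negb_or ij il jl.
pose cs := rcons (map (inner b) idx) (inner_last b).
have scs : size cs = #|I|.+1 by rewrite size_rcons size_map sidx.
have nth_in j i0 : j < #|I| -> nth set0 cs j = inner b (nth i0 idx j).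
  by move=> lt; rewrite nth_rcons size_map sidx lt (nth_map i0) ?sidx.
have nth_last : nth set0 cs #|I| = inner_last b.
  by rewrite nth_rcons size_map sidx ltnn eqxx.
have innerE i e : e \in inner b i -> [/\ e \in E i, e \in side b & e \subset comp b].
  by rewrite in_set => /andP[/setIP[]].
have lastE e : e \in inner_last b -> [/\ e \in K, e \in side b & e \subset comp b].
  by rewrite in_set => /andP[/setIP[]].
have csP P e : P \in cs -> e \in P -> e \in side b /\ e \subset comp b.
  by rewrite mem_rcons inE => /orP[/eqP->|/mapP[i _ ->]] => [/lastE[]|/innerE[]].
have i0 : 0 < #|I| -> I by move=> /card_gt0P/sigW[].
have [|||F [fF cF sF hF]] := @rainbow_forest V cs.
- by move=> P e Pc /(csP _ _ Pc)[/side2].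
- move=> j j' e; rewrite scs !ltnS (leq_eqVlt j) (leq_eqVlt j').
  case/orP => [/eqP->|lj]; case/orP => [/eqP->|lj'] //.
  + rewrite nth_last (nth_in _ (i0 (leq_ltn_trans (leq0n _) lj'))) // => /lastE[eK _ _] /innerE[ei _ _].
    by have := EK ei; rewrite eK.
  + rewrite nth_last (nth_in _ (i0 (leq_ltn_trans (leq0n _) lj))) // => /innerE[ei _ _] /lastE[eK _ _].
    by have := EK ei; rewrite eK.
  rewrite !(nth_in _ (i0 (leq_ltn_trans (leq0n _) lj))) // => /innerE[ei _ _] /innerE[ej _ _].
  by apply/eqP; rewrite -(nth_uniq (i0 (leq_ltn_trans (leq0n _) lj)) _ _ uidx) ?sidx // (EE ei ej).
- move=> j; rewrite scs ltnS leq_eqVlt => /orP[/eqP->|lj].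
    by rewrite nth_last; apply: leq_trans (inner_last_card b) (leq_addr _ _).
  set d := i0 (leq_ltn_trans (leq0n _) lj); rewrite (nth_in _ d) //.
  have gt0 : 0 < #|inner b (nth d idx j)| by rewrite card_gt0 ne.
  case: (ltnP j 2) => j2.
    by move: j2 gt0; case: (j) => [|[|//]] _ g0; rewrite ?binn ?addn0 ?addn1 ?ltnS.
  have : ~~ small (nth d idx j).
    have : nth d idx j \in filter (predC small) (enum I).
      rewrite nth_cat ltnNge (leq_trans small2 j2) /=; apply: mem_nth.
      by rewrite ltn_subLR ?(leq_trans small2 j2) // -size_cat -/idx sidx.
    by rewrite mem_filter => /andP[].
  rewrite -ltnNge => h; apply: leq_trans (leq_trans h (leq_addr _ _)).
  by rewrite ltnS leq_bin2l.
have Fin e : e \in F -> e \in side b /\ e \subset comp b.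
  by case/sF => P Pc eP; apply: csP eP.
pose P := cover F :|: (comp b :\: good b).
have cP : #|P| <= 2 * #|I|.+1 + 200 * rho.
  apply: leq_trans (cardU_le _ _) _; apply: leq_add.
    apply: leq_trans (leq_card_cover F) _; rewrite -scs -cF mulnC -sum_nat_const.
    by apply: leq_sum => e /Fin[/side2->].
  apply: leq_trans (bad_card b); apply: subset_leq_card.
  by apply: setSD; apply: comp_sub.
have [||A [rA PA cA]] := rooted_core (H := side b) (x := x) (P := P) (Good := good b) (@good_path b).
- move=> v /setUP[/bigcupP[e /Fin[_ /subsetP ec] ve]|]; last by rewrite !inE => /andP[].
  by have := ec v ve; rewrite inE.
- by move=> v cv vg; apply/setUP; right; rewrite in_setD vg inE.
have [|B [rB AB cB]] := rooted_exact (t := n - rho.-1) rA.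
  have cc := comp_card b; rewrite -/(comp b); apply/andP; split; last first.
    by move: cc cU rho_gt0; clear; lia.
  apply: leq_trans cA _.
  have I1 : 10 * #|I|.+1 <= n.
    by apply: leq_trans I_small; rewrite leq_mul2l leq_pmulr.
  by move: cP I1 n_large rho_gt0; clear; lia.
have FB : F \subset within (side b) B.
  apply/subsetP => e eF; have [es _] := Fin e eF; rewrite in_set es /=.
  apply: subset_trans AB; apply: subset_trans PA; apply: subsetU; apply/orP; left.
  exact: (bigcup_sup e).
have [T [tT vT FT TH]] := tree_on (@side2 b) rB FB fF.
exists T; split=> //.
- rewrite vT; split=> //; apply/subsetP => v vB; apply: (subsetP (comp_sub b)).
  by rewrite inE; apply: rooted_connect rB vB.
- move=> i; have /hF/set0Pn[e] : inner b i \in cs by rewrite mem_rcons inE map_f ?orbT.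
  case/setIP => eF /innerE[ei _ _]; apply/set0Pn; exists e.
  by rewrite in_setI ei andbT (subsetP FT).
have /hF/set0Pn[e] : inner_last b \in cs by rewrite mem_rcons mem_head.
case/setIP => eF /lastE[eK _ _]; apply/set0Pn; exists e.
by rewrite in_setI eK andbT (subsetP FT).
Qed.

Definition hidden b i := [set e in E i :&: side b | ~~ (e \subset comp b)].
Definition lost i := [set e in E i | ~~ S e].

Lemma sum_hidden b : \sum_i #|hidden b i| <= #|cutoff b| * #|cutoff b|.
Proof.
apply: leq_trans (_ : #|[set e in side b | e \subset cutoff b]| <= _); last first.
  by apply: pairs_within => e; rewrite in_set => /andP[/side2].
rewrite (eq_bigl (fun i => i \in [set: I])); last by move=> i; rewrite in_setT.
apply: disjoint_sum => [i _|i j e _ _].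
  apply/subsetP => e; rewrite [_ \in hidden _ _]in_set => /andP[/setIP[_ es] nc].
  by rewrite in_set es; apply: hidden_within es nc.
rewrite ![_ \in hidden _ _]in_set => /andP[/setIP[ei _] _] /andP[/setIP[ej _] _].
exact: EE ei ej.
Qed.

Lemma sum_lost : \sum_i #|lost i| + #|Z :&: K| <= #|Z|.
Proof.
rewrite -(cardsID K Z) addnC leq_add2l.
rewrite (eq_bigl (fun i => i \in [set: I])); last by move=> i; rewrite in_setT.
apply: disjoint_sum => [i _|i j e _ _].
  apply/subsetP => e; rewrite [_ \in lost _]in_set => /andP[ei nS].
  by rewrite in_setD (EK ei) [_ \in Z]in_set nS (EEG ei).
rewrite ![_ \in lost _]in_set => /andP[ei _] /andP[ej _]; exact: EE ei ej.
Qed.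

(** By balance, half of the surviving edges of the class have sign b. *)
Lemma colour_count b i : #|E i| <= 2 * (#|inner b i| + #|hidden b i|) + 1 + #|lost i|.
Proof.
have sideE c' : #|E i :&: side c'| = #|[set e in E i | S e && (p e == c')]|.
  apply: eq_card => e; rewrite in_setI [_ \in side _]in_set [in RHS]in_set.
  by case: (boolP (e \in E i)) => // /EEG ->.
have h1 : #|inner b i| + #|hidden b i| = #|E i :&: side b|.
  rewrite -(cardsID [set e : {set V} | e \subset comp b] (E i :&: side b)).
  by congr (_ + _); apply: eq_card => e; rewrite !in_set // andbC.
have h2 : #|E i| <= #|E i :&: side b| + #|E i :&: side (~~ b)| + #|lost i|.
  apply: leq_trans (leq_add (cardU_le _ _) (leqnn _)); apply: leq_trans (cardU_le _ _).
  apply: subset_leq_card; apply/subsetP => e ei; rewrite in_setU in_setU !in_setI.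
  rewrite ![_ \in side _]in_set [_ \in lost _]in_set ei (EEG ei) /=.
  by case: (S e); case: (p e); case: (b).
have := balance i (~~ b); rewrite negbK -!sideE.
by move: h1 h2; clear; lia.
Qed.

Lemma sum3 (f : I -> nat) i j l : uniq [:: i; j; l] -> f i + f j + f l <= \sum_k f k.
Proof.
rewrite /= !inE negb_or => /andP[/andP[ij il] /andP[jl _]].
rewrite (bigD1 i) //= (bigD1 j) 1?eq_sym //= (bigD1 l) /=; last by rewrite ![l == _]eq_sym il.
by rewrite !addnA leq_addr.
Qed.

(** The hidden edges number at most |U|^2 for the cut-off set U, which is far
    less than the deletions at U.  Adding [colour_count] over three sparse
    classes thus bounds their total size s by 6 C + 3 + |Z|, where C bounds the
    inner edges of each, and 3 |Z| + 3 <= s because |Z| < c; this contradicts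
    s > 9 C + 3. *)
Lemma no_sparse_triple b i j l : uniq [:: i; j; l] ->
  ~ [/\ #|inner b i| <= 'C(#|I|, 2), #|inner b j| <= 'C(#|I|, 2) & #|inner b l| <= 'C(#|I|, 2)].
Proof.
move=> u [si sj sl]; have T := triple_large u.
have h := sum3 (fun k => #|hidden b k|) u; have z := sum3 (fun k => #|lost k|) u.
have hU := sum_hidden b; have hZ := sum_lost; have ZK := cutoff_zeros b.
have Uc := cutoff_card b.
have quad : 2 * (#|cutoff b| * #|cutoff b|) <= #|Z :&: K|.
  rewrite -(leq_pmul2l (isT : 0 < 100)); apply: leq_trans ZK.
  rewrite [X in _ <= X * _](_ : 40 * n = 200 * (n %/ 5) + 40 * (n %% 5)); last first.
    by rewrite {1}(divn_eq n 5); clear; lia.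
  rewrite !mulnA leq_mul2r; apply/orP; right.
  have := divn_eq n 5; move: (n %/ 5) (n %% 5) => q t.
  by move: Uc n_large; clear; lia.
have := colour_count b i; have := colour_count b j; have := colour_count b l.
have := c_colour i; have := c_colour j; have := c_colour l.
move: T h z hU hZ quad si sj sl few.
clear; move: ('C(#|I|, 2)) (#|cutoff b| * _) => M0 q; lia.
Qed.

(** By [colour_count], at least |E i| - 1 - 2 h edges of the class are deleted,
    where h is the number of hidden ones.  If the cut-off set were nonempty, more
    than 2 h edges of K would be deleted as well, so at least |E i| >= c edges in
    total.  Hence nothing is hidden and the c - 1 deletions are all in class i. *)
Lemma missing_colour b i : inner b i = set0 ->
  [/\ cutoff b = set0, E i :&: side b = set0, Z \subset E i & #|E i| <= #|Z| + 1].
Proof.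
move=> i0; have cc := colour_count b i; rewrite i0 cards0 add0n in cc.
have hi : #|hidden b i| <= #|cutoff b| * #|cutoff b|.
  by apply: leq_trans (sum_hidden b); rewrite (bigD1 i) //= leq_addr.
have li : #|lost i| + #|Z :&: K| <= #|Z|.
  by apply: leq_trans sum_lost; rewrite leq_add2r (bigD1 i) //= leq_addr.
have ci := c_colour i; have ZK := cutoff_zeros b; have Uc := cutoff_card b.
have U0 : cutoff b = set0.
  apply/eqP; rewrite -cards_eq0 -leqn0 leqNgt; apply/negP => U1.
  have : #|Z :&: K| <= 2 * (#|cutoff b| * #|cutoff b|).
    by move: cc hi li ci few; move: (#|cutoff b| * _) => q; clear; lia.
  rewrite -(leq_pmul2l (isT : 0 < 100)) => h; have := leq_trans ZK h.
  rewrite !mulnA leq_pmul2r //; move: Uc n_large rho_gt0; clear; lia.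
have h0 : #|hidden b i| = 0 by apply/eqP; move: hi; rewrite U0 cards0 leqn0.
have lZ : #|lost i| = #|Z|.
  by move: cc li ci few; rewrite h0; clear; lia.
have sub : lost i \subset Z.
  by apply/subsetP => e; rewrite [_ \in lost _]in_set => /andP[ei nS]; rewrite [_ \in Z]in_set (EEG ei).
have eZ : lost i = Z by apply/eqP; rewrite eqEcard sub lZ leqnn.
split=> //.
- apply/setP => e; rewrite [in RHS]inE; apply/negP => es.
  case: (boolP (e \subset comp b)) => ec.
    by have := in_set0 e; rewrite -i0 in_set es ec.
  by move/cards0_eq: h0 => /setP/(_ e); rewrite in_set es ec inE.
- by rewrite -eZ; apply/subsetP => e; rewrite in_set => /andP[].
by move: cc; rewrite h0 lZ muln0 add0n addnC.
Qed.

(** If sign b fails because of a missing class i, nothing is deleted in K, so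
    nothing is cut off in the other sign either, and that sign fails because of a
    missing class j.  All deletions lie in both classes, hence there are none,
    and both classes are single edges, of opposite signs. *)
Lemma two_failures : ~ has_tree true -> ~ has_tree false ->
  rho <= #|cutoff true| /\ rho <= #|cutoff false|.
Proof.
move=> nt nf; have nb b : ~ has_tree b by case: b.
have fail b : rho <= #|cutoff b| \/ exists i, inner b i = set0.
  case: (leqP rho #|cutoff b|) => [|lt]; [by left|right].
  have [/existsP[i /eqP e]|none] := boolP [exists i, inner b i == set0]; first by exists i.
  case: (nb b); apply: tree_of_inner => // [i|]; last exact: no_sparse_triple.
  by apply: contra none => e; apply/existsP; exists i.
suff allb b : rho <= #|cutoff b| by split.
case: (fail b) => // -[i /missing_colour[U0 Ei0 ZE Ei1]].
have ZK0 : Z :&: K = set0.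
  by apply/setP => e; rewrite in_setI in_set0; apply/andP => -[/(subsetP ZE)/EK/negP].
have Un : cutoff (~~ b) = set0.
  have := cutoff_zeros (~~ b); rewrite ZK0 cards0 muln0 leqn0 !muln_eq0.
  by rewrite cards_eq0 -[n == 0]negbK -lt0n n_gt0 /= => /eqP.
case: (fail (~~ b)) => [|[j /missing_colour[_ Ej0 ZE' Ej1]]].
  by rewrite Un cards0 leqNgt rho_gt0.
have cE k e : e \in E k -> S e -> e \in E k :&: side (p e).
  by move=> ek Se; rewrite in_setI ek in_set (EEG ek) Se eqxx.
have pnb k e b' : e \in E k -> S e -> E k :&: side b' = set0 -> p e = ~~ b'.
  move=> ek Se /setP/(_ e); rewrite in_set0 => h; have := cE k e ek Se.
  by case: (p e) h; case: b' => // ->.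
have ij : i != j.
  apply/eqP => ij; rewrite -ij in Ej0.
  have : #|E i| <= #|Z|.
    apply: subset_leq_card; apply/subsetP => e ei; rewrite in_set (EEG ei) /=.
    apply/negP => Se; have := pnb _ _ _ ei Se Ei0; rewrite (pnb _ _ _ ei Se Ej0).
    by case: (b).
  by have := c_colour i; move: few; clear; lia.
have Z0 : Z = set0.
  apply/setP => e; rewrite in_set0; apply/negP => eZ.
  have ei := subsetP ZE _ eZ; have ej := subsetP ZE' _ eZ.
  by rewrite (EE ei ej) eqxx in ij.
have allS e : e \in EG -> S e.
  by move=> eE; apply/negPn/negP => nS; have := in_set0 e; rewrite -Z0 in_set eE nS.
have c0 := few; rewrite Z0 cards0 in c0 Ei1 Ej1.
have i1 : #|E i| = 1 by have := c_colour i; move: c0 Ei1; clear; lia.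
have j1 : #|E j| = 1 by have := c_colour j; move: c0 Ej1; clear; lia.
have [e ee] := cards1P (introT eqP i1); have [f fe] := cards1P (introT eqP j1).
have ei : e \in E i by rewrite ee set11.
have fj : f \in E j by rewrite fe set11.
have := single_same allS ij i1 j1 ei fj.
rewrite (pnb _ _ _ ei (allS _ (EEG ei)) Ei0) (pnb _ _ _ fj (allS _ (EEG fj)) Ej0).
by case: (b).
Qed.

Let Y := cutoff true :|: cutoff false.
Let own (b : bool) := cutoff b :\: cutoff (~~ b).
Let dirty u (e : {set V}) := [exists y in Y, (y != u) && (y \in e)].
(** The deletions for which u pays; those in its own bow-ties need not be at u. *)
Let charged u :=
  [set e in EG | [&& (u \in e) || (e \in Bow u), ~~ dirty u e & ~~ S e]].
(** An edge from a vertex cut off in both signs to the outside of Y can have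
    neither sign, so these are all such edges. *)
Let shared := [set e in Z | (e :&: (cutoff true :&: cutoff false) != set0) && ~~ (e \subset Y)].

Let cutoffY b : cutoff b \subset Y.
Proof. by case: b; [apply: subsetUl|apply: subsetUr]. Qed.

Let sharedI b : cutoff true :&: cutoff false = cutoff b :&: cutoff (~~ b).
Proof. by case: b => //=; rewrite setIC. Qed.

Lemma charged_bound b u : u \in own b ->
  #|[set e in EG | u \in e]| + m <= 2 * #|charged u| + 14 * #|Y|.
Proof.
move=> /setDP[uX _]; have uV : u \in VG by move: uX; rewrite in_setD => /andP[].
have mono e : e \in EG -> u \in e -> ~~ dirty u e -> S e -> p e = ~~ b.
  move=> eE ue cl; apply: cutoff_clean uX eE ue _.
  by apply: contra cl => /exists_inP[y yX h]; apply/exists_inP; exists y => //; apply: (subsetP (cutoffY b)).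
have h1 := cost_exact uV mono.
have h2 : #|[set e in EG | (u \in e) && dirty u e]| <= #|Y|.
  by apply: incident_to => e /EG2[].
have h3 : #|[set e in Bow u | dirty u e]| <= 2 * #|Y|.
  apply: leq_trans (_ : #|\bigcup_(y in Y :\ u) [set e in Bow u | y \in e]| <= _).
    apply: subset_leq_card; apply/subsetP => e; rewrite in_set => /andP[eB /exists_inP[y yY /andP[yu ye]]].
    by apply/bigcupP; exists y; rewrite ?in_setD1 ?yu // in_set eB.
  apply: leq_trans (card_bigcup_le _ _) _.
  apply: leq_trans (_ : \sum_(y in Y :\ u) 2 <= _).
    by apply: leq_sum => y /setD1P[yu _]; apply: Bow_deg.
  rewrite sum_nat_const mulnC leq_mul2l; apply: subset_leq_card; apply: subsetDl.
by move: h1 h2 h3; rewrite -/(charged u); clear; lia.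
Qed.

(** A clean edge has only one end in Y, and bow-ties at different centres are
    disjoint. *)
Lemma charged_total :
  #|shared| + \sum_(u in own true :|: own false) #|charged u| <= #|Z|.
Proof.
have ownY u : u \in own true :|: own false -> u \in Y /\ u \notin cutoff true :&: cutoff false.
  rewrite in_setU => /orP[] /setDP[uX nX]; split.
  - by rewrite in_setU uX.
  - by rewrite in_setI negb_and nX orbT.
  - by rewrite in_setU uX orbT.
  by rewrite in_setI negb_and nX.
rewrite -(cardsID shared Z) leq_add //.
  by apply: subset_leq_card; apply/subsetP => e es; rewrite in_setI es andbT; move: es; rewrite [_ \in shared]in_set => /andP[].
apply: disjoint_sum => [u /ownY[uY uI]|u v e /ownY[uY _] /ownY[vY _]].
  apply/subsetP => e; rewrite [_ \in charged u]in_set => /and4P[eE _ cl nS].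
  rewrite in_setD [_ \in Z]in_set eE nS !andbT [_ \in shared]in_set; apply: contra cl.
  case/and3P => _ /set0Pn[i /setIP[ie iI]] _; apply/exists_inP; exists i.
    by apply: (subsetP (cutoffY true)); case/setIP: iI.
  by rewrite ie andbT; apply: contraNneq uI => <-.
rewrite ![_ \in charged _]in_set => /and4P[_ ue du _] /and4P[_ ve dv _].
apply/eqP; apply/negPn/negP => uv.
have nu : u \notin e by apply: contra dv => h; apply/exists_inP; exists u; rewrite // uv.
have nv : v \notin e by apply: contra du => h; apply/exists_inP; exists v; rewrite // eq_sym uv.
rewrite (negbTE nu) (negbTE nv) /= in ue ve.
by have := disjoint_setI0 (Bow_dis uv) => /setP/(_ e); rewrite in_setI ue ve in_set0.
Qed.

Lemma cut_bound b : #|cut_edges (cutoff b)| <=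
  #|shared| + \sum_(u in own b) #|[set e in EG | u \in e]| + #|own (~~ b)| * #|Y|.
Proof.
apply: leq_trans (_ : #|shared :|: \bigcup_(u in own b) [set e in EG | u \in e] :|:
   \bigcup_(u in own (~~ b)) [set e in EG | (u \in e) && dirty u e]| <= _); last first.
  apply: leq_trans (cardU_le _ _) _; apply: leq_add.
    by apply: leq_trans (cardU_le _ _) _; rewrite leq_add2l; apply: card_bigcup_le.
  apply: leq_trans (card_bigcup_le _ _) _; rewrite -sum_nat_const; apply: leq_sum => u _.
  by apply: incident_to => e /EG2[].
apply: subset_leq_card; apply/subsetP => e; rewrite [_ \in cut_edges _]in_set.
case/and3P => eE /set0Pn[u /setIP[ue uX]] /subsetPn[v ve vX].
have [e2 /subsetP eV] := EG2 eE; have [w wu eE2] := edge_other e2 ue.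
have vu : v != u by apply: contraNneq vX => ->.
have {w wu eE2} eE2 : e = [set u; v].
  by move: ve; rewrite eE2 !inE (negbTE vu) /= => /eqP->.
have [uX'|uX'] := boolP (u \in cutoff (~~ b)); last first.
  rewrite in_setU in_setU; apply/orP; left; apply/orP; right; apply/bigcupP; exists u.
    by rewrite in_setD uX uX'.
  by rewrite in_set eE.
have [vX'|vX'] := boolP (v \in cutoff (~~ b)).
  rewrite in_setU; apply/orP; right; apply/bigcupP; exists v.
    by rewrite in_setD negbK vX vX'.
  rewrite in_set eE ve /=; apply/exists_inP; exists u; first exact: (subsetP (cutoffY b)).
  by rewrite eq_sym vu.
rewrite in_setU in_setU; apply/orP; left; apply/orP; left.
have vY : v \notin Y.
  rewrite in_setU; move: vX vX'; case: (b) => /=; first by move=> h1 h2; rewrite negb_or h1.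
  by move=> h1 h2; rewrite negb_or h1 andbT.
have cl b' : u \in cutoff b' -> v \notin cutoff b' -> S e -> p e = ~~ b'.
  move=> u' v'; apply: cutoff_clean u' eE ue _; apply/exists_inP => -[y yX /andP[yu ye]].
  by move: ye yX; rewrite eE2 in_set2 (negbTE yu) /= => /eqP->; rewrite (negbTE v').
rewrite [_ \in shared]in_set [_ \in Z]in_set eE /=; apply/and3P; split.
- apply/negP => Se; have := cl _ uX vX Se; rewrite (cl _ uX' vX' Se).
  by case: (b).
- by apply/set0Pn; exists u; rewrite in_setI ue (sharedI b) in_setI uX uX'.
by apply/subsetPn; exists v.
Qed.

(** Each cut is made of shared edges, edges at own vertices, and at most |Y|
    edges for each vertex owned by the other side.  Shared edges are deleted and
    occur in both cuts; those of the second kind are paid for at half price by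
    [charged_bound], where the surplus m absorbs all terms in |Y|. *)
Lemma no_double_cut : rho <= #|cutoff true| -> rho <= #|cutoff false| -> False.
Proof.
move=> rt rf.
have cle b : rho <= #|cutoff b| -> c <= #|cut_edges (cutoff b)|.
  move=> rb; apply: c_cut => //; first exact: subsetDl.
  by have := cutoff_card b; move: n_large; clear; lia.
have h1 := leq_trans (cle true rt) (cut_bound true).
have h2 := leq_trans (cle false rf) (cut_bound false).
have h3 := charged_total.
have dis : [disjoint own true & own false].
  rewrite -setI_eq0; apply/eqP/setP => u; rewrite in_setI in_set0.
  by apply/negP => /andP[/setDP[u1 _] /setDP[_]]; rewrite u1.
rewrite (eq_bigl [predU own true & own false]) ?bigU //= in h3; last by move=> u; rewrite in_setU.
rewrite [~~ true]/= [~~ false]/= in h1 h2.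
have h4 b : \sum_(u in own b) #|[set e in EG | u \in e]| + #|own b| * m <=
    2 * \sum_(u in own b) #|charged u| + #|own b| * (14 * #|Y|).
  rewrite -!sum_nat_const -!big_split /= big_distrr -big_split /=.
  by apply: leq_sum => u; apply: charged_bound.
have Ym : 15 * #|Y| <= m.
  have := cardU_le (cutoff true) (cutoff false); rewrite -/Y.
  by have := cutoff_card true; have := cutoff_card false; move: m_large; clear; lia.
have h5 b : #|own b| * (14 * #|Y|) + #|own b| * #|Y| <= #|own b| * m.
  by rewrite -mulnDr leq_mul2l -mulSnr Ym orbT.
move: h1 h2 h3 (h4 true) (h4 false) (h5 true) (h5 false) few.
move: (#|own true| * (14 * #|Y|)) (#|own true| * #|Y|) (#|own true| * m) => a1 a2 a3.
move: (#|own false| * (14 * #|Y|)) (#|own false| * #|Y|) (#|own false| * m) => b1 b2 b3.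
move: (\sum_(u in own true) #|[set e in EG | u \in e]|)
  (\sum_(u in own false) #|[set e in EG | u \in e]|)
  (\sum_(u in own true) #|charged u|) (\sum_(u in own false) #|charged u|) => d1 d2 c1 c2.
move: #|shared| #|Z| => s0 z0; clear; lia.
Qed.

Lemma some_tree : has_tree true \/ has_tree false.
Proof.
have [h|nt] := EM (has_tree true); first by left.
have [h|nf] := EM (has_tree false); first by right.
by have [r1 r2] := two_failures nt nf; case: (no_double_cut r1 r2).
Qed.

End Hub.

Theorem survivors_tree : exists b (T : sgraph V),
  [/\ is_tree T, vertices T \subset VG /\ #|vertices T| = n - rho.-1, edges T \subset side b,
      forall i, edges T :&: E i != set0 & edges T :&: K != set0].
Proof.
have [x xV hx] := hub few_rho.
by case: (some_tree xV hx) => h; [exists true|exists false].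
Qed.
End Survivors.

(** * Chromatic number and deletions *)

Lemma alternating_exists (T : eqType) (l : seq T) : uniq l -> exists p : pred T, alternating p l.
Proof.
elim: l => [|x l IH] /=; first by exists xpredT.
case/andP => xl /IH[p ap]; exists (fun y => if y == x then ~~ p (head x l) else p y).
have ap' : alternating (fun y => if y == x then ~~ p (head x l) else p y) l.
  have -> // : alternating (fun y => if y == x then ~~ p (head x l) else p y) l = alternating p l.
  apply: (@eq_in_sorted _ (mem l)) => [y z yl zl|]; last exact/allP.
  by rewrite !ifN //; apply: contraNneq xl => <-.
case: l xl ap' {ap IH} => //= y l; rewrite inE negb_or => /andP[xy xl] ap'.
by rewrite [path _ _ _]ap' eqxx (eq_sym y x) (negbTE xy) andbT; case: (p y).
Qed.

Section Basics.
Variable V : finType.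
Implicit Types (H G : sgraph V).

Lemma edgesP H e : e \in edges H -> #|e| = 2 /\ e \subset vertices H.
Proof. by case: H => h hP /= eh; have /andP[/eqP] := forall_inP hP _ eh. Qed.

Lemma isomorphic_refl H : isomorphic H H.
Proof.
apply/existsP; exists [ffun x => x]; apply/and3P; split.
- rewrite (_ : _ @: _ = vertices H) //; apply/setP => x; apply/imsetP/idP => [[y yH ->]|xH].
    by rewrite ffunE.
  by exists x; rewrite ?ffunE.
- by apply/forall_inP => x _; apply/forall_inP => y _; rewrite !ffunE; apply/implyP.
by apply/forall_inP => x _; apply/forall_inP => y _; rewrite !ffunE.
Qed.

Lemma isomorphic_connected H G : isomorphic H G -> is_connected G ->
  #|vertices H| = #|vertices G| /\
  {in vertices H &, forall x y, connect (adj H) x y}.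
Proof.
case/existsP => f /and3P[/eqP fV finj fadj] /andP[_ cG].
have fI : {in vertices H &, injective f}.
  move=> x y xH yH /eqP; have /forall_inP/(_ y yH)/implyP h := forall_inP finj x xH.
  by move/h/eqP.
split; first by rewrite -fV card_in_imset.
move=> x y xH yH.
have fin z : z \in vertices H -> f z \in vertices G by move=> zH; rewrite -fV imset_f.
have /forall_inP/(_ _ (fin y yH)) := forall_inP cG _ (fin x xH).
case/connectP => q; elim: q x xH => [|w q IH] x xH /= => [_ e|/andP[xw pq] e].
  by rewrite (fI y x).
have wG : w \in vertices G by have [_ /subsetP] := edgesP xw; apply; rewrite set22.
rewrite -fV in wG; case/imsetP: wG => z zH wz; subst w.
apply: connect_trans (IH z zH pq e); apply: connect1.
by have /forall_inP/(_ z zH)/eqP <- := forall_inP fadj x xH.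
Qed.

Lemma bigmin_le (T : eqType) (r : seq T) (P : pred T) (F : T -> nat) d x :
  x \in r -> P x -> \big[minn/d]_(i <- r | P i) F i <= F x.
Proof.
elim: r => // y r IH; rewrite inE big_cons => /orP[/eqP<- Px|xr Px].
  by rewrite Px geq_minl.
by case: ifP => _; [apply: leq_trans (geq_minr _ _) _|]; apply: IH.
Qed.

Lemma min_degree_le H x : x \in vertices H -> min_degree H <= degree H x.
Proof. by move=> xH; apply: bigmin_le; rewrite ?mem_index_enum. Qed.

Lemma edge_deletedP G (R : {set {set V}}) :
  [forall e in (vertices G, edges G :\: R).2, (#|e| == 2) && (e \subset (vertices G, edges G :\: R).1)].
Proof.
by apply/forall_inP => e /= /setDP[/edgesP[-> ->] _]; rewrite eqxx.
Qed.

Definition delete_edges G R : sgraph V := SGraph (edge_deletedP G R).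

Lemma delete_spanning G R : spanning (delete_edges G R) G.
Proof.
by rewrite /spanning /subgraph /vertices /edges /= subxx eqxx subsetDl.
Qed.

End Basics.

Section Coloring.
Variables (V : finType) (k : nat) (G : sgraph V) (D : 'I_k -> sgraph V) (F : {set sgraph V}).
Hypothesis k_gt0 : 0 < k.

Let good (S : sgraph V) := spanning S G &&
  [forall H, ~~ [&& subgraph H S, family_subgraph G D H & in_family F H]].

Lemma ex_attained : exists2 S, good S & ex_number G D F = #|edges S|.
Proof.
have : 0 < #|[pred S | good S]|.
  apply/card_gt0P; exists (delete_edges G (edges G)); rewrite inE /good delete_spanning.
  apply/forallP => H; apply/negP => /and3P[/andP[_ sE] /andP[_ /forallP/(_ (Ordinal k_gt0))/set0Pn[e he]] _].
  have eH : e \in edges H by case/setIP: he.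
  by have := subsetP sE e eH; rewrite /edges /= setDv inE.
move=> h; have [S gS e] := eq_bigmax_cond (fun S : sgraph V => #|edges S|) h.
by exists S; rewrite // -e; apply: eq_bigl => S'; rewrite inE.
Qed.

(** Without R the graph is a competitor in the definition of the extremal
    number. *)
Lemma deletion_bound (R : {set {set V}}) :
  (forall H, subgraph H (delete_edges G R) -> family_subgraph G D H -> ~~ in_family F H) ->
  #|edges G| - ex_number G D F <= #|R|.
Proof.
move=> no; have gS : good (delete_edges G R).
  rewrite /good delete_spanning; apply/forallP => H; apply/negP => /and3P[h1 h2 h3].
  by have := no H h1 h2; rewrite h3.
have : #|edges (delete_edges G R)| <= ex_number G D F by apply: leq_bigmax_cond.
have -> : #|edges (delete_edges G R)| = #|edges G :\: R| by [].
by have := cardsID R (edges G); have := subset_leq_card (subsetIr (edges G) R); clear; lia.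
Qed.

(** No tree fits into an extremal spanning subgraph, so each can be coloured by
    one of its edges that is missing there. *)
Lemma chromatic_upper :
  chromatic_number (kneser_graph G D F) <= #|edges G| - ex_number G D F.
Proof.
rewrite /chromatic_number; case: ex_minnP => m0 _; apply.
have [S /andP[/andP[/andP[vS sE] /eqP vE] /forallP noS] exE] := ex_attained.
pose R := edges G :\: edges S.
have cR : #|edges G| - ex_number G D F = #|R|.
  by rewrite exE cardsD (setIidPr sE).
rewrite cR; set KG := kneser_graph G D F.
have hit (H : {x : sgraph V | x \in vertices KG}) : exists e, e \in edges (val H) :&: R.
  apply/set0Pn; case: H => H /= HK; move: (HK); rewrite inE => /andP[fH iH].
  apply/negP => /eqP dis; have := noS H; rewrite fH iH /= !andbT.
  rewrite /subgraph vE; have /andP[/andP[-> eHG] _] := fH; case/negP => /=.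
  apply/subsetP => e eH; apply/negPn/negP => eS; have := in_set0 e.
  by rewrite -dis in_setI eH in_setD eS (subsetP eHG).
pose pick H := xchoose (hit H).
have pickR H : pick H \in edges (val H) /\ pick H \in R.
  by apply/setIP; apply: (xchooseP (hit H)).
apply/existsP; exists [ffun H => enum_rank_in (pickR H).2 (pick H)].
apply/forallP => H1; apply/forallP => H2; apply/implyP => a12.
rewrite !ffunE; apply/negP => /eqP /enum_rank_in_inj h.
have e12 := h (pickR H1).2 (pickR H2).2.
move: a12; rewrite /adj /edges /= inE => /exists_inP[x _ /exists_inP[y _ /and3P[_ dxy /eqP]]].
have [p1 _] := pickR H1; have [p2 _] := pickR H2; rewrite -e12 in p2.
case/pair_eq => -[e1 e2]; move: dxy; rewrite /edge_disjoint -e1 -e2 => /disjoint_setI0/setP/(_ (pick H1));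
  by rewrite in_setI p1 p2 in_set0.
Qed.

(** Colourings of the Kneser graph are read as colourings of edge sets.  Edge
    sets outside the family take the colour of an arbitrary tree T0. *)
Lemma chromatic_lower (sigma : seq {set V}) c :
  uniq sigma -> sigma =i edges G -> c <= #|edges G| ->
  (forall (S : {set {set V}}) (p : pred {set V}), {subset S <= sigma} ->
     alternating p [seq e <- sigma | e \in S] -> #|[set e in edges G | e \notin S]| < c ->
     exists b T, T \in vertices (kneser_graph G D F) /\
       edges T \subset [set e in edges G | (e \in S) && (p e == b)]) ->
  c <= chromatic_number (kneser_graph G D F).
Proof.
move=> us sE cE full; set KG := kneser_graph G D F in full *.
case: (posnP c) => [->//|c0].
have csig : #|edges G| = size sigma.
  by rewrite -(card_uniqP us); apply: eq_card => e; rewrite sE.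
rewrite /chromatic_number; case: ex_minnP => m /existsP[f /forallP fP] _.
have KGne H : H \in vertices KG -> edges H != set0.
  rewrite inE => /andP[/andP[_ /forallP/(_ (Ordinal k_gt0))/set0Pn[e /setIP[eH _]]] _].
  by apply/set0Pn; exists e.
have [T0 T0K] : exists T0, T0 \in vertices KG.
  have [p ap] := alternating_exists us.
  have [|||b [T [TK _]]] := full [set e in sigma] p.
  - by move=> e; rewrite inE.
  - by rewrite (_ : [seq e <- _ | _] = sigma) //; apply/all_filterP/allP => e; rewrite inE.
  - rewrite (_ : [set _ in _ | _] = set0) ?cards0 //.
    by apply/setP => e; rewrite !inE sE andbN.
  by exists T.
pose Fs := [set edges T | T in vertices KG].
pose col (A : {set {set V}}) : 'I_m :=
  if [pick H : {x : sgraph V | x \in vertices KG} | edges (val H) == A] is Some H then f H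
  else f (exist _ T0 T0K).
have colP A : A \in Fs -> exists H : {x : sgraph V | x \in vertices KG}, edges (val H) = A /\ col A = f H.
  case/imsetP => T TK ->; rewrite /col; case: pickP => [H /eqP eH|/(_ (exist _ T TK))]; first by exists H.
  by rewrite /= eqxx.
apply: (@kneser_alternating _ sigma Fs c m col us) => [A1 A2 F1 F2 dis||S p sS ap lt].
- have [H1 [e1 ->]] := colP _ F1; have [H2 [e2 ->]] := colP _ F2.
  have := forallP (fP H1) H2; move/implyP; apply.
  rewrite /adj /edges /= inE; apply/exists_inP; exists (val H1); first exact: valP.
  apply/exists_inP; exists (val H2); first exact: valP.
  rewrite eqxx andbT /edge_disjoint e1 e2 dis andbT; apply/eqP => e12.
  have := KGne (val H1) (valP H1); rewrite e1; move: dis; rewrite -e2 -e12 e1.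
  by rewrite -setI_eq0 setIid => ->.
- by rewrite -csig.
have [|b [T [TK Tsub]]] := full S p sS ap.
  have cS : #|[set e in edges G | e \notin S]| + #|S| = size sigma.
    rewrite -csig -(cardsID S (edges G)) addnC; congr (_ + _).
      apply: eq_card => e; rewrite in_setI; case: (boolP (e \in S)) => //; last by rewrite andbF.
      by move/sS; rewrite sE => ->.
    by apply: eq_card => e; rewrite inE in_setD andbC.
  by rewrite -(ltn_add2r #|S|) cS addnC.
exists (edges T); first exact: imset_f.
apply/orP; case: b Tsub => /subsetP Tsub; [left|right]; apply/subsetP => e /Tsub;
  by rewrite !inE => /and3P[_ -> /eqP->].
Qed.
End Coloring.

(** * The equality for fixed parameters *)

Lemma sorted_triple (k : nat) (f : nat -> nat) i j l :
  (forall a b, a <= b < k -> f a <= f b) -> i < k -> j < k -> l < k ->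
  uniq [:: i; j; l] -> f 0 + f 1 + f 2 <= f i + f j + f l.
Proof.
move=> mono ik jk lk u; pose s := sort leq [:: i; j; l].
have ps : perm_eq s [:: i; j; l] by rewrite perm_sort.
have lt : sorted ltn s.
  by rewrite ltn_sorted_uniq_leq sort_uniq u; apply: sort_sorted leq_total _.
have sk : all (fun a => a < k) s by rewrite (perm_all _ ps) /= ik jk lk.
have := perm_sumn (perm_map f ps); rewrite /= addn0 addnA => <-.
have := perm_size ps; clearbody s.
case: s lt sk {ps} => [|a [|b [|c [|]]]] //= /and3P[ab bc _] /and4P[ak bk ck _] _.
rewrite addn0 addnA; apply: leq_add; first apply: leq_add; apply: mono; lia.
Qed.

(** For k = q + 3, the lower bound on s is 6 q^2 + 27 q + 34, whereas
    9 C(k, 2) + 3 = (9 q^2 + 45 q + 60) / 2. *)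
Lemma triple_bound (k s t : nat) : 3 <= k ->
  3 * 'C(2 * k.+1 - 3, 2) + 4 <= s -> s <= t -> 9 * 'C(k, 2) + 3 < t.
Proof.
move=> k3 h st; have h1 := bin2_double k; have h2 := bin2_double (2 * k.+1 - 3).
have [q kq] : exists q, k = q + 3 by exists (k - 3); rewrite subnK.
have e1 : 2 * k.+1 - 3 = 2 * q + 5 by rewrite kq; clear; lia.
rewrite e1 in h h2; move: h h1 h2 st; rewrite kq.
move: ('C(2 * q + 5, 2)) ('C(q + 3, 2)) => a b; clear.
rewrite !(addnS, addn0) /=; nia.
Qed.

Section Finite.
Variables (V : finType) (G : sgraph V) (k r m sh : nat) (D : 'I_k.+1 -> sgraph V).
Let n := #|vertices G|.
Hypothesis decD : decomposition G D.
Hypothesis sortedD : forall i j : 'I_k.+1, i <= j -> #|edges (D i)| <= #|edges (D j)|.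
Hypothesis sumD : k.+1 <= 2 \/
  3 * 'C(2 * k.+1 - 3, 2) + 4 <= \sum_(i < k.+1 | i < 3) #|edges (D i)|.
Hypothesis spanD : spanning (D ord_max) G.
Hypothesis degD : 5 * n <= 6 * min_degree (D ord_max).
Hypothesis r_gt0 : 0 < r.
Hypothesis m_small : 4000 * m <= n %/ 100.
Hypothesis sh_small : 10 * sh <= m.
Hypothesis rho_small : 200 * (360 * r.+1) <= sh.
Hypothesis k_small : 10 * k.+1 <= m.
Hypothesis m_large : 100 <= m.
Hypothesis k2_small : 10 * (k.+1 * k.+1) <= n.

Let K := edges (D ord_max).
Let E (i : 'I_k) := edges (D (widen_ord (leqnSn k) i)).
Let F := tree_family G (n - r).
Let EG := K :|: \bigcup_i E i.

Lemma edgesG : edges G = EG.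
Proof.
have /and3P[_ _ /eqP <-] := decD; apply/setP => e; apply/bigcupP/setUP => [[i _ ei]|[eK|/bigcupP[i _ ei]]].
- case: (unliftP ord_max i) ei => [j|] -> ei; last by left.
  right; apply/bigcupP; exists j => //; move: ei; rewrite /E.
  by congr (_ \in edges (D _)); apply: val_inj; rewrite /= /bump leqNgt ltn_ord.
- by exists ord_max.
by exists (widen_ord (leqnSn k) i).
Qed.

Lemma colours_disjoint (i j : 'I_k.+1) e : e \in edges (D i) -> e \in edges (D j) -> i = j.
Proof.
move=> ei ej; apply/eqP/negPn/negP => ij.
have /and3P[_ /forallP/(_ i)/forallP/(_ j)/implyP/(_ ij) /disjoint_setI0 + _] := decD.
by move/setP/(_ e); rewrite in_setI ei ej in_set0.
Qed.

Lemma EKdis (i : 'I_k) e : e \in E i -> e \notin K.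
Proof.
move=> ei; apply/negP => eK; have := congr1 val (colours_disjoint ei eK) => /= ik.
by have := ltn_ord i; rewrite ik ltnn.
Qed.

Lemma EEdis (i j : 'I_k) e : e \in E i -> e \in E j -> i = j.
Proof. by move=> ei ej; have := congr1 val (colours_disjoint ei ej) => /= ij; apply: val_inj. Qed.

Lemma EGprop e : e \in EG -> #|e| = 2 /\ e \subset vertices G.
Proof. by rewrite -edgesG; apply: edgesP. Qed.

Lemma triple (i j l : 'I_k) : uniq [:: i; j; l] -> 9 * 'C(k, 2) + 3 < #|E i| + #|E j| + #|E l|.
Proof.
move=> u; have k3 : 3 <= k.
  have := uniq_leq_size u (fun x _ => mem_enum predT x); rewrite /= -[X in _ <= X]cardE.
  by rewrite card_ord.
case: sumD => [|h]; first by move: k3; clear; lia.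
pose f a := #|edges (D (inord a))|.
have fE a : a < k -> forall o : 'I_k, val o = a -> #|E o| = f a.
  move=> ak o oa; rewrite /f /E; congr #|edges (D _)|; apply: val_inj.
  by rewrite /= inordK ?oa // ltnS ltnW.
apply: (triple_bound k3 h).
have -> : \sum_(i0 < k.+1 | i0 < 3) #|edges (D i0)| = f 0 + f 1 + f 2.
  rewrite (eq_bigr (fun i0 : 'I_k.+1 => f i0)); last first.
    by move=> i0 _; rewrite /f inord_val.
  rewrite -(big_ord_widen k.+1 f (leqW k3)) !big_ord_recr big_ord0 /=.
  by rewrite add0n.
rewrite !(fE _ (ltn_ord _) _ erefl).
apply: (sorted_triple (k := k)) => // a b /andP[ab bk].
by apply: sortedD; rewrite !inordK //; move: ab bk; clear; lia.
Qed.

Let c := cut_number G D (r + 1).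

Lemma r_lt_n : r.+1 < n.
Proof.
have := leq_trunc_div n 100; move: rho_small sh_small m_small; clear.
by move: (n %/ 100) n => a b; lia.
Qed.

Lemma cE : c = #|edges G| - ex_number G D F.
Proof.
rewrite /c /cut_number /F; congr (_ - ex_number _ _ (tree_family _ _)).
by have := r_lt_n; rewrite -/n; clear; lia.
Qed.

Lemma in_tree_family H : subgraph H G -> in_family F H -> [/\ #|vertices H| = n - r,
  vertices H \subset vertices G & {in vertices H &, forall x y, connect (eadj (edges H)) x y}].
Proof.
move=> /andP[sV _] /exists_inP[T]; rewrite inE => /and3P[_ /andP[cT _] /eqP <-] iso.
by have [h1 h2] := isomorphic_connected iso cT.
Qed.

(** A tree of the family needs an edge of each class. *)
Lemma c_colour (i : 'I_k) : c <= #|E i|.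
Proof.
rewrite cE; apply: deletion_bound => H /andP[_ sE] /andP[_ /forallP/(_ (widen_ord (leqnSn k) i))].
case/set0Pn => e /setIP[eH ei]; have := subsetP sE e eH.
by rewrite /edges /= in_setD ei.
Qed.

(** A connected subgraph on n - r vertices that avoids the cut lies inside U or
    outside U, and neither has room for it. *)
Lemma c_cut (U : {set V}) : U \subset vertices G -> r.+1 <= #|U| -> #|U| + r.+1 <= n ->
  c <= #|cut_edges K E U|.
Proof.
move=> UV rU Un; rewrite cE; apply: deletion_bound => H sH /andP[sHG _]; apply/negP => iH.
have [cH vH conH] := in_tree_family sHG iH.
have cutH u v : u \in U -> v \notin U -> [set u; v] \in edges H -> False.
  move=> uU vU uvH; have /andP[_ sE] := sH; have := subsetP sE _ uvH.
  rewrite {1}/edges /= in_setD => /andP[/negP nc uvG]; apply: nc.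
  rewrite inE -/EG -edgesG uvG /=; apply/andP; split.
    by apply/set0Pn; exists u; rewrite in_setI set21.
  by apply/subsetPn; exists v; rewrite ?set22.
have [/eqP e|/set0Pn[u /setIP[uH uU]]] := boolP (vertices H :&: U == set0).
  have : #|vertices H| + #|U| <= n.
    have <- : #|vertices H :|: U| = #|vertices H| + #|U| by rewrite cardsU e cards0 subn0.
    by apply: subset_leq_card; rewrite subUset vH.
  by rewrite cH; have := r_lt_n; move: rU; clear; move: n => n0; lia.
have [sub|/subsetPn[w wH wU]] := boolP (vertices H \subset U).
  have := subset_leq_card sub; rewrite cH; move: Un; have := r_lt_n; clear.
  by move: n => n0; lia.
have [a [b [aU bU abH _]]] := crossing_edge (conH u w uH wH) uU wU.
exact: cutH abH.
Qed.

Lemma mindegK v : v \in vertices G -> 5 * n <= 6 * #|nbr K v|.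
Proof.
move=> vG; apply: leq_trans degD _; rewrite leq_mul2l /=.
have vD : v \in vertices (D ord_max) by have /andP[_ /eqP->] := spanD.
exact: min_degree_le.
Qed.

Theorem chromatic_cut : chromatic_number (kneser_graph G D F) = c.
Proof.
apply/eqP; rewrite eqn_leq; apply/andP; split.
  by rewrite cE; apply: chromatic_upper.
have K2 e : e \in K -> #|e| = 2 /\ e \subset vertices G.
  by move=> eK; apply: EGprop; rewrite in_setU eK.
have E2 (i : 'I_k) e : e \in E i -> #|e| = 2 by move/edgesP => [].
have singles (i j l : 'I_k) : uniq [:: i; j; l] -> ~ [/\ #|E i| = 1, #|E j| = 1 & #|E l| = 1].
  by move=> u [e1 e2 e3]; have := triple u; rewrite e1 e2 e3; clear; lia.
have kI : 10 * #|'I_k| <= m by rewrite card_ord; move: k_small; clear; lia.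
have [sigma [Bow [us sE [BK Bdis Bdeg] ord]]] :=
  ordering K2 E2 EKdis EEdis singles mindegK m_small sh_small rho_small kI m_large (ltn0Sn r).
apply: (@chromatic_lower _ _ G D F (ltn0Sn k) sigma) => //.
- by move=> e; rewrite sE edgesG.
- by rewrite cE leq_subr.
move=> S p sS alt few.
have [bal sing cst hubs exact_cost] := ord (mem S) p alt.
have := @survivors_tree V _ (vertices G) K E r.+1 m c Bow (mem S) p EGprop EKdis EEdis (ltn0Sn r).
case.
- by have := leq_trunc_div n 100; move: rho_small sh_small m_small; clear; rewrite -/n;
    move: (n %/ 100) n => a b; lia.
- by move: rho_small sh_small; clear; lia.
- by rewrite card_ord.
- by move=> i j l u; rewrite card_ord; apply: triple.
- exact: c_colour.
- exact: c_cut.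
- by move: few; rewrite edgesG.
- exact: Bdis.
- exact: Bdeg.
- exact: bal.
- exact: sing.
- exact: cst.
- exact: hubs.
- exact: exact_cost.
move=> b [T [tT [vT cT] eT hE hK]]; exists b, T; split; last by rewrite edgesG.
have sT : subgraph T G.
  rewrite /subgraph vT edgesG; apply: subset_trans eT _.
  by apply/subsetP => e; rewrite in_set => /andP[].
rewrite inE; apply/andP; split.
  rewrite /family_subgraph sT; apply/forallP => i.
  case: (unliftP ord_max i) => [j|] -> //.
  have := hE j; rewrite /E; congr (edges T :&: edges (D _) != set0).
  by apply: val_inj; rewrite /= /bump leqNgt ltn_ord.
apply/exists_inP; exists T; last exact: isomorphic_refl.
by rewrite inE sT tT cT /=.
Qed.
End Finite.

Unset Implicit Arguments.
From mathcomp Require Import all_boot all_order all_algebra.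
From mathcomp Require Import all_classical all_reals all_analysis.
Import Order.TTheory GRing.Theory Num.Theory.
Import numFieldNormedType.Exports.
Local Open Scope classical_set_scope.
Local Open Scope ring_scope.

(** * Asymptotics *)

Lemma littleo_linear (R : realType) (f : nat -> nat) (C : nat) :
  (fun n => (f n)%:R : R^o) =o_\oo (fun n => n%:R : R^o) ->
  exists N, forall n, (N <= n)%N -> (C * f n <= n)%N.
Proof.
have e0 : 0 < (C.+1%:R : R)^-1 by rewrite invr_gt0.
move/eqoP => /(_ _ e0) [N _ hN]; exists N => n /hN /=.
rewrite !normr_nat ler_pdivlMl // -natrM ler_nat.
by apply: leq_trans; rewrite leq_mul.
Qed.

Lemma littleo_sqrt (R : realType) (f : nat -> nat) (C : nat) :
  (fun n => (f n)%:R : R^o) =o_\oo (fun n => Num.sqrt n%:R : R^o) ->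
  exists N, forall n, (N <= n)%N -> (C * (f n * f n) <= n)%N.
Proof.
have e0 : 0 < (C.+1%:R : R)^-1 by rewrite invr_gt0.
move/eqoP => /(_ _ e0) [N _ hN]; exists N => n /hN /=.
rewrite normr_nat ger0_norm ?sqrtr_ge0 // ler_pdivlMl // -natrM => le_f.
have le2 : ((C.+1 * f n) ^ 2)%:R <= n%:R :> R.
  by rewrite natrX -(sqr_sqrtr (ler0n R n)) ler_pXn2r ?nnegrE ?sqrtr_ge0.
move: le2; rewrite ler_nat; apply: leq_trans.
rewrite expnMn -mulnn leq_mul // ?mulnn //.
by rewrite -mulnn (leq_trans (leqnSn C)) // leq_pmulr.
Qed.

Lemma degree_ratio (R : realType) (delta : R) (n d : nat) :
  5 / 6 < delta -> delta * n%:R <= d%:R -> (5 * n <= 6 * d)%N.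
Proof.
move=> ld le_d; rewrite -(ler_nat R) !natrM -ler_pdivrMl // mulrA.
apply: le_trans le_d; rewrite ler_wpM2r //.
by rewrite mulrC ltW.
Qed.

(** The number m of bow-ties at each vertex is about n / 400000, and the degree
    threshold sh of the hub gadgets about a tenth of it.  The argument is carried
    out for unknown factors, because the constant C is too large to be computed
    in unary. *)
Lemma parameters : exists C, forall n k r : nat,
  (0 < r)%N -> (C * r <= n)%N -> (C * (k * k) <= n)%N ->
  exists m sh : nat,
  [/\ (4000 * m <= n %/ 100)%N, (10 * sh <= m)%N, (200 * (360 * r.+1) <= sh)%N,
      (10 * k <= m)%N & (100 <= m)%N /\ (10 * (k * k) <= n)%N].
Proof.
have general a b w u : (0 < a)%N -> (0 < b)%N -> exists C, forall n k r : nat,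
    (0 < r)%N -> (C * r <= n)%N -> (C * (k * k) <= n)%N ->
    exists m sh : nat, [/\ (b * m <= n %/ a)%N, (10 * sh <= m)%N, (u * r.+1 <= sh)%N,
      (10 * k <= m)%N & (w <= m)%N /\ (10 * (k * k) <= n)%N].
  move=> a0 b0.
  have [C] : exists C, C = ((10 + w + 20 * u) * (b * a))%N by eexists.
  move=> CE; exists C => n k r r0 Cr Ck.
  have to_m x y : (C * y <= n)%N -> (x <= (10 + w + 20 * u) * y)%N -> (x <= n %/ a %/ b)%N.
    move=> Cy xy; rewrite !leq_divRL // -mulnA; apply: leq_trans Cy.
    by rewrite CE mulnAC leq_mul2r xy orbT.
  exists (n %/ a %/ b)%N, (n %/ a %/ b %/ 10)%N; split.
  - by rewrite mulnC leq_trunc_div.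
  - by rewrite mulnC leq_trunc_div.
  - rewrite leq_divRL //; apply: to_m Cr _.
    have : (u * r.+1 <= u * (2 * r))%N by rewrite leq_mul //; lia.
    by clear; nia.
  - apply: to_m Ck _; apply: leq_mul; first by clear; lia.
    by case: (k) => // k'; rewrite leq_pmulr.
  split; first by apply: to_m Cr _; clear -r0; nia.
  apply: leq_trans Ck; rewrite CE leq_mul2r; apply/orP; right.
  by apply: leq_trans (_ : 10 + w + 20 * u <= _)%N; [clear; lia|rewrite leq_pmulr // muln_gt0 b0].
have [C hC] := general 100%N 4000%N 100%N (200 * 360)%N isT isT.
exists C => n k r r0 Cr Ck; have [m [sh [h1 h2 h3 h4 h5]]] := hC n k r r0 Cr Ck.
by exists m, sh; split=> //; rewrite mulnA.
Qed.

Theorem theorem2 (R : realType) (delta : R) (k r : nat -> nat)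
  (delta_gt : 5 / 6 < delta) (delta_lt : delta < 1)
  (k_gt0 : forall n, (0 < n)%N -> (0 < k n)%N)
  (r_gt0 : forall n, (0 < n)%N -> (0 < r n)%N)
  (k_small : (fun n => (k n)%:R : R^o) =o_\oo (fun n => Num.sqrt n%:R : R^o))
  (r_small : (fun n => (r n)%:R : R^o) =o_\oo (fun n => n%:R : R^o)) :
  exists N : nat, forall n : nat, (N <= n)%N ->
  forall (V : finType) (G : sgraph V) (D : 'I_(k n) -> sgraph V),
    #|vertices G| = n ->
    decomposition G D ->
    (forall i, (1 <= #|edges (D i)|)%N) ->
    (forall i j : 'I_(k n), (i <= j)%N ->
       (#|edges (D i)| <= #|edges (D j)|)%N) ->
    (k n <= 2)%N \/
      (3 * 'C(2 * k n - 3, 2) + 4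
         <= \sum_(i < k n | (i < 3)%N) #|edges (D i)|)%N ->
    (forall i : 'I_(k n), i.+1 = k n ->
       spanning (D i) G /\ delta * n%:R <= (min_degree (D i))%:R) ->
    chromatic_number (kneser_graph G D (tree_family G (n - r n)))
      = cut_number G D (r n + 1).
Proof.
have [C hC] := parameters.
have [Nk hk] := littleo_sqrt R k C k_small.
have [Nr hr] := littleo_linear R r C r_small.
exists (maxn 1 (maxn Nk Nr)) => n; rewrite !geq_max => /and3P[n0 /hk kn /hr rn] V G D Gn.
move: (k n) (k_gt0 n n0) kn D => [//|kn] _ hkn D decD edgeD sortedD sumD lastD.
have [m [sh [h1 h2 h3 h4 [h5 h6]]]] := hC n kn.+1 (r n) (r_gt0 n n0) rn hkn.
have [spanD degD] := lastD ord_max erefl.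
rewrite -{1}Gn.
apply: (@chromatic_cut V G kn (r n) m sh D) => //; rewrite ?Gn //.
exact: degree_ratio delta_gt degD.
Qed.
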